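(* Let $\mathcal{V}$ be a finite veering triangulation of a connected 3-manifold $M$. Then $$\Theta_{\mathcal{V}} = \Delta_M^{\omega \otimes \pi}$$ (up to a unit of $\mathbb{Z}[H_M]$), where $\Theta_{\mathcal V}$ is the taut polynomial of $\mathcal V$, $\omega: \pi_1(M) \rightarrow \{-1, 1\}=\mathrm{GL}(1,\mathbb{Z})$ is the edge-orientation homomorphism of $\mathcal{V}$, $\pi:\pi_1(M) \rightarrow H_M$ is the natural projection, and $\Delta_M^{\omega\otimes\pi}$ is the Alexander polynomial of $M$ twisted by $\omega\otimes\pi$.
   Context: Veering triangulations. $M$ is a connected oriented 3-manifold. An ideal triangulation of $M$ is a decomposition of (the interior of) $M$ into ideal tetrahedra; $T,F,E$ denote the sets of tetrahedra, triangles and edges. An ideal tetrahedron with cooriented faces is transverse taut if the coorientation points out of two faces (top faces) and into the other two (bottom faces). The common edge of the top faces is the top diagonal, the common edge of the bottom faces is the bottom diagonal, the other four edges are equatorial. The tetrahedron is immediately below its top faces and immediately above its bottom faces. Diagonals get angle $\pi$, equatorial edges get angle $0$. A triangulation is transverse taut if its triangles are cooriented so that every tetrahedron is transverse taut and the angles around every edge sum to $2\pi$. It is veering if moreover its edges are coloured red or blue so that in every tetrahedron, drawn (respecting the orientation of $M$) as a flat quadrilateral with face coorientations pointing towards the viewer, top diagonal vertical and bottom diagonal horizontal, the equatorial edges of positive slope are red and those of negative slope are blue (no condition on diagonals). It is finite if $T$ is finite; then $M$ is a cusped hyperbolic manifold with torus cusps, and $M$ also denotes the compact manifold obtained by truncating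 the cusps. Veering triangulations lift to covers. Upper track. The cooriented 2-skeleton is regarded as a branched surface $\mathcal B$. The upper track $\tau$ is the train track in $\mathcal B$ which in each triangle $f$ consists of three half-branches joining a switch in the interior of $f$ to the midpoints of the three edges of $f$; one half-branch is large, the other two are small and merge smoothly into the large one (forming a cusp with each other); the large half-branch ends on the edge of $f$ that is the bottom diagonal of the tetrahedron immediately above $f$. This edge is the upper large edge of $f$. The track is transversely orientable if it admits a nonvanishing continuous vector field tangent to $\mathcal B$ and transverse to the track; $\mathcal V$ is edge-orientable if its upper track is transversely orientable. Edge-orientation homomorphism. The upper track restricted to the four faces of a tetrahedron has exactly two (opposite) transverse orientations, each inducing orientations of the edges of the tetrahedron. The edge-orientation double cover $\mathcal V^{or}\to\mathcal V$ is built from two copies $t,\overline t$ of each tetrahedron $t$, carrying the two opposite transverse orientations and the induced edge orientations; the faces of these copies are glued as in $\mathcal V$, in the unique way that matches edge orientations. Then $\omega:\pi_1(M)\to\{-1,1\}$ is defined by $\omega(\gamma)=1$ if $\gamma$ lifts to a loop in $\mathcal V^{or}$ and $\omega(\gamma)=-1$ otherwise. Algebra. $H_M = H_1(M;\mathbb{Z})/\text{torsion}$, written multiplicatively; $M^{fab}$ is the regular cover of $M$ with deck group $H_M$ and $\mathcal V^{fab}$ its induced veering triangulation. For a finitely presented $\mathbb{Z}[H]$-module with $l\times k$ presentation matrix $A$ ($l$ generators), the zeroth Fitting invariant is the greatest common divisor of the $l\times l$ minors of $A$ ($0$ if all vanish); it is defined up to a unit, and all equalities of polynomials are up to a unit.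 Twisted Alexander polynomial. For $\varphi:\pi_1(M)\to \mathrm{GL}(k,\mathbb{Z})$, put $(\varphi\otimes\pi)(\gamma)=\varphi(\gamma)\cdot\pi(\gamma)\in\mathrm{GL}(k,\mathbb{Z}[H_M])$, making $\mathbb{Z}[H_M]^k$ a $\mathbb{Z}[\pi_1(M)]$-module. $\Delta_M^{\varphi\otimes\pi}\in\mathbb{Z}[H_M]$ is the zeroth Fitting invariant of the first homology of $C_*(\widetilde M)\otimes_{\mathbb{Z}[\pi_1(M)]}\mathbb{Z}[H_M]^k$, where $\widetilde M$ is the universal cover. Taut polynomial. Choosing lifts, identify triangles and edges of $\mathcal V^{fab}$ with $H_M\times F$ and $H_M\times E$. Let $D:\mathbb{Z}[H_M]^F\to\mathbb{Z}[H_M]^E$ be the homomorphism sending a triangle with upper large edge $h_0\cdot e_0$ and other edges $h_1\cdot e_1,h_2\cdot e_2$ to $h_0\cdot e_0-h_1\cdot e_1-h_2\cdot e_2$. Then $\Theta_{\mathcal V}\in\mathbb{Z}[H_M]$ is the zeroth Fitting invariant of $\operatorname{coker} D$, i.e. the gcd of the maximal minors of $D$. *)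

(* Defs.v *)
From HB Require Import structures.
From mathcomp Require Import all_boot all_order all_algebra all_fingroup.
From mathcomp Require Import generic_quotient ring_quotient.
From mathcomp Require Import finmap.
From mathcomp.multinomials Require Import monalg.
From mathcomp Require Import boolp.
From Stdlib Require Import Relation_Operators Operators_Properties.

Set Implicit Arguments.
Unset Strict Implicit.
Unset Printing Implicit Defensive.

Import GRing.Theory.
Local Open Scope ring_scope.
Local Open Scope quotient_scope.

Definition group_ring (H : zmodType) : Type := {malg int[H]}.

Section GroupRing.
Variable H : zmodType.

HB.instance Definition _ := GRing.Zmodule.on (group_ring H).

Local Notation G := {malg int[H]}.

Definition gr_elt (h : H) : group_ring H := mkmalgU h 1.

Definition gr_mul (g1 g2 : group_ring H) : group_ring H :=
  (\sum_(h1 <- msupp (g1 : G)) \sum_(h2 <- msupp (g2 : G))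
     mkmalgU (h1 + h2) (mcoeff h1 g1 * mcoeff h2 g2) : G).

Lemma gr_mulw (d1 d2 : {fset H}) (g1 g2 : G) :
  (msupp g1 `<=` d1)%fset -> (msupp g2 `<=` d2)%fset ->
  gr_mul g1 g2 = (\sum_(h1 <- d1) \sum_(h2 <- d2)
     mkmalgU (h1 + h2) (mcoeff h1 g1 * mcoeff h2 g2) : G).
Proof.
move=> le1 le2; rewrite /gr_mul (big_fset_incl _ le1) /=; last first.
  by move=> k _ /mcoeff_outdom zk; rewrite big1 // => k2 _; rewrite zk mul0r monalgU0.
apply/eq_bigr=> k1 _; apply/big_fset_incl => // k _ /mcoeff_outdom zk.
by rewrite zk mulr0 monalgU0.
Qed.

Lemma gr_mulC : commutative gr_mul.
Proof.
move=> g1 g2; rewrite /gr_mul exchange_big /=.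
by apply/eq_bigr=> k1 _; apply/eq_bigr=> k2 _; rewrite mulrC addrC.
Qed.

Lemma gr_mulDl : left_distributive gr_mul +%R.
Proof.
move=> g1 g2 g.
rewrite (gr_mulw (msuppD_le (g1 : G) (g2 : G)) (fsubset_refl (msupp (g : G)))).
rewrite (gr_mulw (fsubsetUl (msupp (g1 : G)) (msupp (g2 : G))) (fsubset_refl _)).
rewrite (gr_mulw (fsubsetUr (msupp (g1 : G)) (msupp (g2 : G))) (fsubset_refl _)).
rewrite -big_split; apply/eq_bigr=> k1 _; rewrite -big_split /=.
by apply/eq_bigr=> k2 _; rewrite mcoeffD mulrDl monalgUD.
Qed.

Lemma gr_mul0 : left_zero 0 gr_mul.
Proof. by move=> g; rewrite /gr_mul msupp0 big_seq_fset0. Qed.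

Lemma gr_mul_suml I (r : seq I) (F : I -> group_ring H) (g : group_ring H) :
  gr_mul (\sum_(i <- r) F i) g = \sum_(i <- r) gr_mul (F i) g.
Proof.
by apply: (big_morph (gr_mul^~ g)) => [x y|]; rewrite ?gr_mulDl ?gr_mul0.
Qed.

Lemma gr_mul_sumr I (r : seq I) (F : I -> group_ring H) (g : group_ring H) :
  gr_mul g (\sum_(i <- r) F i) = \sum_(i <- r) gr_mul g (F i).
Proof. by rewrite gr_mulC gr_mul_suml; apply: eq_bigr => i _; rewrite gr_mulC. Qed.

Lemma gr_mulUU (h1 h2 : H) (a1 a2 : int) :
  gr_mul (mkmalgU h1 a1) (mkmalgU h2 a2) = mkmalgU (h1 + h2) (a1 * a2).
Proof.
by rewrite (gr_mulw msuppU_le msuppU_le) !big_seq_fset1 !mcoeffUU.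
Qed.

Lemma gr_sumE (g : group_ring H) :
  g = \sum_(h <- msupp (g : G)) (mkmalgU h (mcoeff h (g : G)) : group_ring H).
Proof. exact: monalgE. Qed.

Lemma gr_mulA : associative gr_mul.
Proof.
move=> g1 g2 g3; rewrite [g1]gr_sumE [g2]gr_sumE [g3]gr_sumE.
rewrite !gr_mul_suml; apply: eq_bigr => k1 _.
rewrite (gr_mul_sumr (msupp (g2 : G))) (gr_mul_sumr (msupp (g2 : G))).
rewrite (gr_mul_suml (msupp (g2 : G))); apply: eq_bigr => k2 _.
rewrite !(gr_mul_sumr (msupp (g3 : G))); apply: eq_bigr => k3 _.
by rewrite !gr_mulUU addrA mulrA.
Qed.

Lemma gr_mul1 : left_id (gr_elt 0) gr_mul.
Proof.
move=> g; rewrite [g]gr_sumE gr_mul_sumr; apply: eq_bigr => k _.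
by rewrite gr_mulUU add0r mul1r.
Qed.

Lemma gr_one_neq0 : gr_elt 0 != 0 :> group_ring H.
Proof. by apply/eqP => /(congr1 (mcoeff 0)); rewrite mcoeffUU mcoeff0. Qed.

HB.instance Definition _ := GRing.Zmodule_isComNzRing.Build (group_ring H)
  gr_mulA gr_mulC gr_mul1 gr_mulDl gr_one_neq0.

End GroupRing.

Definition divides (R : comNzRingType) (a b : R) : Prop := exists c, b = c * a.

Definition unit_eq (R : comNzRingType) (a b : R) : Prop :=
  exists u v : R, u * v = 1 /\ a = u * b.

(* If all members of [S] vanish, or if [S] is empty, this forces [g = 0]. *)
Definition is_gcd (R : comNzRingType) (S : R -> Prop) (g : R) : Prop :=
  (forall s, S s -> divides g s) /\
  (forall d, (forall s, S s -> divides d s) -> divides d g).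

Definition maximal_minor (R : comNzRingType) (l k : nat) (A : 'M[R]_(l, k))
    (m : R) : Prop :=
  exists2 c : 'I_l -> 'I_k, injective c & m = \det (colsub c A).

(* [A] is a presentation matrix, with one row per generator and one column per
   relation, of the quotient [Z / B] of two submodules [B <= Z] of [M]. *)
Definition presents (R : comNzRingType) (M : lmodType R) (Z B : M -> Prop)
    (l k : nat) (A : 'M[R]_(l, k)) : Prop :=
  exists z : 'I_l -> M,
    [/\ forall i, Z (z i),
        forall c, Z c -> exists x : 'cV[R]_l, B (c - \sum_i x i 0 *: z i)
      & forall x : 'cV[R]_l,
          B (\sum_i x i 0 *: z i) <-> exists y : 'cV[R]_k, x = A *m y].

Definition is_fitting_invariant (R : comNzRingType) (M : lmodType R)
    (Z B : M -> Prop) (g : R) : Prop :=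
  exists l k (A : 'M[R]_(l, k)), presents Z B A /\ is_gcd (maximal_minor A) g.

(* The vertices of every tetrahedron [t] are labelled by ['I_4] so that
   [0, 1, 2, 3] is positively oriented: [det (v1 - v0, v2 - v0, v3 - v0) > 0].
   The face of [t] opposite to the vertex [i] is glued, by the restriction of
   the permutation [gluing t i], to the face of [neighbour t i] opposite to
   [gluing t i i].  The manifold is the union of the tetrahedra with their
   vertices removed. *)
Record triangulation := Triangulation {
  tet : finType;
  neighbour : tet -> 'I_4 -> tet;
  gluing : tet -> 'I_4 -> 'S_4;
  neighbourK : forall t i, neighbour (neighbour t i) (gluing t i i) = t;
  gluingK : forall t i,
    gluing (neighbour t i) (gluing t i i) = (gluing t i)^-1%g;
  gluing_odd : forall t i, odd_perm (gluing t i)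
}.

Section Triangulation.
Variable V : triangulation.

(* A pair [(t, i)] stands for the face of [t] opposite to [i], and, as a step,
   for the path of the dual graph that leaves [t] through this face. *)
Definition face := (tet V * 'I_4)%type.

Definition opposite (s : face) : face := (neighbour s.1 s.2, gluing s.1 s.2 s.2).

Lemma oppositeK : involutive opposite.
Proof. by case=> t i; rewrite /opposite /= neighbourK gluingK permK. Qed.

(* A pair [(t, A)] with [#|A| = 2] stands for the edge of [t] with set of
   endpoints [A].  The edges of the triangulation are the classes of such pairs
   under the gluings. *)
Definition local_edge := (tet V * {set 'I_4})%type.

Definition glued_edges : rel local_edge := fun x y =>
  [exists i, (i \notin x.2) &&
     (y == (neighbour x.1 i, [set gluing x.1 i a | a in x.2]))].

Definition edge_class (x : local_edge) : {set local_edge} :=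
  [set y | connect glued_edges x y].

Definition edge_classes : {set {set local_edge}} :=
  [set edge_class x | x in [set x : local_edge | #|x.2| == 2]].

Definition edge := {e : {set local_edge} | e \in edge_classes}.

(* M deformation retracts onto the 2-complex dual to the triangulation: it has
   one vertex per tetrahedron, one 1-cell per triangle and one 2-cell per edge.
   [walk x w y]: [w] is an edge path from [x] to [y] in the dual graph. *)
Fixpoint walk (x : tet V) (w : seq face) (y : tet V) : bool :=
  if w is s :: w' then (s.1 == x) && walk (opposite s).1 w' y else x == y.

Definition connected : Prop := forall x y, exists w, walk x w y.

Definition rev_walk (w : seq face) : seq face := rev (map opposite w).

(* A flag [(t, p)] stands for the edge of [t] with endpoints [p 0] and [p 1],
   about to be turned around by leaving [t] through the face opposite to
   [p 2]. *)
Definition flag := (tet V * 'S_4)%type.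

Definition o0 : 'I_4 := @Ordinal 4 0 isT.
Definition o1 : 'I_4 := @Ordinal 4 1 isT.
Definition o2 : 'I_4 := @Ordinal 4 2 isT.
Definition o3 : 'I_4 := @Ordinal 4 3 isT.

Definition flag_step (x : flag) : face := (x.1, x.2 o2).

Definition flag_edge (x : flag) : local_edge := (x.1, [set x.2 o0; x.2 o1]).

(* After crossing the face, the tetrahedron has been entered through the face
   opposite to the image of [p 2] and is left through that opposite to the image
   of [p 3]. *)
Definition turn (x : flag) : flag :=
  ((opposite (flag_step x)).1, (tperm o2 o3 * (x.2 * gluing x.1 (x.2 o2)))%g).

(* The first [n] steps of the walk around an edge; the boundary of the dual
   2-cell is the complete turn. *)
Definition around (x : flag) (n : nat) : seq face :=
  [seq flag_step y | y <- traject turn x n].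

Definition cell_boundary (x : flag) : seq face := around x (fingraph.order turn x).

Definition null_loop (r : seq face) : Prop :=
  (exists s, r = [:: s; opposite s]) \/ (exists f, r = cell_boundary f).

Definition elementary_homotopy (x y : tet V) (w w' : seq face) : Prop :=
  [/\ walk x w y, walk x w' y &
      exists u r v, [/\ w = u ++ r ++ v, w' = u ++ v & null_loop r]].

Definition homotopic (x y : tet V) : seq face -> seq face -> Prop :=
  clos_refl_sym_trans _ (elementary_homotopy x y).

Definition dual_path (x y : tet V) := {w : seq face | walk x w y}.

Variable t0 : tet V.

Definition homotopicb (w w' : dual_path t0 t0) : bool :=
  `[< homotopic t0 t0 (val w) (val w') >].

Lemma homotopicb_equiv : equiv_class_of homotopicb.
Proof.
split=> [w|w w'|w2 w1 w3].
- by apply/asboolP; apply: rst_refl.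
- by apply/asboolP/asboolP => h; apply: rst_sym.
- move=> /asboolP h1 /asboolP h2; apply/asboolP.
  exact: rst_trans h1 h2.
Qed.

Canonical homotopicb_equivRel := EquivRelPack homotopicb_equiv.
Canonical homotopicb_encModRel := defaultEncModRel homotopicb.

Definition pi1 := {eq_quot homotopicb}.

HB.instance Definition _ := Choice.on pi1.
HB.instance Definition _ := EqQuotient.on pi1.

Lemma walk_cat (x y : tet V) u v :
  walk x (u ++ v) y <-> exists2 z, walk x u z & walk z v y.
Proof.
elim: u x => [|s u IH] x /=; split.
- by exists x.
- by case=> z /eqP->.
- by case/andP=> -> /IH [z h1 h2]; exists z.
- by case=> z /andP[-> h1] h2; apply/IH; exists z.
Qed.

Lemma cat_walk (x y z : tet V) u v : walk x u y -> walk y v z -> walk x (u ++ v) z.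
Proof. by move=> h1 h2; apply/walk_cat; exists y. Qed.

Lemma walk_rev (x y : tet V) w : walk x w y -> walk y (rev_walk w) x.
Proof.
elim: w x => [|s w IH] x /=; first by rewrite eq_sym.
case/andP=> /eqP<- /IH h; rewrite /rev_walk /= rev_cons -cats1.
by apply: cat_walk h _; rewrite /= neighbourK !eqxx.
Qed.

Definition path_refl (x : tet V) : dual_path x x := exist _ [::] (eqxx x).

Definition path_cat (x y z : tet V) (u : dual_path x y) (v : dual_path y z) :
  dual_path x z := exist _ (val u ++ val v) (cat_walk (valP u) (valP v)).

Definition path_rev (x y : tet V) (u : dual_path x y) : dual_path y x :=
  exist _ (rev_walk (val u)) (walk_rev (valP u)).

Lemma walk_step (s : face) : walk s.1 [:: s] (opposite s).1.
Proof. by rewrite /= !eqxx. Qed.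

Definition path_step (s : face) : dual_path s.1 (opposite s).1 :=
  exist _ [:: s] (walk_step s).

Lemma homotopic_cat (x y z t : tet V) u v w w' :
  walk x u y -> walk z v t -> homotopic y z w w' ->
  homotopic x t (u ++ w ++ v) (u ++ w' ++ v).
Proof.
move=> hu hv; elim=> [a b [wa wb [p [r [q [ea eb hr]]]]]|a|a b _ h|a b c _ h1 _ h2].
- apply: rst_step; split.
  + exact: cat_walk hu (cat_walk wa hv).
  + exact: cat_walk hu (cat_walk wb hv).
  + by exists (u ++ p), r, (q ++ v); rewrite ea eb -!catA.
- exact: rst_refl.
- exact: rst_sym.
- exact: rst_trans h1 h2.
Qed.

Lemma rev_walkK : involutive rev_walk.
Proof.
move=> w; rewrite /rev_walk map_rev revK -map_comp.
by rewrite (eq_map (g := id)) ?map_id // => s; apply: oppositeK.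
Qed.

Lemma rev_walk_cat u v : rev_walk (u ++ v) = rev_walk v ++ rev_walk u.
Proof. by rewrite /rev_walk map_cat rev_cat. Qed.

Lemma homotopic_cancel (x y : tet V) w :
  walk x w y -> homotopic x x (w ++ rev_walk w) [::].
Proof.
elim: w x => [|s w IH] x /=; first by move=> _; apply: rst_refl.
case/andP=> /eqP<- h.
have -> : s :: w ++ rev_walk (s :: w) = [:: s] ++ (w ++ rev_walk w) ++ [:: opposite s].
  by rewrite /rev_walk /= rev_cons -cats1 -catA.
have hs : walk (opposite s).1 [:: opposite s] s.1.
  by rewrite /= neighbourK !eqxx.
apply: rst_trans (homotopic_cat (walk_step s) hs (IH _ h)) _.
apply: rst_step; split => /=; rewrite ?neighbourK ?eqxx //.
by exists [::], [:: s; opposite s], [::]; split=> //; left; exists s.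
Qed.

Lemma homotopic_cancel_rev (x y : tet V) w :
  walk x w y -> homotopic y y (rev_walk w ++ w) [::].
Proof. by move=> /walk_rev/homotopic_cancel; rewrite rev_walkK. Qed.

Lemma homotopic_walk (x y : tet V) w w' : homotopic x y w w' -> walk x w y = walk x w' y.
Proof. by elim=> [a b [-> ->]|//|a b _ ->|a b c _ -> _ ->]. Qed.

Lemma homotopic_rev (x y : tet V) w w' :
  homotopic x y w w' -> walk x w y -> homotopic y x (rev_walk w) (rev_walk w').
Proof.
move=> h hw; have hw' : walk x w' y by rewrite -(homotopic_walk h).
have h1 := homotopic_cat (walk_rev hw) (walk_rev hw') h.
have h2 := homotopic_cat (walk_rev hw) (eqxx x : walk x [::] x)
  (homotopic_cancel hw').
have h3 := homotopic_cat (eqxx y : walk y [::] y) (walk_rev hw')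
  (homotopic_cancel_rev hw).
rewrite !cats0 in h2; rewrite /= -catA in h3.
apply: rst_trans (rst_sym _ _ _ _ h2) _.
by apply: rst_trans (rst_sym _ _ _ _ h1) h3.
Qed.

Definition loop_class (w : dual_path t0 t0) : pi1 := \pi w.

Lemma loop_classE w w' :
  loop_class w = loop_class w' <-> homotopic t0 t0 (val w) (val w').
Proof.
split; first by move/eqmodP/asboolP.
by move=> h; apply/eqmodP/asboolP.
Qed.

Definition pi1_one : pi1 := loop_class (path_refl t0).
Definition pi1_mul (a b : pi1) : pi1 := loop_class (path_cat (repr a) (repr b)).
Definition pi1_inv (a : pi1) : pi1 := loop_class (path_rev (repr a)).

Lemma loop_class_repr a : loop_class (repr a) = a.
Proof. exact: reprK. Qed.

Lemma repr_loop_class w : homotopic t0 t0 (val (repr (loop_class w))) (val w).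
Proof. by apply/loop_classE; rewrite loop_class_repr. Qed.

Lemma pi1_mulE w w' :
  pi1_mul (loop_class w) (loop_class w') = loop_class (path_cat w w').
Proof.
apply/loop_classE => /=.
set a := repr _; set b := repr _.
have ha := homotopic_cat (eqxx t0 : walk t0 [::] t0) (valP b) (repr_loop_class w).
have hb := homotopic_cat (valP w) (eqxx t0 : walk t0 [::] t0) (repr_loop_class w').
by rewrite !cats0 in hb; apply: rst_trans ha hb.
Qed.

Lemma pi1_invE w : pi1_inv (loop_class w) = loop_class (path_rev w).
Proof.
apply/loop_classE; have := homotopic_rev (repr_loop_class w); apply.
exact: valP (repr (loop_class w)).
Qed.

Lemma pi1_mulA : associative pi1_mul.
Proof.
move=> a b c; rewrite -[a]loop_class_repr -[b]loop_class_repr -[c]loop_class_repr.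
rewrite !pi1_mulE; apply/loop_classE => /=; rewrite catA; exact: rst_refl.
Qed.

Lemma pi1_mul1 : left_id pi1_one pi1_mul.
Proof.
move=> a; rewrite -[a]loop_class_repr pi1_mulE; apply/loop_classE; exact: rst_refl.
Qed.

Lemma pi1_mulr1 : right_id pi1_one pi1_mul.
Proof.
move=> a; rewrite -[a]loop_class_repr pi1_mulE; apply/loop_classE => /=.
rewrite cats0; exact: rst_refl.
Qed.

Lemma pi1_mulV : left_inverse pi1_one pi1_inv pi1_mul.
Proof.
move=> a; rewrite -[a]loop_class_repr pi1_invE pi1_mulE; apply/loop_classE.
exact: homotopic_cancel_rev (valP (repr a)).
Qed.

Lemma pi1_mulrV : right_inverse pi1_one pi1_inv pi1_mul.
Proof.
move=> a; rewrite -[a]loop_class_repr pi1_invE pi1_mulE; apply/loop_classE.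
exact: homotopic_cancel (valP (repr a)).
Qed.

HB.instance Definition _ :=
  isGroup.Build pi1 pi1_mulA pi1_mul1 pi1_mulr1 pi1_mulV pi1_mulrV.

End Triangulation.

Section Diagonals.
Variables (V : triangulation) (out : tet V -> 'I_4 -> bool).

Definition top_diagonal_of (t : tet V) : {set 'I_4} :=
  \bigcap_(i | out t i) ~: [set i].
Definition bottom_diagonal_of (t : tet V) : {set 'I_4} :=
  \bigcap_(i | ~~ out t i) ~: [set i].

Definition is_diagonal_of (x : local_edge V) : bool :=
  (x.2 == top_diagonal_of x.1) || (x.2 == bottom_diagonal_of x.1).

End Diagonals.

(* [points_out t i]: the coorientation of the face of [t] opposite to [i] points
   out of [t], so that this is a top face of [t].  The angle condition says that
   exactly two of the dihedral angles around any edge are equal to [pi]. *)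
Record transverse_taut := TransverseTaut {
  taut_triangulation :> triangulation;
  points_out : tet taut_triangulation -> 'I_4 -> bool;
  points_out_glued : forall s : face taut_triangulation,
    points_out (opposite s).1 (opposite s).2 = ~~ points_out s.1 s.2;
  two_top_faces : forall t, #|[set i | points_out t i]| = 2;
  angle_sum : forall x : local_edge taut_triangulation, #|x.2| = 2 ->
    #|[set y in edge_class x | is_diagonal_of points_out y]| = 2
}.

Definition top_diagonal (V : transverse_taut) (t : tet V) : {set 'I_4} :=
  top_diagonal_of (@points_out V) t.
Definition bottom_diagonal (V : transverse_taut) (t : tet V) : {set 'I_4} :=
  bottom_diagonal_of (@points_out V) t.

(* Place [p 0], [p 1] at the top and at the bottom of the vertical (top)
   diagonal, and [p 2], [p 3] at the left and at the right of the horizontal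
   (bottom) diagonal, which is behind the vertical one for the viewer; these
   vertices are in positive order when [p] is even. *)
Record veering := Veering {
  veering_taut :> transverse_taut;
  red : local_edge veering_taut -> bool;
  red_glued : forall x y : local_edge veering_taut,
    #|x.2| = 2 -> glued_edges x y -> red y = red x;
  red_slope : forall (t : tet veering_taut) (p : 'S_4), ~~ odd_perm p ->
    top_diagonal t = [set p o0; p o1] -> bottom_diagonal t = [set p o2; p o3] ->
    [/\ red (t, [set p o0; p o2]), red (t, [set p o1; p o3]),
        ~~ red (t, [set p o0; p o3]) & ~~ red (t, [set p o1; p o2])]
}.

Section Taut.
Variable V : transverse_taut.

(* A triangle is represented as a bottom face of the unique tetrahedron
   immediately above it. *)
Definition triangle := {s : face V | ~~ points_out s.1 s.2}.

Definition above (f : triangle) : tet V := (val f).1.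
Definition below (f : triangle) : tet V := (opposite (val f)).1.

Lemma opposite_bottom (s : face V) :
  points_out s.1 s.2 -> ~~ points_out (opposite s).1 (opposite s).2.
Proof. by rewrite points_out_glued negbK. Qed.

(* The 1-cells of the dual complex are oriented by the coorientation of the
   triangles. *)
Definition chain1 := {ffun triangle -> int}.

Definition step_chain (s : face V) : chain1 :=
  [ffun f => if points_out s.1 s.2 then (val f == opposite s)%:R
             else - (val f == s)%:R].

Definition walk_chain (w : seq (face V)) : chain1 := \sum_(s <- w) step_chain s.

Definition boundary1 (c : chain1) : {ffun tet V -> int} :=
  [ffun t => \sum_f c f * ((above f == t)%:R - (below f == t)%:R)].

Definition is_cycle : {pred chain1} := fun c => boundary1 c == 0.

Lemma boundary1_sub : {morph boundary1 : c d / c - d}.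
Proof.
move=> c d; apply/ffunP => t; rewrite !ffunE -sumrB.
by apply: eq_bigr => f _; rewrite !ffunE mulrBl.
Qed.

Lemma is_cycle_closed : zmod_closed is_cycle.
Proof.
split=> [|c d]; rewrite !unfold_in.
  by rewrite -(subrr (0 : chain1)) boundary1_sub subrr.
by rewrite boundary1_sub => /eqP-> /eqP->; rewrite subrr.
Qed.

HB.instance Definition _ := GRing.isZmodClosed.Build chain1 is_cycle is_cycle_closed.

Record cycle1 := Cycle1 { cycle_chain :> chain1; _ : is_cycle cycle_chain }.
HB.instance Definition _ := [isSub for cycle_chain].
HB.instance Definition _ := [Choice of cycle1 by <:].
HB.instance Definition _ := [SubChoice_isSubZmodule of cycle1 by <:].

(* The cycles some nonzero multiple of which is a boundary. *)
Definition rationally_null : {pred cycle1} := fun c =>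
  `[< exists n (z : {ffun flag V -> int}), (0 < n)%N /\
      val c *+ n = \sum_x walk_chain (cell_boundary x) *~ z x >].

Lemma rationally_null_closed : zmod_closed rationally_null.
Proof.
split=> [|c d].
  apply/asboolP; exists 1%N, 0; split=> //; rewrite big1 ?mul0rn // => x _.
  by rewrite ffunE mulr0z.
move=> /asboolP[n [z [n0 hz]]] /asboolP[m [y [m0 hy]]]; apply/asboolP.
exists (n * m)%N, [ffun x => z x * m%:Z - y x * n%:Z]; split.
  by rewrite muln_gt0 n0.
rewrite [val _]raddfB /= mulrnBl {1}mulrnA hz mulnC mulrnA hy -!sumrMnl -sumrB.
by apply: eq_bigr => x _; rewrite ffunE mulrzBr !mulrzA.
Qed.

HB.instance Definition _ :=
  GRing.isZmodClosed.Build cycle1 rationally_null rationally_null_closed.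

Definition HM : zmodType := Quotient.quot rationally_null.

Lemma boundary1_step (s : face V) t :
  boundary1 (step_chain s) t = ((opposite s).1 == t)%:R - (s.1 == t)%:R.
Proof.
rewrite ffunE; case: (boolP (points_out s.1 s.2)) => hs.
  rewrite (bigD1 (Sub (opposite s) (opposite_bottom hs))) //=.
  rewrite ffunE hs eqxx mul1r /above /below SubK oppositeK big1 ?addr0 // => f.
  by rewrite -val_eqE /= => /negPf hf; rewrite ffunE hs hf mul0r.
rewrite (bigD1 (Sub s hs)) //=.
rewrite ffunE (negPf hs) eqxx mulN1r opprB /above /below /= big1 ?addr0 // => f.
by rewrite -val_eqE /= => /negPf hf; rewrite ffunE (negPf hs) hf oppr0 mul0r.
Qed.

Lemma boundary1_walk x w y t :
  walk x w y -> boundary1 (walk_chain w) t = (y == t)%:R - (x == t)%:R.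
Proof.
have add c d : boundary1 (c + d) = boundary1 c + boundary1 d.
  have b0 : boundary1 0 = 0 by rewrite -(subrr (0 : chain1)) boundary1_sub subrr.
  by rewrite -[d in LHS]opprK boundary1_sub -[- d]sub0r boundary1_sub b0 sub0r opprK.
elim: w x => [|s w IH] x /=; rewrite /walk_chain.
  by move=> /eqP->; rewrite big_nil -(subrr (0 : chain1)) boundary1_sub !subrr ffunE.
case/andP=> /eqP<- /IH h; rewrite big_cons add ffunE boundary1_step [X in _ + X]h.
by rewrite addrC subrKA.
Qed.

Lemma walk_chain_cycle x w : walk x w x -> is_cycle (walk_chain w).
Proof.
move=> h; apply/eqP/ffunP => t.
by rewrite (boundary1_walk _ h) subrr ffunE.
Qed.

Variable t0 : tet V.

Definition loop_homology (w : dual_path t0 t0) : HM :=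
  \pi_(Quotient.quot rationally_null) (Cycle1 (walk_chain_cycle (valP w))).

Definition hurewicz (g : pi1 t0) : HM := loop_homology (repr g).

Lemma step_chain_opposite s : step_chain (opposite s) = - step_chain s.
Proof.
apply/ffunP => f; rewrite !ffunE points_out_glued oppositeK.
by case: points_out => //=; rewrite opprK.
Qed.

Lemma walk_chain_cat u v : walk_chain (u ++ v) = walk_chain u + walk_chain v.
Proof. exact: big_cat. Qed.

Lemma homotopic_homologous w w' : homotopic t0 t0 w w' ->
  exists z : {ffun flag V -> int},
    walk_chain w - walk_chain w' = \sum_x walk_chain (cell_boundary x) *~ z x.
Proof.
elim=> [a b [_ _ [u [r [v [-> -> hr]]]]]|a|a b _ [z hz]|a b c _ [z hz] _ [y hy]].
- have -> : walk_chain (u ++ r ++ v) - walk_chain (u ++ v) = walk_chain r.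
    by rewrite !walk_chain_cat opprD addrACA subrr add0r addrK.
  case: hr => [[s ->]|[f ->]].
    exists 0; rewrite big1 => [|x _]; last by rewrite ffunE.
    by rewrite /walk_chain big_cons big_seq1 step_chain_opposite subrr.
  exists [ffun x => (x == f)%:R]; rewrite (bigD1 f) //= ffunE eqxx big1 ?addr0 // => x.
  by rewrite ffunE => /negPf->.
- exists 0; rewrite subrr big1 // => x _; by rewrite ffunE.
- exists (- z); rewrite -opprB hz -sumrN; apply: eq_bigr => x _.
  by rewrite ffunE mulrNz.
- exists (z + y); rewrite -(subrKA (walk_chain b)) hz hy -big_split /=.
  by apply: eq_bigr => x _; rewrite ffunE mulrzDr.
Qed.

Lemma hurewicz_loop w : hurewicz (loop_class w) = loop_homology w.
Proof.
apply/eqP; rewrite -Quotient.idealrBE; apply/asboolP.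
have [z hz] := homotopic_homologous (repr_loop_class w).
by exists 1%N, z; rewrite mulr1n -hz.
Qed.

Lemma hurewicz_mul g h : hurewicz (g * h)%g = hurewicz g + hurewicz h.
Proof.
rewrite -[g]loop_class_repr -[h]loop_class_repr [(_ * _)%g]pi1_mulE !hurewicz_loop.
rewrite /loop_homology -raddfD; congr (\pi _); apply/val_inj.
exact: walk_chain_cat.
Qed.

End Taut.

Section EdgeOrientation.
Variable V : transverse_taut.

(* The edge of [t] on which the large half-branch of the upper track in the face
   opposite to [i] ends: the bottom diagonal of the tetrahedron immediately
   above this face. *)
Definition upper_large_edge (t : tet V) (i : 'I_4) : {set 'I_4} :=
  if points_out t i
  then [set a | gluing t i a \in bottom_diagonal (neighbour t i)]
  else bottom_diagonal t.

(* An orientation of the edges of a tetrahedron: [o (a, b)] holds when the edge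
   is oriented from [a] to [b]. *)
Definition tet_orientation := {ffun 'I_4 * 'I_4 -> bool}.

(* The orientations of the edges of [t] induced by the transverse orientations
   of the upper track restricted to the four faces of [t].  In a face with upper
   large edge [xy] and third vertex [z], the large half-branch crosses [xy] and
   splits into the half-branches crossing [xz] and [zy].  If the track is
   crossed from the side of [x] to that of [y] along [xy], then the smooth
   branch ending on [xz] is crossed from [x] to [z], and the one ending on [zy]
   from [z] to [y]. *)
Definition transverse_orientation (t : tet V) (o : tet_orientation) : Prop :=
  (forall a b, o (a, b) = (a != b) && ~~ o (b, a)) /\
  (forall i x y z, uniq [:: i; x; y; z] -> upper_large_edge t i = [set x; y] ->
     o (x, z) = o (x, y) /\ o (z, y) = o (x, y)).

(* The tetrahedra of the edge-orientation double cover are the pairs of a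
   tetrahedron and one of its transverse orientations; the one oriented by [o]
   is glued along the face [s] to the one oriented by [o'] when these
   orientations agree on the edges of [s]. *)
Definition orientations_match (s : face V) (o o' : tet_orientation) : Prop :=
  forall a b, a != s.2 -> b != s.2 ->
    o' (gluing s.1 s.2 a, gluing s.1 s.2 b) = o (a, b).

(* [lifts w o o']: the path [w] lifts to a path in the double cover that starts
   in the tetrahedron oriented by [o] and ends in that oriented by [o']. *)
Fixpoint lifts (w : seq (face V)) (o o' : tet_orientation) : Prop :=
  if w is s :: w' then
    exists u, [/\ transverse_orientation (opposite s).1 u,
                  orientations_match s o u & lifts w' u o']
  else o = o'.

Variable t0 : tet V.

Definition lifts_to_loop (w : dual_path t0 t0) : Prop :=
  exists o, transverse_orientation t0 o /\ lifts (val w) o o.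

Definition edge_orientation (g : pi1 t0) : int :=
  if `[< exists w, loop_class w = g /\ lifts_to_loop w >] then 1 else -1.

End EdgeOrientation.

Section TwistedAlexander.
Variables (V : transverse_taut) (t0 : tet V).

(* A choice of lifts of the tetrahedra to covers of the manifold: the lift of
   [t] is the end of the lift of [p t]. *)
Definition tet_lifts := forall t : tet V, dual_path t0 t.

(* The element of the fundamental group taking the lift of the neighbour of
   [s.1] across the face [s] to the neighbour of the lift of [s.1]. *)
Definition lift_monodromy (p : tet_lifts) (s : face V) : pi1 t0 :=
  loop_class (path_cat (path_cat (p s.1) (path_step s)) (path_rev (p (opposite s).1))).

Section Complex.
Variables (R : comNzRingType) (k : nat) (rho : pi1 t0 -> 'M[R]_k).
Variable p : tet_lifts.

(* The cellular chain complex of the universal cover of the dual 2-complex,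
   tensored with [R^k].  Deck transformations act on the chains on the left, and
   a left module is turned into a right one by [c . g = g^-1 c], so that
   [(g c) (x) v = c (x) rho g^-1 v].  The 1-cell dual to [f] is lifted so as to
   start at the lift of [below f], and the 2-cell dual to [e] so as to have the
   lift of the tetrahedron of the flag [x e] as base point; a chain is given by
   its coefficients on these lifts of the cells. *)
Definition chains (I : finType) := {ffun I -> 'cV[R]_k}.

Definition twisted_boundary1 (c : chains (triangle V)) : chains (tet V) :=
  [ffun t => \sum_f
     ((if above f == t then rho (lift_monodromy p (val f)) *m c f else 0)
      - (if below f == t then c f else 0))].

(* The inverse of the element taking the lift of the tetrahedron reached after
   [n] steps around the edge to the tetrahedron reached from the lift of
   [x.1]. *)
Fixpoint around_monodromy (x : flag V) (n : nat) : pi1 t0 :=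
  if n is m.+1 then
    ((lift_monodromy p (flag_step (iter m (@turn V) x)))^-1
       * around_monodromy x m)%g
  else 1%g.

(* The [n]-th step around the edge contributes the 1-cell it runs along: upwards
   from the tetrahedron reached after [n] steps, or downwards to the one reached
   after [n + 1] steps. *)
Definition twisted_boundary2 (x : edge V -> flag V) (c : chains (edge V)) :
    chains (triangle V) :=
  [ffun f => \sum_e \sum_(n < fingraph.order (@turn V) (x e))
     let s := flag_step (iter n (@turn V) (x e)) in
     if points_out s.1 s.2
     then (if val f == opposite s then rho (around_monodromy (x e) n) *m c e else 0)
     else (if val f == s then - (rho (around_monodromy (x e) n.+1) *m c e) else 0)].

End Complex.

Definition is_twisted_order (R : comNzRingType) (k : nat)
    (rho : pi1 t0 -> 'M[R]_k) (g : R) : Prop :=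
  exists (p : tet_lifts) (x : edge V -> flag V),
    (forall e, flag_edge (x e) \in val e) /\
    is_fitting_invariant
      (fun c : chains R k (triangle V) => twisted_boundary1 rho p c = 0)
      (fun c => exists d, c = twisted_boundary2 rho p x d) g.

Definition tensor_hurewicz (k : nat) (phi : pi1 t0 -> 'M[int]_k) (g : pi1 t0) :
    'M[group_ring (HM V)]_k :=
  gr_elt (hurewicz g) *: map_mx intr (phi g).

Definition is_twisted_alexander_polynomial (k : nat) (phi : pi1 t0 -> 'M[int]_k)
    (g : group_ring (HM V)) : Prop :=
  is_twisted_order (tensor_hurewicz phi) g.

End TwistedAlexander.

Section TautPolynomial.
Variables (V : transverse_taut) (t0 : tet V).

(* The tetrahedra of the triangulation of the maximal free abelian cover: after
   a choice of lifts, [(h, t)] is the image of the lift of [t] under the deck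
   transformation [h]. *)
Definition fab_tet := (HM V * tet V)%type.

Definition fab_neighbour (p : tet_lifts t0) (x : fab_tet) (i : 'I_4) : fab_tet :=
  (x.1 + hurewicz (lift_monodromy p (x.2, i)), neighbour x.2 i).

(* An identification of the edges of the cover with [HM * edge V]: the edge [A]
   of the tetrahedron [x] is the translate by [l x A] of the chosen lift of the
   edge of [V] it projects to. *)
Definition is_edge_labelling (p : tet_lifts t0)
    (l : fab_tet -> {set 'I_4} -> HM V) : Prop :=
  (forall (h : HM V) (x : fab_tet) (A : {set 'I_4}), #|A| = 2 ->
     l (h + x.1, x.2) A = h + l x A) /\
  (forall (x : fab_tet) (i : 'I_4) (A : {set 'I_4}), #|A| = 2 -> i \notin A ->
     l (fab_neighbour p x i) [set gluing x.2 i a | a in A] = l x A).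

(* The matrix of [D]; the lift of the triangle [f] is the one below the
   tetrahedron [(k f, above f)], whose bottom diagonal is its upper large
   edge. *)
Definition taut_matrix (k : triangle V -> HM V)
    (l : fab_tet -> {set 'I_4} -> HM V) :
    'M[group_ring (HM V)]_(#|{: edge V}|, #|{: triangle V}|) :=
  \matrix_(i, j)
    let e : edge V := enum_val i in let f : triangle V := enum_val j in
    \sum_(A : {set 'I_4} | [&& #|A| == 2, (val f).2 \notin A
                             & (above f, A) \in val e])
      (if A == upper_large_edge (above f) (val f).2 then 1 else -1)
        * gr_elt (l (k f, above f) A).

Definition is_taut_polynomial (g : group_ring (HM V)) : Prop :=
  exists (p : tet_lifts t0) k l,
    is_edge_labelling p l /\ is_gcd (maximal_minor (taut_matrix k l)) g.

End TautPolynomial.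

(* Main.v *)
Require Import Defs.
From mathcomp Require Import all_boot all_algebra.
From mathcomp Require Import all_order all_fingroup.
From mathcomp Require Import generic_quotient ring_quotient finmap boolp ring.
From mathcomp.multinomials Require Import monalg.
From Stdlib Require Import Relation_Operators.

Set Implicit Arguments.
Unset Strict Implicit.
Unset Printing Implicit Defensive.

Import GRing.Theory Num.Theory Order.TTheory.
Local Open Scope ring_scope.
Local Open Scope quotient_scope.

(** Why the two polynomials agree.

    A transverse orientation of the upper track on a tetrahedron orients its
    edges.  In a triangle whose upper large edge runs from [x] to [y] and whose
    third vertex is [z], the other edges run from [x] to [z] and from [z] to
    [y], so the column [e0 - e1 - e2] of the taut matrix is the boundary of the
    oriented triangle.  The orientations chosen on two neighbouring tetrahedra
    agree or disagree on their whole common face ([twistE]), and the product of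
    these signs along a loop is the edge-orientation homomorphism
    ([edge_orientation_loop]).  The taut matrix is therefore the boundary map
    from triangles to edges with coefficients twisted by the character
    [twisting], the product of the edge orientation and of the class in the
    group ring.  Dually, its transpose is the boundary map [B] from the 2-cells
    to the 1-cells of the dual complex, up to units that rescale rows and
    columns: the unit attached to a cell compares its chosen lift and
    orientation on both sides.  This is [taut_and_order_minors]; its
    combinatorial core is [sum_face_coef], which matches the steps of the walk
    around an edge with the edges of the triangles.  That a tetrahedron has
    transverse orientations at all is where the colours of a veering
    triangulation enter ([transverse_orientation_exists]).

    It remains to compare the maximal minors of [B] with those of a
    presentation matrix of the homology [ker D / im B], where [D] is the next
    boundary map ([twisted_order_minors]).  The twisted augmentation ideal,
    generated by the [chi g - 1], kills the cokernel of [D], so for each [y] in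
    it there is [S] with [D *m S = y%:M].  After inverting [y] the cokernel of
    [B] is the sum of the homology and of a free module, and the invariance of
    Fitting ideals shows that both families of minors have the same common
    divisors up to powers of [y] ([minors_of_split_presentation]).  The powers
    disappear because of a dichotomy ([twisted_augmentation_ideal]).  Either the
    ideal contains a regular sequence [y1, y2], and divisibility of a multiple
    by powers of both implies divisibility; or it is principal, and then the
    image of [D] is free and [D] can be replaced by a split surjection.  The
    dichotomy needs a nonzero class in [HM], which comes from counting cells:
    there are as many edges as tetrahedra and twice as many triangles.

    Two greatest common divisors of families with the same common divisors
    differ by a unit because the group ring of the torsion-free group [HM] is an
    integral domain ([group_ring_integral]). *)

(** * Maximal minors and divisibility *)

Definition divides_minors (R : comNzRingType) l k (A : 'M[R]_(l, k)) (d : R) :=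
  forall s, maximal_minor A s -> divides d s.

Section Minors.
Variable R : comNzRingType.
Implicit Types (d : R).

Lemma divides_mull d a b : divides d a -> divides d (b * a).
Proof. by case=> c ->; exists (b * c); rewrite mulrA. Qed.

Lemma divides_sum d (I : Type) (r : seq I) (P : pred I) (F : I -> R) :
  (forall i, P i -> divides d (F i)) -> divides d (\sum_(i <- r | P i) F i).
Proof.
move=> h; elim/big_rec: _ => [|i x /h[a ->] [b ->]]; first by exists 0; rewrite mul0r.
by exists (a + b); rewrite mulrDl.
Qed.

Lemma divides_sub1_mul (y a b : R) :
  divides y (a - 1) -> divides y (b - 1) -> divides y (a * b - 1).
Proof.
move=> [u eu] [v ev]; exists (u * b + v).
by rewrite mulrDl -ev mulrAC -eu mulrBl mul1r addrA subrK.
Qed.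

Lemma divides_sub1_inv (y a b : R) :
  a * b = 1 -> divides y (a - 1) -> divides y (b - 1).
Proof.
move=> ab [u eu]; exists (- (u * b)).
by rewrite mulNr mulrAC -eu mulrBl ab mul1r opprB.
Qed.

Lemma det_mulmx_sum l k (A : 'M[R]_(l, k)) (Q : 'M_(k, l)) :
  \det (A *m Q) =
  \sum_(f : {ffun 'I_l -> 'I_k}) (\prod_i Q (f i) i) * \det (colsub f A).
Proof.
rewrite -[LHS]det_tr {1}/determinant.
under eq_bigr => s _.
  under eq_bigr => i _ do rewrite !mxE.
  rewrite bigA_distr_bigA /= mulr_sumr.
  over.
rewrite exchange_big /=; apply: eq_bigr => f _.
rewrite -[\det (colsub f A)]det_tr /determinant mulr_sumr.
apply: eq_bigr => s _; rewrite mulrCA -big_split /=; congr (_ * _).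
by apply: eq_bigr => i _; rewrite !mxE mulrC.
Qed.

(** By multilinearity a determinant of a product with [A] on the left is a
    combination of determinants of column selections of [A]; those with a
    repeated column vanish. *)
Lemma minors_dvd_det_mul l k (A : 'M[R]_(l, k)) d (Q : 'M_(k, l)) :
  divides_minors A d -> divides d (\det (A *m Q)).
Proof.
move=> hA; rewrite det_mulmx_sum; apply: divides_sum => f _; apply: divides_mull.
have [/injectiveP inj|/injectivePn[i [j ij fij]]] := boolP (injectiveb f).
  by apply: hA; exists f.
exists 0; rewrite mul0r -det_tr (determinant_alternate ij) // => a.
by rewrite !mxE fij.
Qed.

(** Laplace expansion along the rows of [U] reduces to the previous lemma: it
    deletes a row of [U] and a column of [U] and [V], and leaves [A] alone. *)
Lemma minors_dvd_det_col l k (A : 'M[R]_(l, k)) d p (U : 'M_(p, p + l))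
    (V : 'M_(k, p + l)) :
  divides_minors A d ->
  divides d (\det (col_mx U (A *m V))).
Proof.
move=> hA; elim: p U V => [|p IH] U V.
  rewrite (_ : col_mx U (A *m V) = A *m V); first exact: minors_dvd_det_mul.
  apply/matrixP => i j; rewrite mxE; case: splitP => [[]//|i' ii'].
  by congr (_ _ _); apply: val_inj; rewrite /= ii'.
rewrite (expand_det_row _ ord0); apply: divides_sum => j _; apply: divides_mull.
rewrite /cofactor; apply: divides_mull.
have -> : row' ord0 (col' j (col_mx U (A *m V))) =
    col_mx (row' ord0 (col' j U)) (A *m col' j V) :> 'M_(p + l); last exact: IH.
apply/matrixP => a b; rewrite !mxE.
case: (@splitP p.+1 l) => c /= ac; case: splitP => e /= ae; rewrite ?mxE //.
- by congr (U _ _); apply: val_inj; rewrite /= -ae -ac.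
- by move: (ltn_ord c); rewrite -ac /bump /= ae add1n ltnS ltnNge leq_addr.
- by move: (ltn_ord e); rewrite -ae; move: ac; rewrite /bump /= add1n addSn => -[->]; rewrite ltnNge leq_addr.
- apply: eq_bigr => i _; rewrite mxE; congr (A _ _ * _); apply: val_inj => /=.
  by apply: (@addnI p); move: ac; rewrite /bump /= add1n addSn ae => -[].
Qed.

Lemma lift_columns m k p (M : 'M[R]_(m, p)) (A : 'M_(m, k)) :
  (forall j, exists w : 'cV_k, col j M = A *m w) -> exists W : 'M_(k, p), M = A *m W.
Proof.
move=> /fin_all_exists[w hw]; exists (\matrix_(i, j) w j i 0).
apply/matrixP => i j; have := congr1 (fun C : 'cV__ => C i 0) (hw j).
by rewrite !mxE => ->; apply: eq_bigr => a _; rewrite !mxE.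
Qed.

End Minors.

Section Compare.
Variables (R : comNzRingType) (n r l k : nat) (y : R).
Variables (B : 'M[R]_(r + n, n)) (D : 'M[R]_(r, r + n)) (S : 'M[R]_(r + n, r)).
Variables (Z : 'M[R]_(r + n, l)) (A : 'M[R]_(l, k)).
Hypothesis DB : D *m B = 0.
Hypothesis DS : D *m S = y%:M.
Hypothesis DZ : D *m Z = 0.
Hypothesis Zgen : forall c : 'cV_(r + n), D *m c = 0 ->
  exists (x : 'cV_l) (w : 'cV_n), c = Z *m x + B *m w.
Hypothesis Arel : forall x : 'cV_l,
  (exists w : 'cV_n, Z *m x = B *m w) <-> exists w : 'cV_k, x = A *m w.

(** The columns of [y%:M - S *m D] lie in the kernel of [D]. *)
Let splitting : exists (X : 'M_(l, r + n)) (Y : 'M_(n, r + n)),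
  y%:M - S *m D = Z *m X + B *m Y.
Proof.
have [W hW] : exists W : 'M_(l + n, r + n), y%:M - S *m D = row_mx Z B *m W.
  apply: lift_columns => j.
  have [|x [w e]] := Zgen (c := col j (y%:M - S *m D)).
    rewrite colE mulmxA mulmxBr mulmxA DS mul_mx_scalar mul_scalar_mx subrr mul0mx //.
    by exists (col_mx x w); rewrite mul_row_col.
by exists (usubmx W), (dsubmx W); rewrite hW -mul_row_col vsubmxK.
Qed.

Let relations p (X : 'M_(l, p)) (W : 'M_(n, p)) :
  Z *m X = B *m W -> exists Q : 'M_(k, p), X = A *m Q.
Proof.
move=> e; apply: lift_columns => j; apply/Arel.
by exists (col j W); rewrite !colE !mulmxA e.
Qed.

(** The first half of the invariance of Fitting ideals, with [y] inverted.  The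
    matrix [row_mx S B] presents the homology: clearing the generators [Z]
    against it by row operations leaves rows that are combinations of the
    relations [A].  The block product of [col_mx D P] with [row_mx S B] is
    triangular, so every determinant of [P *m B] is a multiple of that of
    [row_mx S B] after multiplication by a power of [y]. *)
Lemma presentation_minors_dvd d (P : 'M_(n, r + n)) :
  divides_minors A d ->
  divides d (y ^+ (l + r) * \det (P *m B)).
Proof.
move=> hA; have [X [Y e]] := splitting.
have [Q2 hQ2] : exists Q, y%:M - X *m Z = A *m Q.
  apply: (@relations _ _ (Y *m Z)); have := congr1 (mulmx^~ Z) e.
  rewrite mulmxBl mulmxDl -!mulmxA DZ mulmx0 subr0 mul_scalar_mx => h.
  by rewrite mulmxBr mul_mx_scalar h addrAC subrr add0r.
have [Q3 hQ3] : exists Q, X *m S = A *m Q.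
  apply: (@relations _ _ (- (Y *m S))); have := congr1 (mulmx^~ S) e.
  rewrite mulmxBl mulmxDl -!mulmxA DS mul_scalar_mx mul_mx_scalar subrr => h.
  by rewrite mulmxN; apply/eqP; rewrite -subr_eq0 opprK -h.
have [Q1 hQ1] : exists Q, X *m B = A *m Q.
  apply: (@relations _ _ (y%:M - Y *m B)); have := congr1 (mulmx^~ B) e.
  rewrite mulmxBl mulmxDl -!mulmxA DB mulmx0 subr0 mul_scalar_mx => h.
  by rewrite mulmxBr mul_mx_scalar h addrK.
have dG : divides d (y ^+ l * \det (row_mx S B)).
  have e1 : block_mx (row_mx S B) (- Z) (0 : 'M_(l, r + n)) y%:M =
     block_mx 1%:M 0 (- X) 1%:M *m
       col_mx (row_mx (row_mx S B) (- Z)) (A *m row_mx (row_mx Q3 Q1) Q2).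
    have -> : A *m row_mx (row_mx Q3 Q1) Q2 = row_mx (X *m row_mx S B) (y%:M - X *m Z).
      by rewrite !mul_mx_row hQ1 hQ2 hQ3.
    rewrite mul_block_col !mul1mx mul0mx addr0 mulNmx mul_mx_row mulmxN.
    by rewrite opp_row_mx opprK add_row_mx addNr [X *m Z + _]addrC subrK.
  have := congr1 determinant e1.
  rewrite det_ublock det_scalar det_mulmx det_lblock !det1 !mul1r mulrC => ->.
  exact: minors_dvd_det_col.
have e2 : \det (col_mx D P) * \det (row_mx S B) = y ^+ r * \det (P *m B).
  by rewrite -det_mulmx mul_col_row DB DS det_lblock det_scalar.
by rewrite exprD -mulrA -e2 mulrCA; apply: divides_mull.
Qed.

(** The converse half: [row_mx S B] has a determinant in the ideal of the
    minors of [B], and it divides a power of [y] times any minor of [A], since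
    the relations [A] among the [Z] hold modulo the image of [B]. *)
Lemma boundary_minors_dvd d m :
  divides_minors B^T d -> maximal_minor A m ->
  divides d (y ^+ (r + n) * m).
Proof.
move=> hB [c _ ->]; have [X [Y e]] := splitting.
have dG : divides d (\det (row_mx S B)).
  rewrite -det_tr tr_row_mx.
  by rewrite -[B^T]mulmx1; apply: minors_dvd_det_col.
have [W hW] : exists W : 'M_(n, l), Z *m colsub c A = B *m W.
  apply: lift_columns => j; rewrite colE -mulmxA -colE; apply/Arel.
  exists (delta_mx (c j) 0); rewrite -colE.
  by apply/matrixP => a b; rewrite !mxE.
have e1 : block_mx 1%:M 0 Z 1%:M *m block_mx (colsub c A) (- X) 0 y%:M =
   block_mx 1%:M 0 0 (row_mx S B) *m
     col_mx (row_mx (colsub c A) (- X)) (block_mx 0 D W Y).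
  rewrite mulmx_block mul_block_col !mul1mx !mul0mx !addr0 hW add0r mulmxN.
  rewrite mul_row_block mulmx0 !add0r -[y%:M](subrK (S *m D)) e.
  by rewrite addrA addrA addNr add0r addrC block_mxEv.
have := congr1 determinant e1; rewrite !det_mulmx det_lblock det_ublock !det1 !mul1r.
rewrite det_scalar mulrC => ->; rewrite det_lblock det1 mul1r mulrC.
exact: divides_mull.
Qed.

End Compare.

Definition integral (R : comNzRingType) : Prop := forall a b : R, a * b = 0 -> a = 0 \/ b = 0.

Section Integral.
Variable R : comNzRingType.
Hypothesis dom : integral R.

Lemma integral_mulI (a b c : R) : a <> 0 -> a * b = a * c -> b = c.
Proof.
move=> a0 e; have [|//|/eqP] := dom (a := a) (b := b - c); first by rewrite mulrBr e subrr.
by rewrite subr_eq0 => /eqP.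
Qed.

Lemma integral_exp (a : R) n : a <> 0 -> a ^+ n <> 0.
Proof.
move=> a0; elim: n => [|n IH]; first by apply/eqP; rewrite expr0 oner_eq0.
by rewrite exprS => /dom[].
Qed.

Lemma gcd_unit_eq (S1 S2 : R -> Prop) g1 g2 :
  (forall d, (forall s, S1 s -> divides d s) <-> (forall s, S2 s -> divides d s)) ->
  is_gcd S1 g1 -> is_gcd S2 g2 -> unit_eq g1 g2.
Proof.
move=> h [d1 m1] [d2 m2].
have [a ea] : divides g1 g2 by apply/m2/h.
have [b eb] : divides g2 g1 by apply/m1/h.
have [g0|g0] := pselect (g2 = 0).
  by exists 1, 1; split; rewrite ?mulr1 // eb g0 mulr0 mulr0.
exists b, a; split=> //; apply: (integral_mulI g0).
by rewrite mulr1 mulrC [b * a]mulrC -mulrA -eb -ea.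
Qed.

(** The quotient of [s] by [d] is a fraction whose denominator can be taken to
    be a power of [y1] or a power of [y2].  Such a fraction lies in the ring
    because the powers of [y1] and [y2] still form regular sequences. *)
Lemma regular_dvd (y1 y2 d s : R) N1 N2 :
  y1 <> 0 -> (forall a, divides y1 (y2 * a) -> divides y1 a) ->
  divides d (y1 ^+ N1 * s) -> divides d (y2 ^+ N2 * s) -> divides d s.
Proof.
move=> y10 reg [a ea] [b eb].
have [d0|d0] := pselect (d = 0).
  rewrite d0 mulr0 in ea; have [/(integral_exp y10)//|->] := dom ea.
  by exists 0; rewrite mul0r.
have reg2 c : divides y1 (y2 ^+ N2 * c) -> divides y1 c.
  elim: N2 c {eb} => [|N IH] c; first by rewrite mul1r.
  by rewrite exprS -mulrA => /reg/IH.
have reg3 M c : divides (y1 ^+ M) (y2 ^+ N2 * c) -> divides (y1 ^+ M) c.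
  elim: M c => [|M IH] c; first by exists c; rewrite mulr1.
  case=> e; rewrite exprS => h; have [|c' hc'] := reg2 c.
    by exists (e * y1 ^+ M); rewrite h -mulrA [_ * y1]mulrC.
  have [|f hf] := IH c'.
    exists e; apply: (integral_mulI y10); rewrite mulrCA [y1 * c']mulrC -hc' h.
    by rewrite mulrCA.
  by exists f; rewrite hc' hf mulrAC mulrA.
have [|c hc] := reg3 N1 a.
  exists b; apply: (integral_mulI d0); rewrite mulrCA [d * a]mulrC -ea.
  by rewrite mulrCA eb mulrC -mulrA mulrCA.
exists c; apply: (integral_mulI (integral_exp (n := N1) y10)).
by rewrite ea hc mulrA [_ * c]mulrC.
Qed.

End Integral.

(** [A] presents the quotient of the kernel of [D] by the image of [B], with
    the columns of [Z] as representatives of the generators. *)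
Definition presents_homology (R : comNzRingType) m n r l k (D : 'M[R]_(r, m)) (B : 'M[R]_(m, n))
    (Z : 'M[R]_(m, l)) (A : 'M[R]_(l, k)) :=
  [/\ D *m Z = 0, forall c : 'cV_m, D *m c = 0 ->
        exists (x : 'cV_l) (w : 'cV_n), c = Z *m x + B *m w &
      forall x : 'cV_l, (exists w : 'cV_n, Z *m x = B *m w) <-> exists w : 'cV_k, x = A *m w].

Lemma minors_of_split_presentation (R : comNzRingType) m n r l k (y : R)
    (D : 'M[R]_(r, m)) (B : 'M[R]_(m, n)) S (Z : 'M[R]_(m, l)) (A : 'M[R]_(l, k)) d :
  m = (r + n)%N -> D *m B = 0 -> D *m S = y%:M -> presents_homology D B Z A ->
  (divides_minors A d -> forall s, maximal_minor B^T s -> divides d (y ^+ (l + r) * s)) /\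
  (divides_minors B^T d -> forall s, maximal_minor A s -> divides d (y ^+ (r + n) * s)).
Proof.
move=> e; subst m => DB DS [DZ Zgen Arel]; split=> hd s; last first.
  exact: (boundary_minors_dvd DS Zgen Arel hd).
case=> c _ ->; have -> : \det (colsub c B^T) = \det (rowsub c 1%:M *m B).
  by rewrite mul_rowsub_mx mul1mx -det_tr; congr (\det _); apply/matrixP => i j; rewrite !mxE.
exact: (presentation_minors_dvd DB DS DZ Zgen Arel (rowsub c 1%:M) hd).
Qed.

Section Depth.
Variables (R : comNzRingType) (dom : integral R) (m n r l k : nat).
Variables (D : 'M[R]_(r, m)) (B : 'M[R]_(m, n)) (Z : 'M[R]_(m, l)) (A : 'M[R]_(l, k)).
Hypothesis mE : m = (r + n)%N.
Hypothesis DB : D *m B = 0.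

Lemma minors_of_depth_two y1 y2 S1 S2 d : presents_homology D B Z A ->
  D *m S1 = y1%:M -> D *m S2 = y2%:M -> y1 <> 0 ->
  (forall a, divides y1 (y2 * a) -> divides y1 a) ->
  divides_minors B^T d <-> divides_minors A d.
Proof.
move=> hA e1 e2 y10 reg.
have [a1 b1] := minors_of_split_presentation d mE DB e1 hA.
have [a2 b2] := minors_of_split_presentation d mE DB e2 hA.
split=> hd s hs; apply: (regular_dvd dom y10 reg).
- exact: b1.
- exact: b2.
- exact: a1.
- exact: a2.
Qed.

Lemma minors_of_split S d : presents_homology D B Z A -> D *m S = 1%:M ->
  divides_minors B^T d <-> divides_minors A d.
Proof.
move=> hA e; have [a b] := minors_of_split_presentation d mE DB e hA.
by split=> hd s hs; [have := b hd s hs | have := a hd s hs]; rewrite expr1n mul1r.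
Qed.

End Depth.

Section PrincipalQuotient.
Variables (R : comNzRingType) (dom : integral R) (m r : nat) (i0 : 'I_r).
Variables (D : 'M[R]_(r, m)) (y : R) (q : 'I_m -> R).
Hypothesis y0 : y <> 0.
Hypothesis sumD : forall j, \sum_i D i j = y * q j.

(** When the image of [D] consists of the vectors whose coordinates sum to a
    multiple of [y], it is free, with the differences of basis vectors and one
    multiple of [y] as a basis.  In the coordinates of this basis [D] becomes a
    split surjection with the same kernel. *)
Definition reduced_matrix : 'M[R]_(r, m) :=
  \matrix_(i, j) if i == i0 then q j else D i j.

Lemma reduced_coord p (C : 'M[R]_(m, p)) j : y * (reduced_matrix *m C) i0 j = \sum_i (D *m C) i j.
Proof.
under [RHS]eq_bigr => i _ do rewrite mxE.
rewrite exchange_big /= mxE mulr_sumr; apply: eq_bigr => a _.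
by rewrite mxE eqxx mulrA -sumD mulr_suml.
Qed.

Lemma reduced_other p (C : 'M[R]_(m, p)) i j : i != i0 ->
  (reduced_matrix *m C) i j = (D *m C) i j.
Proof. by move=> h; rewrite !mxE; apply: eq_bigr => a _; rewrite mxE (negPf h). Qed.

Lemma reduced_eq0 p (C : 'M[R]_(m, p)) : reduced_matrix *m C = 0 <-> D *m C = 0.
Proof.
split=> e; apply/matrixP => i j; rewrite [RHS]mxE.
  have other i' : i' != i0 -> (D *m C) i' j = 0 by move=> h; rewrite -reduced_other // e mxE.
  have [->|/other//] := eqVneq i i0.
  have := reduced_coord C j; rewrite e mxE mulr0 (bigD1 i0) //= big1 ?addr0 //.
have [->|h] := eqVneq i i0; last by rewrite reduced_other // e mxE.
apply: (integral_mulI dom y0); rewrite mulr0 reduced_coord big1 // => i' _.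
by rewrite e mxE.
Qed.

Hypothesis path : forall i, exists c : 'cV_m, D *m c = delta_mx i 0 - delta_mx i0 0.
Hypothesis loop : exists c : 'cV_m, D *m c = y *: delta_mx i0 0.

Lemma reduced_split : exists S, reduced_matrix *m S = 1%:M.
Proof.
suff [S ->] : exists S, 1%:M = reduced_matrix *m S by exists S.
apply: lift_columns => j.
have [->|ji] := eqVneq j i0; [have [c hc] := loop | have [c hc] := path j]; exists c.
  apply/colP => i; have [->|h] := eqVneq i i0.
    apply: (integral_mulI dom y0); rewrite reduced_coord hc (bigD1 i0) //= big1 => [|i' h'].
      by rewrite !mxE !eqxx addr0.
    by rewrite !mxE (negPf h') mulr0.
  by rewrite reduced_other // hc !mxE (negPf h) mulr0.
apply/colP => i; have [->|h] := eqVneq i i0.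
  apply: (integral_mulI dom y0); rewrite reduced_coord hc.
  under eq_bigr => i' _ do rewrite !mxE !andbT.
  rewrite sumrB (bigD1 j) //= (bigD1 i0 (P := xpredT)) //= !eqxx !big1 => [|i' /negPf->|i' /negPf->] //.
  by rewrite !mxE eq_sym (negPf ji) mulr0 !addr0 subrr.
by rewrite reduced_other // hc !mxE (negPf h) subr0 !andbT.
Qed.

End PrincipalQuotient.

Section Scaling.
Variable R : comNzRingType.

Lemma det_scaled n (u v : 'I_n -> R) (M : 'M[R]_n) :
  \det (\matrix_(i, j) (u i * v j * M i j)) = (\prod_i u i) * (\prod_i v i) * \det M.
Proof.
have -> : \matrix_(i, j) (u i * v j * M i j) =
    diag_mx (\row_i u i) *m M *m diag_mx (\row_i v i).
  by apply/matrixP => i j; rewrite mul_mx_diag mul_diag_mx !mxE mulrAC.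
rewrite !det_mulmx !det_diag mulrAC; congr (_ * _ * _); apply: eq_bigr => i _; exact: mxE.
Qed.

Lemma divides_minors_scaled n m (T M : 'M[R]_(n, m)) (u : 'I_n -> R) (v : 'I_m -> R) d :
  (forall i j, T i j = u i * v j * M i j) -> divides_minors M d -> divides_minors T d.
Proof.
move=> e hM s [c cinj ->].
have -> : colsub c T = \matrix_(i, j) (u i * v (c j) * colsub c M i j).
  by apply/matrixP => i j; rewrite !mxE e.
by rewrite det_scaled; apply: divides_mull; apply: hM; exists c.
Qed.

Lemma divides_minors_units n m (T M : 'M[R]_(n, m)) (u u' : 'I_n -> R) (v v' : 'I_m -> R) d :
  (forall i, u i * u' i = 1) -> (forall j, v j * v' j = 1) ->
  (forall i j, T i j = u i * v j * M i j) -> divides_minors T d <-> divides_minors M d.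
Proof.
move=> hu hv e; split; last exact: divides_minors_scaled e.
apply: (divides_minors_scaled (u := u') (v := v')).
move=> i j; rewrite e mulrA.
have -> : u' i * v' j * (u i * v j) = 1; last by rewrite mul1r.
by rewrite mulrACA [u' i * _]mulrC hu [v' j * _]mulrC hv mulr1.
Qed.

End Scaling.

(** * Group rings of torsion-free groups *)

Section GroupRing.
Variable H : zmodType.
Local Notation R := (group_ring H).

Definition coef (h : H) (a : R) : int := mcoeff h (a : {malg int[H]}).
Definition supp (a : R) : {fset H} := msupp (a : {malg int[H]}).

Lemma coef_eq (a b : R) : (forall h, coef h a = coef h b) -> a = b.
Proof. by move=> e; apply/malgP. Qed.

Lemma coef_add h (a b : R) : coef h (a + b) = coef h a + coef h b.
Proof. exact: mcoeffD. Qed.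
Lemma coef_opp h (a : R) : coef h (- a) = - coef h a.
Proof. exact: mcoeffN. Qed.
Lemma coef_zero h : coef h 0 = 0.
Proof. exact: mcoeff0. Qed.
Lemma coef_elt h k : coef h (gr_elt k) = (k == h)%:R.
Proof. exact: mcoeffU. Qed.
Lemma coef_monomial h k c : coef h (mkmalgU k c : R) = c *+ (k == h).
Proof. exact: mcoeffU. Qed.
Lemma supp_coef h a : (h \in supp a) = (coef h a != 0).
Proof. by rewrite /supp -mcoeff_neq0. Qed.

Lemma gr_eltD (h k : H) : gr_elt (h + k) = gr_elt h * gr_elt k.
Proof. by rewrite /GRing.mul /= /gr_elt gr_mulUU mulr1. Qed.
Lemma gr_elt0 : gr_elt (0 : H) = 1.
Proof. by []. Qed.
Lemma coef_one h : coef h (1 : R) = (0 == h)%:R.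
Proof. exact: coef_elt. Qed.
Lemma gr_eltNK (h : H) : gr_elt h * gr_elt (- h) = 1.
Proof. by rewrite -gr_eltD subrr. Qed.

Lemma coef_sum k I (r : seq I) P (F : I -> R) :
  coef k (\sum_(i <- r | P i) F i) = \sum_(i <- r | P i) coef k (F i).
Proof. by apply: (big_morph (coef k)) => [a b|]; rewrite ?coef_add ?coef_zero. Qed.

Lemma sum_coef_supp (S : {fset H}) k (a : R) : (supp a `<=` S)%fset ->
  \sum_(j <- S) coef j a *+ (j == k) = coef k a.
Proof.
move=> le; have [kS|kS] := boolP (k \in S).
  rewrite (bigD1_seq k) //= eqxx big1 ?addr0 // => j /negPf->; exact: mulr0n.
rewrite big1_seq => [|j /andP[_ jS]].
  apply/esym/eqP/negbNE; apply: contraNN kS; rewrite -supp_coef; exact: (fsubsetP le).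
by case: eqP => // jk; rewrite -jk jS in kS.
Qed.

Lemma coef_mul (S : {fset H}) k (a b : R) : (supp b `<=` S)%fset ->
  coef k (a * b) = \sum_(j <- S) coef (k - j) a * coef j b.
Proof.
move=> le; have -> : a * b = (\sum_(h1 <- supp a) \sum_(h2 <- S)
     (mkmalgU (h1 + h2) (coef h1 a * coef h2 b) : {malg int[H]}) : R).
  exact: gr_mulw (fsubset_refl _) le.
rewrite exchange_big coef_sum /=; apply: eq_bigr => j _; rewrite coef_sum.
rewrite -(sum_coef_supp _ (fsubset_refl (supp a))) mulr_suml; apply: eq_bigr => i _.
rewrite coef_monomial mulrnAl; congr (_ *+ nat_of_bool _).
by apply/eqP/eqP => [<-|->]; rewrite ?addrK ?subrK.
Qed.

Lemma coef_mulgr h k (a : R) : coef k (gr_elt h * a) = coef (k - h) a.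
Proof.
rewrite mulrC (@coef_mul [fset h]%fset) ?big_seq_fset1 ?coef_elt ?eqxx ?mulr1 //.
exact: msuppU_le.
Qed.

Definition graded_part (lam : H -> int) (q : int) (a : R) : R :=
  \sum_(h <- supp a | lam h == q) (mkmalgU h (coef h a) : {malg int[H]}).

Lemma coef_part lam q k a : coef k (graded_part lam q a) = if lam k == q then coef k a else 0.
Proof.
rewrite /graded_part big_mkcond coef_sum /= -(sum_coef_supp _ (fsubset_refl (supp a))).
case: eqP => kq.
  apply: eq_bigr => j _; case: eqP => jq; first exact: coef_monomial.
  by rewrite coef_zero; case: eqP => // jk; rewrite jk in jq.
rewrite big1 // => j _; case: eqP => jq; rewrite ?coef_zero // coef_monomial.
by case: eqP => // jk; rewrite jk in jq.
Qed.

Lemma seq_argmax (T : eqType) (f : T -> int) (s : seq T) : s != [::] ->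
  exists2 x, x \in s & forall z, z \in s -> f z <= f x.
Proof.
elim: s => // x s IH _; have [->|/IH[y ys hy]] := eqVneq s [::].
  by exists x; rewrite ?inE // => z; rewrite inE => /eqP->.
have [xy|/ltW yx] := leP (f x) (f y).
  by exists y; rewrite ?inE ?ys ?orbT // => z; rewrite inE => /predU1P[->|/hy].
exists x; rewrite ?inE ?eqxx // => z; rewrite inE => /predU1P[->//|/hy h].
exact: le_trans h yx.
Qed.

Lemma supp_eq0 (a : R) : a <> 0 -> (supp a : seq H) != [::].
Proof.
move=> a0; apply/eqP => e; apply: a0; apply: coef_eq => h; rewrite coef_zero.
by apply/eqP/negbNE; rewrite -supp_coef -[h \in _]/(h \in (supp a : seq H)) e.
Qed.

Definition additive_fun (lam : H -> int) := {morph lam : h k / h + k}.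

Section Grading.
Variable lam : H -> int.
Hypothesis lamD : additive_fun lam.

Lemma lam0 : lam 0 = 0.
Proof. by apply: (@addrI _ (lam 0)); rewrite -lamD !addr0. Qed.

Lemma lamN h : lam (- h) = - lam h.
Proof. by apply: (@addrI _ (lam h)); rewrite -lamD !subrr lam0. Qed.

Lemma lamB h k : lam (h - k) = lam h - lam k.
Proof. by rewrite lamD lamN. Qed.

Lemma supp_ltn (a b : R) x : (forall h, coef h a <> 0 -> coef h b <> 0) ->
  coef x b <> 0 -> coef x a = 0 -> (#|` supp a| < #|` supp b|)%N.
Proof.
move=> ab bx ax; apply: fproper_ltn_card; rewrite fproperE; apply/andP; split.
  by apply/fsubsetP => h; rewrite !supp_coef => /eqP/ab/eqP.
by apply/fsubsetPn; exists x; rewrite supp_coef ?ax ?eqxx //; apply/eqP.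
Qed.

Lemma top_part (a : R) : a <> 0 -> exists q,
  [/\ forall h, coef h a <> 0 -> lam h <= q, graded_part lam q a <> 0,
      (#|` supp (a - graded_part lam q a)%R| < #|` supp a|)%N &
      forall h, coef h a <> 0 -> lam h <> q -> (#|` supp (graded_part lam q a)| < #|` supp a|)%N].
Proof.
move=> a0; have [x xs hx] := seq_argmax lam (supp_eq0 a0).
have ax : coef x a != 0 by rewrite -supp_coef.
have hx' h : coef h a <> 0 -> lam h <= lam x by move/eqP; rewrite -supp_coef => /hx.
have coefB h : coef h (a - graded_part lam (lam x) a) = if lam h == lam x then 0 else coef h a.
  by rewrite coef_add coef_opp coef_part; case: ifP => _; rewrite ?subrr ?subr0.
exists (lam x); split=> //.
- by move=> /(congr1 (coef x)); rewrite coef_part eqxx coef_zero; apply/eqP.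
- apply: (@supp_ltn _ _ x) => [h||]; rewrite ?coefB ?eqxx //; last exact/eqP.
  by case: ifP.
- move=> h ah hh; apply: (@supp_ltn _ _ h) => [z|//|]; rewrite coef_part.
    by case: ifP.
  by case: eqP.
Qed.

Lemma part_mul_ker q (a y : R) : (forall h, coef h y <> 0 -> lam h = 0) ->
  graded_part lam q (a * y) = graded_part lam q a * y.
Proof.
move=> hy; apply: coef_eq => k; rewrite coef_part !(coef_mul _ _ (fsubset_refl (supp y))).
case: eqP => kq.
  apply: eq_big_seq => j; rewrite supp_coef coef_part lamB => /eqP/hy->.
  by rewrite subr0 kq eqxx.
rewrite big1_seq // => j /andP[_]; rewrite supp_coef coef_part lamB => /eqP/hy->.
by rewrite subr0; case: eqP => // _; rewrite mul0r.
Qed.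

(** For the grading by [lam], the term of highest degree of [(u - 1) * a] is
    the unit [u] times that of [a], and the factor [y] is homogeneous of degree
    zero, so it divides this term; subtracting the term leaves an element with
    smaller support. *)
Lemma regular_pos (y u : R) (h : H) : 0 < lam h ->
  (forall k, coef k y <> 0 -> lam k = 0) -> (u = gr_elt h \/ u = - gr_elt h) ->
  forall a, divides y ((u - 1) * a) -> divides y a.
Proof.
move=> lh hy hu a; have [n] := ubnP #|` supp a|; elim: n a => // n IH a; rewrite ltnS => sa.
have [->|a0] := pselect (a = 0); first by exists 0; rewrite mul0r.
case=> c ec; have [q [hq t0 tlt _]] := top_part a0.
have [w uw] : exists w, u * w = 1.
  by case: hu => ->; [exists (gr_elt (- h)) | exists (- gr_elt (- h))]; rewrite ?mulrNN gr_eltNK.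
have e1 : u * graded_part lam q a = graded_part lam (q + lam h) c * y.
  rewrite -part_mul_ker // -ec; apply: coef_eq => k.
  rewrite coef_part mulrBl mul1r coef_add coef_opp.
  have -> : coef k (u * graded_part lam q a) = if lam k == q + lam h then coef k (u * a) else 0.
    case: hu => ->; rewrite ?mulNr ?coef_opp !coef_mulgr coef_part lamB subr_eq //.
    by case: ifP; rewrite ?oppr0.
  case: eqP => // kq; suff -> : coef k a = 0 by rewrite subr0.
  apply/eqP/negbNE/negP => /eqP/hq; rewrite kq.
  by rewrite gerDl leNgt lh.
have [||c' ec'] := IH (a - graded_part lam q a).
- exact: leq_trans tlt sa.
- exists (c - (u - 1) * (w * graded_part lam (q + lam h) c)).
  rewrite [LHS]mulrBr ec [RHS]mulrBl; congr (_ - _).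
  by rewrite -!mulrA -e1 [w * _]mulrA [w * u]mulrC uw mul1r.
exists (c' + w * graded_part lam (q + lam h) c).
rewrite mulrDl -ec' -mulrA -e1 mulrA [w * u]mulrC uw mul1r.
by rewrite addrNK.
Qed.

End Grading.

Lemma regular_pair (lam : H -> int) (y u : R) (h : H) : additive_fun lam -> lam h <> 0 ->
  (forall k, coef k y <> 0 -> lam k = 0) -> (u = gr_elt h \/ u = - gr_elt h) ->
  forall a, divides y ((u - 1) * a) -> divides y a.
Proof.
move=> lamD lh hy hu; have [pos|neg|//] := ltgtP 0 (lam h); last 1 first.
- by move=> e; rewrite e in lh.
- exact: regular_pos hu.
apply: (@regular_pos (fun k => - lam k)) hu => [k l||k /hy->]; rewrite ?oppr0 //.
  by rewrite lamD opprD.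
by rewrite oppr_gt0.
Qed.

Lemma part_mul (lam : H -> int) (a b : R) qa qb : additive_fun lam ->
  (forall h, coef h a <> 0 -> lam h <= qa) -> (forall h, coef h b <> 0 -> lam h <= qb) ->
  graded_part lam (qa + qb) (a * b) = graded_part lam qa a * graded_part lam qb b.
Proof.
move=> lamD ha hb; apply: coef_eq => k; rewrite coef_part.
rewrite (coef_mul _ _ (fsubset_refl (supp b))) (@coef_mul (supp b)); last first.
  by apply/fsubsetP => j; rewrite !supp_coef coef_part; case: ifP; rewrite ?eqxx.
case: eqP => kq.
  apply: eq_big_seq => j jb; rewrite !coef_part lamB // kq.
  have := hb j; rewrite supp_coef in jb; move=> /(_ (elimN eqP jb)).
  rewrite le_eqVlt => /predU1P[->|jq]; first by rewrite addrK !eqxx.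
  rewrite (lt_eqF jq) mulr0; suff -> : coef (k - j) a = 0 by rewrite mul0r.
  apply/eqP/negbNE/negP => /eqP/ha; rewrite lamB // kq.
  by rewrite leNgt -addrA ltrDl subr_gt0 jq.
rewrite big1_seq // => j _; rewrite !coef_part lamB //.
case: eqP => e1; case: eqP => e2; rewrite ?mul0r ?mulr0 //.
by case: kq; rewrite -e1 -e2 subrK.
Qed.

(** If some functional [lam i] is not constant on the supports of two nonzero
    elements with product zero, their parts of highest degree still have
    product zero and have a smaller total support.  If all functionals are
    constant on both supports, the elements are monomials, since the
    functionals separate points. *)
Lemma group_ring_integral (I : Type) (lam : I -> H -> int) :
  (forall i, additive_fun (lam i)) -> (forall h, (forall i, lam i h = 0) -> h = 0) ->
  integral R.
Proof.
move=> lamD sep a b ab.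
have [->|a0] := pselect (a = 0); first by left.
have [->|b0] := pselect (b = 0); first by right.
exfalso; have [n] := ubnP (#|` supp a| + #|` supp b|)%N.
elim: n a b a0 b0 ab => // n IH a b a0 b0 ab; rewrite ltnS => sab.
have step i : (exists2 h, coef h a <> 0 & exists2 k, coef k a <> 0 & lam i h <> lam i k) \/
  (exists2 h, coef h b <> 0 & exists2 k, coef k b <> 0 & lam i h <> lam i k) -> False.
  move=> hyp; have [qa [ma ta _ sa]] := @top_part (lam i) _ a0.
  have [qb [mb tb _ sb]] := @top_part (lam i) _ b0.
  have le c q : (#|` supp (graded_part (lam i) q c)| <= #|` supp c|)%N.
    apply/fsubset_leq_card/fsubsetP => z.
    by rewrite !supp_coef coef_part; case: ifP; rewrite ?eqxx.
  apply: (IH _ _ ta tb).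
    by rewrite -part_mul // ab; apply: coef_eq => k; rewrite coef_part coef_zero; case: ifP.
  apply: leq_trans sab; case: hyp => -[h h0 [k k0 hk]].
    have /orP[/eqP e|/eqP e] : (lam i h != qa) || (lam i k != qa).
      by rewrite -negb_and; apply/negP => /andP[/eqP e1 /eqP e2]; rewrite e1 e2 in hk.
    - by rewrite -addSn leq_add // (sa h).
    - by rewrite -addSn leq_add // (sa k).
  have /orP[/eqP e|/eqP e] : (lam i h != qb) || (lam i k != qb).
    by rewrite -negb_and; apply/negP => /andP[/eqP e1 /eqP e2]; rewrite e1 e2 in hk.
  - by rewrite -addnS leq_add // (sb h).
  - by rewrite -addnS leq_add // (sb k).
have mono c : c <> 0 -> (forall i h k, coef h c <> 0 -> coef k c <> 0 -> lam i h = lam i k) ->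
  exists h z, z <> 0 /\ c = mkmalgU h z.
  move=> c0 const; have [x xs _] := seq_argmax (fun=> 0) (supp_eq0 c0).
  have cx : coef x c != 0 by rewrite -supp_coef.
  exists x, (coef x c); split; first exact/eqP.
  apply: coef_eq => k; rewrite coef_monomial; case: eqP => [->|xk]; first by rewrite mulr1n.
  apply/eqP/negbNE/negP => /eqP ck; case: xk; apply/eqP; rewrite -subr_eq0; apply/eqP/sep => i.
  by rewrite lamB // (const i x k) ?subrr //; apply/eqP.
have [h [z [z0 ea]]] : exists h z, z <> 0 /\ a = mkmalgU h z.
  apply: mono => // i h k h0 k0; apply: contrapT => hk.
  by apply: (step i); left; exists h => //; exists k.
have [k [w [w0 eb]]] : exists h z, z <> 0 /\ b = mkmalgU h z.
  apply: mono => // i h' k h0 k0; apply: contrapT => hk.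
  by apply: (step i); right; exists h' => //; exists k.
have := congr1 (coef (h + k)) ab; rewrite ea eb [_ * _]gr_mulUU coef_monomial eqxx coef_zero.
by move/eqP; rewrite mulr1n mulf_eq0 => /orP[] /eqP.
Qed.

End GroupRing.

(** * Transverse orientations of tetrahedra *)

Lemma uniq4_swap (i x y z : 'I_4) : uniq [:: i; x; y; z] = uniq [:: i; x; z; y].
Proof. by apply/perm_uniq/seq.permP => p /=; rewrite !addn0 (addnC (p y)). Qed.

Lemma uniq4_rot (i x y z : 'I_4) : uniq [:: i; x; y; z] = uniq [:: i; y; z; x].
Proof. by apply/perm_uniq/seq.permP => p /=; rewrite !addn0 [(p x + _)%N]addnC -addnA. Qed.

Lemma uniq4_mem (i a b c x : 'I_4) : uniq [:: i; a; b; c] -> x \in [:: i; a; b; c].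
Proof.
move=> u; have := uniq_min_size u (s2 := enum 'I_4).
rewrite size_enum_ord => /(_ _ isT)[|_ ->]; last by rewrite mem_enum.
by move=> z _; rewrite mem_enum.
Qed.

Lemma uniq4_pair (i a b c : 'I_4) (L : {set 'I_4}) : uniq [:: i; a; b; c] ->
  #|L| = 2 -> i \notin L -> [\/ L = [set a; b], L = [set a; c] | L = [set b; c]].
Proof.
move=> u /eqP/cards2P[x [y [xy ->]]]; rewrite !inE negb_or => /andP[ix iy].
have := uniq4_mem x u; have := uniq4_mem y u; rewrite !inE.
rewrite eq_sym in ix; rewrite eq_sym in iy; rewrite (negPf ix) (negPf iy) /=.
case/or3P=> /eqP ey; case/or3P=> /eqP ex; subst x y; rewrite ?eqxx // in xy *.
- by constructor 1; rewrite setUC.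
- by constructor 2; rewrite setUC.
- by constructor 1.
- by constructor 3; rewrite setUC.
- by constructor 2.
- by constructor 3.
Qed.

Lemma third_vertex (i : 'I_4) a b : i != a -> i != b -> a != b ->
  exists c, uniq [:: i; a; b; c].
Proof.
move=> ia ib ab; have : ~~ ([set: 'I_4] \subset [set i; a; b]).
  apply/negP => /subset_leq_card; rewrite cardsT card_ord => h.
  have : (#|[set i; a; b]| <= 3)%N.
    by rewrite -setUA cardsU1 cards2; case: (_ \notin _); case: (_ != _).
  by move/(leq_trans h).
case/subsetPn => c _; rewrite !inE !negb_or => /andP[/andP[ci ca] cb].
exists c; rewrite /= !inE !negb_or ia ib ab (eq_sym i) ci (eq_sym a) ca (eq_sym b) cb.
by [].
Qed.

Lemma two_others (i : 'I_4) : exists a b, [/\ i != a, i != b & a != b].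
Proof.
have [h|] := boolP (i \in [:: o0; o1]).
  by exists o2, o3; move: h; rewrite !inE => /orP[] /eqP->.
by rewrite !inE negb_or => /andP[h0 h1]; exists o0, o1.
Qed.

Section Constraint.
Implicit Types (o : tet_orientation) (L : {set 'I_4}).

Definition orients_edges o := forall a b, o (a, b) = (a != b) && ~~ o (b, a).

(** The condition that the upper track of a triangle imposes: if the
    large edge is [xy] and the third vertex is [z], the edges are oriented by
    the order [x, z, y] of the vertices or by its reverse. *)
Definition crosses_face i L o := forall x y z, uniq [:: i; x; y; z] -> L = [set x; y] ->
  o (x, z) = o (x, y) /\ o (z, y) = o (x, y).

(** The upper track of a triangle has two transverse orientations, which are
    opposite on all three edges. *)
Lemma crosses_face_agree i L o o' a b c d :
  orients_edges o -> orients_edges o' -> crosses_face i L o -> crosses_face i L o' ->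
  #|L| = 2 -> i \notin L -> a != b -> i != a -> i != b -> c != d -> i != c -> i != d ->
  o' (a, b) (+) o (a, b) = o' (c, d) (+) o (c, d).
Proof.
move=> ho ho' co co' cL iL.
have sym x y : x != y -> o' (x, y) (+) o (x, y) = o' (y, x) (+) o (y, x).
  by move=> xy; rewrite ho ho' xy /=; case: (o _) (o' _) => -[].
have tri x y z : uniq [:: i; x; y; z] ->
    o' (x, y) (+) o (x, y) = o' (x, z) (+) o (x, z).
  move=> u; case: (uniq4_pair u cL iL) => e.
  - by have [-> _] := co x y z u e; have [-> _] := co' x y z u e.
  - have u' : uniq [:: i; x; z; y].
      by rewrite uniq4_swap.
    by have [-> _] := co x z y u' e; have [-> _] := co' x z y u' e.
  - have u' : uniq [:: i; y; z; x].
      by rewrite -uniq4_rot.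
    have xy : x != y by move: u; rewrite /= !inE !negb_or => /and3P[_ /andP[]].
    rewrite sym //; have [-> ->] := co y z x u' e; by have [-> ->] := co' y z x u' e.
move=> ab ia ib cd ic id.
have [w u] := third_vertex ia ib ab.
have tri' x y z : i != x -> i != y -> i != z -> x != y -> x != z ->
    o' (x, y) (+) o (x, y) = o' (x, z) (+) o (x, z).
  move=> ix iy iz xy xz; have [->//|yz] := eqVneq y z.
  by apply: tri; rewrite /= !inE !negb_or ix iy iz xy xz yz.
have [ac|ac] := eqVneq a c; first by rewrite -ac; apply: tri' => //; rewrite ac.
by rewrite (tri' a b c) // sym // (tri' c a d) // eq_sym.
Qed.

Definition reorient (b : bool) o : tet_orientation :=
  [ffun e => if b then o (e.2, e.1) else o e].

Lemma reorientE b o x y : orients_edges o -> x != y -> reorient b o (x, y) = b (+) o (x, y).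
Proof. by move=> ho xy; rewrite ffunE; case: b => //=; rewrite ho eq_sym xy. Qed.

Lemma reorient_edges b o : orients_edges o -> orients_edges (reorient b o).
Proof. by move=> ho x y; rewrite !ffunE; case: b; rewrite /= ho // eq_sym. Qed.

Lemma orients_edges_ext o o' : orients_edges o -> orients_edges o' ->
  (forall a b, a != b -> o (a, b) = o' (a, b)) -> o = o'.
Proof.
move=> ho ho' e; apply/ffunP => -[a b]; have [->|ab] := eqVneq a b; last exact: e.
by rewrite ho ho' eqxx.
Qed.

End Constraint.

Section Diagonals.
Variable V : transverse_taut.
Implicit Types (t : tet V) (s : face V).

Lemma in_bottom_diagonal t a : (a \in bottom_diagonal t) = points_out t a.
Proof.
apply/bigcapP/idP => [h|h i]; last by rewrite !inE; apply: contraNneq => <-.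
by apply: contraT => /h; rewrite !inE eqxx.
Qed.

Lemma in_top_diagonal t a : (a \in top_diagonal t) = ~~ points_out t a.
Proof.
apply/bigcapP/idP => [h|h i hi]; last by rewrite !inE; apply: contraNneq h => ->.
by apply/negP => /h; rewrite !inE eqxx.
Qed.

Lemma card_bottom_diagonal t : #|bottom_diagonal t| = 2.
Proof.
rewrite -(two_top_faces t); apply: eq_card => a.
by rewrite inE in_bottom_diagonal.
Qed.

Lemma card_top_diagonal t : #|top_diagonal t| = 2.
Proof.
have -> : top_diagonal t = ~: bottom_diagonal t.
  by apply/setP => a; rewrite inE in_top_diagonal in_bottom_diagonal.
by rewrite cardsCs setCK card_bottom_diagonal card_ord.
Qed.

Lemma in_upper_large_edge s a : (a \in upper_large_edge s.1 s.2) =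
  if points_out s.1 s.2 then points_out (opposite s).1 (gluing s.1 s.2 a)
  else points_out s.1 a.
Proof.
by rewrite /upper_large_edge; case: ifP; rewrite ?inE in_bottom_diagonal.
Qed.

Lemma upper_large_edge_glued s a :
  (gluing s.1 s.2 a \in upper_large_edge (opposite s).1 (opposite s).2) =
  (a \in upper_large_edge s.1 s.2).
Proof.
have e : gluing (opposite s).1 (opposite s).2 (gluing s.1 s.2 a) = a.
  by rewrite /opposite /= gluingK permK.
by rewrite !in_upper_large_edge points_out_glued oppositeK e; case: points_out.
Qed.

Lemma card_upper_large_edge s : #|upper_large_edge s.1 s.2| = 2.
Proof.
rewrite /upper_large_edge; case: ifP => _; last exact: card_bottom_diagonal.
rewrite -(card_bottom_diagonal (neighbour s.1 s.2)).
have -> : [set a | gluing s.1 s.2 a \in bottom_diagonal (neighbour s.1 s.2)] =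
  gluing s.1 s.2 @^-1: bottom_diagonal (neighbour s.1 s.2) by apply/setP => a; rewrite !inE.
by apply: on_card_preimset; apply: onW_bij; exists (gluing s.1 s.2)^-1%g => x; rewrite ?permK ?permKV.
Qed.

Lemma notin_upper_large_edge s : s.2 \notin upper_large_edge s.1 s.2.
Proof.
by rewrite in_upper_large_edge; case: ifP => [|->//]; rewrite points_out_glued => ->.
Qed.

End Diagonals.

Section Signs.
Variable V : transverse_taut.
Variable ort : tet V -> tet_orientation.
Hypothesis ortP : forall t, transverse_orientation t (ort t).

Let orte t : orients_edges (ort t). Proof. by case: (ortP t). Qed.
Let ortc t i : crosses_face i (upper_large_edge t i) (ort t).
Proof. by case: (ortP t) => _ h x y z; apply: h. Qed.

Lemma transverse_reorient t b : transverse_orientation t (reorient b (ort t)).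
Proof.
split; first exact: reorient_edges.
move=> i x y z u e; have [h1 h2] := ortc u e.
move: u; rewrite /= !inE !negb_or => /and4P[_ /andP[xy xz] yz _].
by rewrite !reorientE // ?h1 ?h2 // eq_sym.
Qed.

(** Two faces of a tetrahedron share an edge, so agreement on one edge
    propagates from face to face. *)
Lemma transverse_orientation_uniq t o : transverse_orientation t o ->
  exists b, o = reorient b (ort t).
Proof.
case=> oe oc; exists (o (o0, o1) (+) ort t (o0, o1)).
apply: orients_edges_ext => // [|a b ab]; first exact: reorient_edges.
rewrite reorientE //.
have ag i a' b' c' d' := crosses_face_agree
  (a := a') (b := b') (c := c') (d := d') (orte t) oe (@ortc t i) (oc i)
  (card_upper_large_edge (t, i)) (notin_upper_large_edge (t, i)).
suff -> : o (o0, o1) (+) ort t (o0, o1) = o (a, b) (+) ort t (a, b) by rewrite addbK.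
have f01 i : i != o0 -> i != o1 -> i != a -> i != b ->
  o (o0, o1) (+) ort t (o0, o1) = o (a, b) (+) ort t (a, b).
  by move=> *; apply: (ag i).
have e1 : o (o0, o1) (+) ort t (o0, o1) = o (o1, o2) (+) ort t (o1, o2) by apply: (ag o3).
have e2 : o (o1, o2) (+) ort t (o1, o2) = o (o2, o3) (+) ort t (o2, o3) by apply: (ag o0).
have e3 : o (o2, o3) (+) ort t (o2, o3) = o (o3, o2) (+) ort t (o3, o2) by apply: (ag o0).
have [/existsP[i /and4P[]]|] := boolP [exists i, [&& i != o0, i != o1, i != a & i != b]].
  exact: f01.
rewrite negb_exists => /forallP h.
have := h o2; have := h o3; rewrite /= !negb_and !negbK => h3 h2.
have : (a == o2) && (b == o3) || (a == o3) && (b == o2).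
  by move: h3 h2; rewrite ![_ == a]eq_sym ![_ == b]eq_sym; case: eqP => [->|_]; case: eqP => [->|_];
   rewrite /= ?orbF ?orbT ?andbT.
case/orP=> /andP[/eqP-> /eqP->]; first by rewrite e1.
by rewrite e1 e2.
Qed.

Definition twist (s : face V) : bool :=
  ~~ `[< orientations_match s (ort s.1) (ort (opposite s).1) >].

(** The upper large edge of a triangle is the same seen from both sides, so the
    orientations on both sides are transverse orientations of one track. *)
Lemma twistE s a b : a != b -> s.2 != a -> s.2 != b ->
  ort (opposite s).1 (gluing s.1 s.2 a, gluing s.1 s.2 b) = twist s (+) ort s.1 (a, b).
Proof.
move=> ab sa sb.
pose o' : tet_orientation :=
  [ffun e => ort (opposite s).1 (gluing s.1 s.2 e.1, gluing s.1 s.2 e.2)].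
have oe : orients_edges o'.
  by move=> x y; rewrite !ffunE /= orte (inj_eq perm_inj).
have oc : crosses_face s.2 (upper_large_edge s.1 s.2) o'.
  move=> x y z u e; rewrite !ffunE; apply: (@ortc _ (opposite s).2).
    by rewrite -(map_inj_uniq (@perm_inj _ (gluing s.1 s.2))) in u.
  apply/setP => c; rewrite -(permKV (gluing s.1 s.2) c) upper_large_edge_glued e.
  by rewrite !inE !(inj_eq perm_inj).
have ag a' b' c' d' := crosses_face_agree
  (a := a') (b := b') (c := c') (d := d') (orte s.1) oe (@ortc s.1 s.2) oc
  (card_upper_large_edge s) (notin_upper_large_edge s).
rewrite /twist; case: asboolP => [h|h] /=.
  by apply: h; rewrite eq_sym.
have [c [d [cd sc sd ne]]] : exists c d, [/\ c != d, s.2 != c, s.2 != d & o' (c, d) != ort s.1 (c, d)].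
  apply: contrapT => hn; apply: h => c d cs ds.
  have [->|cd] := eqVneq c d; first by rewrite [LHS]orte [RHS]orte !eqxx.
  apply/eqP/negbNE/negP => ne; apply: hn; exists c, d.
  by rewrite cd eq_sym cs eq_sym ds ffunE.
have := ag a b c d ab sa sb cd sc sd; rewrite [o' (a, b)]ffunE /=.
by move: ne; case: (o' _); case: (ort s.1 (c, d)) => //= _; case: (ort _ _); case: (ort _ _).
Qed.

Lemma reorient_inj t b b' : reorient b (ort t) = reorient b' (ort t) -> b = b'.
Proof.
move=> /ffunP/(_ (o0, o1)); rewrite !reorientE // => e.
by rewrite -(addbK (ort t (o0, o1)) b) e addbK.
Qed.

Lemma orientations_match_reorient s b b' :
  orientations_match s (reorient b (ort s.1)) (reorient b' (ort (opposite s).1)) <->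
  b' = b (+) twist s.
Proof.
split=> [h|-> x y xs ys].
  have [x [y [xs ys xy]]] := two_others s.2.
  rewrite eq_sym in xs; rewrite eq_sym in ys.
  move: (h x y xs ys) => {h}; rewrite !reorientE ?(inj_eq perm_inj) // twistE // 1?eq_sym //.
  by case: b' b (twist _) (ort _ _) => [] [] [] [].
have [->|xy] := eqVneq x y.
  by rewrite [LHS](reorient_edges _ (orte _)) [RHS](reorient_edges _ (orte _)) !eqxx.
rewrite !reorientE ?(inj_eq perm_inj) // twistE // 1?eq_sym //.
by case: b (twist _) (ort _ _) => [] [] [].
Qed.

Definition path_twist (w : seq (face V)) : bool := foldr (fun s b => twist s (+) b) false w.

Lemma path_twist_cat u v : path_twist (u ++ v) = path_twist u (+) path_twist v.
Proof. by elim: u => //= s u ->; rewrite addbA. Qed.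

Lemma liftsP x w y b o' : walk x w y ->
  lifts w (reorient b (ort x)) o' <-> o' = reorient (b (+) path_twist w) (ort y).
Proof.
elim: w x b => [|s w IH] x b /=; first by move/eqP->; rewrite addbF; split=> ->.
case/andP=> /eqP<- hw; split.
  case=> u [/transverse_orientation_uniq[b' ->]].
  by move=> /orientations_match_reorient -> /(IH _ _ hw)->; rewrite addbA.
move=> e; exists (reorient (b (+) twist s) (ort (opposite s).1)); split.
- exact: transverse_reorient.
- exact/orientations_match_reorient.
- by apply/(IH _ _ hw); rewrite e addbA.
Qed.

Lemma lifts_to_loopP t0 (w : dual_path t0 t0) : lifts_to_loop w <-> path_twist (val w) = false.
Proof.
split=> [[o [/transverse_orientation_uniq[b ->]]] /(liftsP _ _ (valP w)) /reorient_inj|h].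
  by case: b (path_twist _) => [] [].
exists (ort t0); split=> //.
have := liftsP false (ort t0) (valP w); rewrite h.
have -> : reorient false (ort t0) = ort t0 by apply/ffunP => e; rewrite ffunE.
by case=> _; apply.
Qed.

Lemma twist_opposite s : twist (opposite s) = twist s.
Proof.
have [x [y [xs ys xy]]] := two_others s.2.
have e1 := twistE xy xs ys.
have := @twistE (opposite s) (gluing s.1 s.2 x) (gluing s.1 s.2 y).
rewrite !(inj_eq perm_inj) => /(_ xy xs ys); rewrite e1 oppositeK.
have ga a : gluing (opposite s).1 (opposite s).2 (gluing s.1 s.2 a) = a.
  by rewrite /opposite /= gluingK permK.
by rewrite !ga; case: (twist _) (twist _) (ort _ _) => [] [] [].
Qed.

End Signs.

Section Turning.
Variable V : triangulation.
Implicit Type x : flag V.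

Lemma turn_o0 x : (turn x).2 o0 = gluing x.1 (x.2 o2) (x.2 o0).
Proof. by rewrite /= !permM tpermD. Qed.
Lemma turn_o1 x : (turn x).2 o1 = gluing x.1 (x.2 o2) (x.2 o1).
Proof. by rewrite /= !permM tpermD. Qed.
Lemma turn_o3 x : (turn x).2 o3 = gluing x.1 (x.2 o2) (x.2 o2).
Proof. by rewrite /= !permM tpermR. Qed.

Lemma turn_inj : injective (@turn V).
Proof.
move=> x y e.
have ex (z : flag V) : opposite (flag_step z) = ((turn z).1, (turn z).2 o3).
  by rewrite turn_o3.
have es : flag_step x = flag_step y by apply: (inv_inj (@oppositeK V)); rewrite !ex e.
move: e; case: x y es => [t p] [t' p'] /= [-> e2].
rewrite /turn /= e2 => -[] /mulgI/mulIg->.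
by [].
Qed.

Lemma odd_turn x : odd_perm (turn x).2 = odd_perm x.2.
Proof. by rewrite /= !odd_permM odd_tperm gluing_odd /= addbT negbK. Qed.

Lemma around_cycle x : iter (fingraph.order (@turn V) x) (@turn V) x = x.
Proof. exact: iter_order turn_inj _. Qed.

End Turning.

Section Holonomy.
Variable V : transverse_taut.
Variable ort : tet V -> tet_orientation.
Hypothesis ortP : forall t, transverse_orientation t (ort t).
Local Notation path_twist := (path_twist ort).
Local Notation twist := (twist ort).

Definition edge_sign (x : flag V) : bool := ort x.1 (x.2 o0, x.2 o1).

Lemma edge_sign_turn x : edge_sign (turn x) = twist (flag_step x) (+) edge_sign x.
Proof.
rewrite /edge_sign turn_o0 turn_o1.
by apply: (twistE ortP (s := flag_step x)); rewrite (inj_eq perm_inj).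
Qed.

Lemma path_twist_around x n :
  path_twist (around x n) = edge_sign (iter n (@turn V) x) (+) edge_sign x.
Proof.
elim: n x => [|n IH] x; first by rewrite addbb.
have -> : around x n.+1 = flag_step x :: around (turn x) n by [].
by rewrite /= IH -iterSr edge_sign_turn; case: (edge_sign x) (twist _) (edge_sign _) => [] [] [].
Qed.

(** Around an edge, the twists add up to the total change of the orientation of
    this very edge. *)
Lemma path_twist_null r : null_loop r -> path_twist r = false.
Proof.
case=> [[s ->]|[f ->]] /=; first by rewrite twist_opposite // addbF addbb.
by rewrite path_twist_around around_cycle addbb.
Qed.

Lemma path_twist_homotopic x y w w' : homotopic x y w w' -> path_twist w = path_twist w'.
Proof.
elim=> [a b [_ _ [u [r [v [-> -> hr]]]]]|//|a b _ ->//|a b c _ -> _ ->//].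
by rewrite !path_twist_cat // (path_twist_null hr).
Qed.

Variable t0 : tet V.

Lemma edge_orientation_loop (w : dual_path t0 t0) :
  edge_orientation (loop_class w) = (-1) ^+ path_twist (val w).
Proof.
rewrite /edge_orientation; case: asboolP => [[w' [/loop_classE h /(lifts_to_loopP ortP)]]|h].
  by rewrite (path_twist_homotopic h) => ->.
case e : (path_twist _) => //; case: h; exists w; split=> //.
exact/(lifts_to_loopP ortP).
Qed.

Lemma edge_orientationM (g h : pi1 t0) :
  edge_orientation (g * h)%g = edge_orientation g * edge_orientation h.
Proof.
rewrite -[g]loop_class_repr -[h]loop_class_repr [(_ * _)%g]pi1_mulE.
by rewrite !edge_orientation_loop path_twist_cat signr_addb.
Qed.

End Holonomy.

(** * Existence of transverse orientations *)

Lemma ord4_ind (P : 'I_4 -> Prop) : P o0 -> P o1 -> P o2 -> P o3 -> forall i, P i.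
Proof.
move=> p0 p1 p2 p3 [[|[|[|[|//]]]] hi].
- by rewrite (_ : Ordinal hi = o0) //; apply: val_inj.
- by rewrite (_ : Ordinal hi = o1) //; apply: val_inj.
- by rewrite (_ : Ordinal hi = o2) //; apply: val_inj.
- by rewrite (_ : Ordinal hi = o3) //; apply: val_inj.
Qed.

Lemma perm4 (a b c d : 'I_4) : uniq [:: a; b; c; d] ->
  exists p : 'S_4, [/\ p o0 = a, p o1 = b, p o2 = c & p o3 = d].
Proof.
move=> u; have inj : injective (tnth [tuple a; b; c; d]) by apply/tuple_uniqP.
by exists (perm inj); split; rewrite permE (tnth_nth a).
Qed.

(** A tetrahedron whose large edges are as for the linear order [m o0 < m o1 <
    m o2 < m o3] of its vertices, where in each face the large edge joins the
    smallest and the largest vertex, is transversely oriented by this order. *)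
Lemma large_edge_order (U : 'I_4 -> {set 'I_4}) (m : 'S_4) :
  U (m o3) = [set m o2; m o0] -> U (m o0) = [set m o1; m o3] ->
  U (m o1) = [set m o0; m o3] -> U (m o2) = [set m o0; m o3] ->
  exists o, orients_edges o /\ forall i, crosses_face i (U i) o.
Proof.
move=> h3 h0 h1 h2.
pose o : tet_orientation := [ffun e => (m^-1 e.1 < m^-1 e.2)%g%N]%g.
have oE a b : o (m a, m b) = (a < b)%N by rewrite ffunE /= !permK.
exists o; split=> [a b|i x y z].
  rewrite -(permKV m a) -(permKV m b) !oE (inj_eq perm_inj) -leqNgt ltn_neqAle.
  by [].
rewrite -(permKV m i) -(permKV m x) -(permKV m y) -(permKV m z).
move: (m^-1 i)%g (m^-1 x)%g (m^-1 y)%g (m^-1 z)%g => {}i {}x {}y {}z.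
rewrite -[[:: _; _; _; _]]/(map m [:: i; x; y; z]) (map_inj_uniq perm_inj) !oE => u e.
have mx : m x \in U (m i) by rewrite e !inE eqxx.
have my : m y \in U (m i) by rewrite e !inE eqxx orbT.
move: u mx my {e}; elim/ord4_ind: i; rewrite ?h0 ?h1 ?h2 ?h3 !inE !(inj_eq perm_inj).
all: by elim/ord4_ind: x => //; elim/ord4_ind: y => //; elim/ord4_ind: z.
Qed.

Section Veering.
Variable V : veering.

Lemma in_bottom_topN (t : tet V) a : (a \in bottom_diagonal t) = (a \notin top_diagonal t).
Proof. by rewrite in_bottom_diagonal in_top_diagonal negbK. Qed.

Lemma red_glued_face (t : tet V) i a b : a != b -> i != a -> i != b ->
  red (neighbour t i, [set gluing t i a; gluing t i b]) = red (t, [set a; b]).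
Proof.
move=> ab ia ib; apply: red_glued; first by rewrite /= cards2 ab.
apply/existsP; exists i; rewrite /= !inE negb_or ia ib /=.
by apply/eqP; congr pair; rewrite imsetU1 imset_set1.
Qed.

(** For the viewer, the edges of a top face follow each other counterclockwise
    as top diagonal, red edge, blue edge with respect to the tetrahedron below,
    and as large edge, blue edge, red edge with respect to the tetrahedron
    above.  So the large edge is not the top diagonal, and it is the red
    equatorial edge if the top diagonal is red, the blue one otherwise. *)
Lemma upper_large_edge_red (t : tet V) (q : 'S_4) : ~~ odd_perm q ->
  top_diagonal t = [set q o0; q o1] -> bottom_diagonal t = [set q o2; q o3] ->
  upper_large_edge t (q o3) =
    if red (t, [set q o0; q o1]) then [set q o2; q o0] else [set q o2; q o1].
Proof.
move=> evq topq botq.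
have [_ red13 _ blue12] := red_slope evq topq botq.
have [red02 _ _ _] := red_slope evq topq botq.
set i := q o3; set u := neighbour t i; pose W := (q * gluing t i)%g.
have out_i : points_out t i by rewrite -in_bottom_diagonal botq !inE eqxx orbT.
have WE x : W x = gluing t i (q x) by rewrite permM.
have oddW : odd_perm W by rewrite odd_permM gluing_odd addbT.
move: W WE oddW => W WE oddW.
have redW x y : x != y -> x != o3 -> y != o3 ->
    red (u, [set W x; W y]) = red (t, [set q x; q y]).
  by move=> xy x3 y3; rewrite !WE red_glued_face ?(inj_eq perm_inj) // eq_sym.
have top3 : W o3 \in top_diagonal u.
  by rewrite in_top_diagonal WE (points_out_glued (t, i)) negbK.
have inU x : (q x \in upper_large_edge t i) = (W x \notin top_diagonal u).
  by rewrite (in_upper_large_edge (t, i)) /= out_i WE in_top_diagonal negbK.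
have [z [z3 topu]] : exists z, z != o3 /\ top_diagonal u = [set W z; W o3].
  have /eqP/cards2P[a [b [ab e]]] := card_top_diagonal u.
  move: top3; rewrite e !inE => /orP[] /eqP h.
    exists (W^-1 b)%g; rewrite permKV setUC h; split=> //.
    by apply: contraNneq ab => e3; rewrite -h -e3 permKV.
  exists (W^-1 a)%g; rewrite permKV h; split=> //.
  by apply: contraNneq ab => e3; rewrite -h -e3 permKV.
have botu c d : (forall x, (x != z) && (x != o3) = (x == c) || (x == d)) ->
    bottom_diagonal u = [set W c; W d].
  move=> h; apply/setP => a; rewrite -(permKV W a) in_bottom_topN topu !inE.
  by rewrite !(inj_eq perm_inj) negb_or h.
have largeE c d : (forall x, (x != z) && (x != o3) = (x == c) || (x == d)) ->
    upper_large_edge t i = [set q c; q d].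
  move=> h; apply/setP => a; rewrite -(permKV q a) inU topu !inE.
  by rewrite !(inj_eq perm_inj) negb_or h.
(* [q z] is opposite to the large edge in the face.  Each value of [z] forces
   an even labelling of the tetrahedron above, obtained from [W], which is odd,
   by the odd permutation of the case. *)
elim/ord4_ind: z z3 topu botu largeE => // _ topu botu largeE.
- have compl x : (x != o0) && (x != o3) = (x == o2) || (x == o1) by elim/ord4_ind: x.
  have ev : ~~ odd_perm (tperm o1 o3 * W)%g by rewrite odd_permM odd_tperm oddW.
  have [||_ _] := red_slope (t := u) ev.
  + by rewrite !permM topu ?tpermL ?tpermR ?tpermD.
  + by rewrite !permM (botu o2 o1) // ?tpermL ?tpermR ?tpermD.
  by rewrite !permM ?tpermL ?tpermR ?tpermD // redW // => /negPf-> _; apply: largeE.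
- have compl x : (x != o1) && (x != o3) = (x == o2) || (x == o0) by elim/ord4_ind: x.
  pose s := (tperm o0 o1 * tperm o0 o3 * tperm o0 o2)%g.
  have ev : ~~ odd_perm (s * W)%g by rewrite !odd_permM !odd_tperm oddW.
  have s0 : s o0 = o1 by rewrite /s !permM tpermL !tpermD.
  have s1 : s o1 = o3 by rewrite /s !permM tpermR tpermL tpermD.
  have s2 : s o2 = o0 by rewrite /s !permM (tpermD _ _ (z := o2)) // (tpermD _ _ (z := o2)) // tpermR.
  have s3 : s o3 = o2 by rewrite /s !permM (tpermD _ _ (z := o3)) // tpermR tpermL.
  move: s ev s0 s1 s2 s3 => s ev s0 s1 s2 s3.
  have [||r _ _ _] := red_slope (t := u) ev.
  + by rewrite !permM topu s0 s1.
  + by rewrite !permM s2 s3 setUC; apply: botu.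
  move: r; rewrite !permM s0 s2 redW // setUC => ->; exact: largeE.
- pose s := (tperm o0 o2 * tperm o0 o1 * tperm o0 o3)%g.
  have ev : ~~ odd_perm (s * W)%g by rewrite !odd_permM !odd_tperm oddW.
  have s0 : s o0 = o2 by rewrite /s !permM tpermL !tpermD.
  have s1 : s o1 = o3 by rewrite /s !permM (tpermD _ _ (z := o1)) // tpermR tpermL.
  have s2 : s o2 = o1 by rewrite /s !permM tpermR tpermL tpermD.
  have s3 : s o3 = o0 by rewrite /s !permM (tpermD _ _ (z := o3)) // (tpermD _ _ (z := o3)) // tpermR.
  move: s ev s0 s1 s2 s3 => s ev s0 s1 s2 s3.
  have [||r _ _ _] := red_slope (t := u) ev.
  + by rewrite !permM topu s0 s1.
  + by rewrite !permM s2 s3; apply: botu; elim/ord4_ind.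
  by move: r; rewrite !permM s0 s2 redW // setUC (negPf blue12).
Qed.

(** The large edges of both top faces have the colour of the top diagonal, so
    they are opposite edges of the tetrahedron; with the bottom diagonal, the
    large edge of the bottom faces, they form the pattern of a linear order. *)
Lemma transverse_orientation_exists (t : tet V) : exists o, transverse_orientation t o.
Proof.
have [q [evq topq botq]] : exists q : 'S_4, [/\ ~~ odd_perm q,
    top_diagonal t = [set q o0; q o1] & bottom_diagonal t = [set q o2; q o3]].
  have /eqP/cards2P[a [b [ab ea]]] := card_top_diagonal t.
  have /eqP/cards2P[c [d [cd ec]]] := card_bottom_diagonal t.
  have dis x : x \in [set a; b] -> x \notin [set c; d] by rewrite -ea -ec in_bottom_topN negbK.
  have [|p [p0 p1 p2 p3]] := @perm4 a b c d.
    have := dis a; have := dis b; rewrite !inE !eqxx orbT => /(_ isT).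
    rewrite negb_or => /andP[bc bd] /(_ isT); rewrite negb_or => /andP[ac ad].
    by rewrite /= !inE !negb_or ab cd bc bd ac ad.
  have [op|ep] := boolP (odd_perm p); last by exists p; rewrite p0 p1 p2 p3.
  exists (tperm o0 o1 * p)%g; rewrite odd_permM odd_tperm op !permM.
  by rewrite tpermL tpermR !tpermD // p0 p1 p2 p3 setUC.
have large3 := upper_large_edge_red evq topq botq.
pose r := (tperm o0 o1 * tperm o2 o3)%g.
have r0 : r o0 = o1 by rewrite /r permM tpermL tpermD.
have r1 : r o1 = o0 by rewrite /r permM tpermR tpermD.
have r2 : r o2 = o3 by rewrite /r permM (tpermD _ _ (z := o2)) // tpermL.
have r3 : r o3 = o2 by rewrite /r permM (tpermD _ _ (z := o3)) // tpermR.
have evr : ~~ odd_perm r by rewrite odd_permM !odd_tperm.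
move: r evr r0 r1 r2 r3 => r evr r0 r1 r2 r3.
have large2 : upper_large_edge t (q o2) =
    if red (t, [set q o0; q o1]) then [set q o3; q o1] else [set q o3; q o0].
  have := @upper_large_edge_red t (r * q)%g.
  rewrite odd_permM (negPf evr) !permM r0 r1 r2 r3 ![[set q o1; q o0]]setUC.
  by apply=> //; rewrite setUC.
have bot x : x \in [set q o0; q o1] -> upper_large_edge t x = [set q o2; q o3].
  by rewrite -topq in_top_diagonal /upper_large_edge => /negPf->.
have [|] := boolP (red (t, [set q o0; q o1])) => b; rewrite ?b ?(negPf b) in large2 large3.
  have [|m [m0 m1 m2 m3]] := @perm4 (q o2) (q o1) (q o0) (q o3).
    by rewrite -[[:: _; _; _; _]]/(map q [:: o2; o1; o0; o3]) (map_inj_uniq perm_inj).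
  apply: (@large_edge_order _ m); rewrite ?m0 ?m1 ?m2 ?m3.
  - by rewrite large3 setUC.
  - by rewrite large2 setUC.
  - by apply: bot; rewrite !inE eqxx orbT.
  - by apply: bot; rewrite !inE eqxx.
have [|m [m0 m1 m2 m3]] := @perm4 (q o2) (q o0) (q o1) (q o3).
  by rewrite -[[:: _; _; _; _]]/(map q [:: o2; o0; o1; o3]) (map_inj_uniq perm_inj).
apply: (@large_edge_order _ m); rewrite ?m0 ?m1 ?m2 ?m3.
- by rewrite large3 setUC.
- by rewrite large2 setUC.
- by apply: bot; rewrite !inE eqxx.
- by apply: bot; rewrite !inE eqxx orbT.
Qed.

End Veering.

(** * Turning around an edge *)

Lemma perm4_ext (p q : 'S_4) : p o0 = q o0 -> p o1 = q o1 -> p o2 = q o2 -> p o3 = q o3 -> p = q.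
Proof. by move=> h0 h1 h2 h3; apply/permP; elim/ord4_ind. Qed.

(** The even permutation that reverses an edge and exchanges the two faces that
    contain it. *)
Definition half_turn : 'S_4 := locked (tperm o0 o1 * tperm o2 o3)%g.
Lemma half_turn0 : half_turn o0 = o1.
Proof. by rewrite /half_turn -lock permM tpermL tpermD. Qed.
Lemma half_turn1 : half_turn o1 = o0.
Proof. by rewrite /half_turn -lock permM tpermR tpermD. Qed.
Lemma half_turn2 : half_turn o2 = o3.
Proof. by rewrite /half_turn -lock permM (tpermD _ _ (z := o2)) // tpermL. Qed.
Lemma half_turn3 : half_turn o3 = o2.
Proof. by rewrite /half_turn -lock permM (tpermD _ _ (z := o3)) // tpermR. Qed.
Definition half_turnE := (half_turn0, half_turn1, half_turn2, half_turn3).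

Lemma ord4_cases (i : 'I_4) : [\/ i = o0, i = o1, i = o2 | i = o3].
Proof. by elim/ord4_ind: i; [constructor 1|constructor 2|constructor 3|constructor 4]. Qed.

Lemma even_stabilizer (s : 'S_4) : ~~ odd_perm s -> s o0 \in [set o0; o1] ->
  s o1 \in [set o0; o1] -> s = 1%g \/ s = half_turn.
Proof.
move=> ev; have u : uniq (map s [:: o0; o1; o2; o3]) by rewrite (map_inj_uniq perm_inj).
rewrite !inE => /orP[] /eqP s0 /orP[] /eqP s1; rewrite /= s0 s1 //= in u;
  case: (ord4_cases (s o2)) => s2; rewrite s2 //= in u;
  case: (ord4_cases (s o3)) => s3; rewrite s3 //= {u} in u.
- by left; apply: perm4_ext; rewrite perm1.
- suff es : s = tperm o2 o3 by rewrite es odd_tperm in ev.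
  by apply: perm4_ext; rewrite ?s0 ?s1 ?s2 ?s3 ?tpermL ?tpermR ?tpermD.
- suff es : s = tperm o0 o1 by rewrite es odd_tperm in ev.
  by apply: perm4_ext; rewrite ?s0 ?s1 ?s2 ?s3 ?tpermL ?tpermR ?tpermD.
- by right; apply: perm4_ext; rewrite half_turnE.
Qed.

Section Orbits.
Variable V : transverse_taut.
Implicit Types x y : flag V.

Definition flip x : flag V := (x.1, (half_turn * x.2)%g).

Lemma turn_flip_turn x : turn (flip (turn x)) = flip x.
Proof.
case: x => t p; rewrite /turn /flip /= !permM !half_turnE tpermR.
rewrite neighbourK gluingK; congr pair.
have t0 : tperm o2 o3 o0 = o0 by rewrite tpermD.
have t1 : tperm o2 o3 o1 = o1 by rewrite tpermD.
by apply: perm4_ext; rewrite !permM ?(tpermL, tpermR, t0, t1) !half_turnE ?(tpermL, tpermR, t0, t1) permK.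
Qed.

Lemma flip_neq x : flip x <> x.
Proof.
case: x => t p [] /permP/(_ o0); rewrite permM half_turnE.
by move/perm_inj.
Qed.

Lemma turn_neq_flip x : turn x <> flip x.
Proof.
move=> e; have e1 : opposite (flag_step x) = flag_step x.
  have -> : opposite (flag_step x) = ((turn x).1, (turn x).2 o3) by rewrite turn_o3.
  by rewrite e /= permM half_turnE.
by have := points_out_glued (flag_step x); rewrite e1; case: points_out.
Qed.

(** The flip conjugates the turn to its inverse.  If it preserved an orbit, it
    would act on this cycle as a reflection, and would fix a flag or exchange
    two consecutive ones.  The latter would glue a face to itself, against the
    coorientation. *)
Lemma orbit_no_flip x y : fconnect (@turn V) x y -> y <> flip x.
Proof.
move/iter_findex <-; move: (findex _ _ _) => n.
have iterflip m : iter m (@turn V) (flip (iter m (@turn V) x)) = flip x.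
  by elim: m => // m IH; rewrite iterSr /= turn_flip_turn.
have iinj m : injective (iter m (@turn V)).
  by elim: m => // m IH a b /= /turn_inj/IH.
rewrite -(odd_double_half n) -addnn; case: (odd n) => e.
  apply: (@turn_neq_flip (iter n./2 (@turn V) x)); apply: (iinj n./2).
  by rewrite -iterSr -iterD iterflip -e add1n.
apply: (@flip_neq (iter n./2 (@turn V) x)); apply: (iinj n./2).
by rewrite -iterD iterflip -e.
Qed.

Lemma odd_orbit x y : fconnect (@turn V) x y -> odd_perm y.2 = odd_perm x.2.
Proof.
move/iter_findex <-; elim: (findex _ _ _) => // n IH.
by rewrite iterS odd_turn.
Qed.

Lemma same_edge_flags x y : x.1 = y.1 -> odd_perm x.2 = odd_perm y.2 ->
  (flag_edge x).2 = (flag_edge y).2 -> x = y \/ x = flip y.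
Proof.
case: x y => t p [t' p'] /= -> op ep.
have [||||] := @even_stabilizer (p * p'^-1)%g.
- by rewrite odd_permM odd_permV op addbb.
- have : p o0 \in [set p' o0; p' o1] by rewrite -ep !inE eqxx.
  by rewrite permM => /set2P[] ->; rewrite permK !inE.
- have : p o1 \in [set p' o0; p' o1] by rewrite -ep !inE eqxx orbT.
  by rewrite permM => /set2P[] ->; rewrite permK !inE.
- by move/(canRL (mulgK _)); rewrite invgK mul1g => ->; left.
by move/(canRL (mulgK _)); rewrite invgK => ->; right.
Qed.

(** Four flags have a given underlying edge.  Turning preserves parity, which
    leaves the flag and its flip; the flip is not in the orbit. *)
Lemma orbit_edge_inj x y : fconnect (@turn V) x y -> flag_edge x = flag_edge y -> x = y.
Proof.
move=> c e; have [et ep] := (congr1 fst e, congr1 snd e).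
by have [->|/(orbit_no_flip c)] := same_edge_flags (esym et) (odd_orbit c) (esym ep).
Qed.

Lemma flag_edge_turn x : glued_edges (flag_edge x) (flag_edge (turn x)).
Proof.
apply/existsP; exists (x.2 o2); rewrite /= !inE !(inj_eq perm_inj) /=.
by rewrite imsetU1 imset_set1 -turn_o0 -turn_o1.
Qed.

Lemma glued_edges_sym : symmetric (@glued_edges V).
Proof.
suff h (x y : local_edge V) : glued_edges x y -> glued_edges y x by move=> x y; apply/idP/idP; apply: h.
case/existsP=> i /andP[ix /eqP->]; apply/existsP; exists (gluing x.1 i i).
rewrite /= mem_imset; last exact: perm_inj.
rewrite ix neighbourK gluingK -imset_comp (eq_imset (g := id)) ?imset_id; last exact: permK.
by rewrite -surjective_pairing eqxx.
Qed.

Lemma edge_connect_sym : connect_sym (@glued_edges V).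
Proof. exact/sym_connect_sym/glued_edges_sym. Qed.

(** A flag gives the two faces that contain its edge, so a gluing of the edge
    across a face is a turn of the flag or the inverse of one. *)
Lemma orbit_edge_surj x (z : local_edge V) : connect (@glued_edges V) (flag_edge x) z ->
  exists2 y, fconnect (@turn V) x y & flag_edge y = z.
Proof.
case/connectP=> p; elim/last_ind: p z => [|p w IH] z.
  by move=> _ ->; exists x; rewrite ?connect0.
rewrite rcons_path last_rcons => /andP[/IH h g] ->; have [y cy ey] := h _ erefl.
move: g; rewrite -ey => /existsP[i /andP[iy /eqP->]].
have : (i == y.2 o2) || (i == y.2 o3).
  have := uniq4_mem i (a := y.2 o1) (b := y.2 o2) (c := y.2 o3) (i := y.2 o0).
  rewrite -[[:: _; _; _; _]]/(map y.2 [:: o0; o1; o2; o3]) (map_inj_uniq perm_inj).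
  move/(_ isT); move: iy; rewrite /= !inE negb_or => /andP[/negPf-> /negPf->].
  by [].
case/orP=> /eqP ei.
  exists (turn y); first exact: connect_trans cy (fconnect1 _ _).
  by rewrite /flag_edge turn_o0 turn_o1 ei imsetU1 imset_set1.
pose y' := finv (@turn V) y; have ty : turn y' = y by apply: f_finv; exact: turn_inj.
exists y'; first by apply: connect_trans cy (fconnect_finv _ _).
have eo : opposite (flag_step y') = (y.1, y.2 o3) by rewrite -ty turn_o3.
have es : flag_step y' = opposite (y.1, y.2 o3) by rewrite -eo oppositeK.
have eg : gluing y.1 (y.2 o3) = (gluing y'.1 (y'.2 o2))^-1%g.
  by rewrite -gluingK; congr gluing; [move/(congr1 fst): eo | move/(congr1 snd): eo].
rewrite /flag_edge /= ei imsetU1 imset_set1 eg; congr pair.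
  by move/(congr1 fst): es.
by rewrite -ty turn_o0 turn_o1 !permK.
Qed.

End Orbits.

Section Counting.
Variable V : transverse_taut.

Lemma edge_class_eq (x y : local_edge V) : y \in edge_class x -> edge_class y = edge_class x.
Proof.
rewrite inE => c; apply/setP => z; rewrite !inE.
by rewrite (same_connect (@edge_connect_sym V) c).
Qed.

Lemma edge_class_refl (x : local_edge V) : x \in edge_class x.
Proof. by rewrite inE connect0. Qed.

Lemma edge_val_class (e : edge V) (y : local_edge V) : y \in val e -> val e = edge_class y.
Proof. by case: e => e /= /imsetP[x _ ->] /edge_class_eq->. Qed.

Lemma card_triangle : #|{: triangle V}| = (#|tet V| + #|tet V|)%N.
Proof.
rewrite card_sig -sum1_card.
rewrite (eq_bigl (fun s : face V => xpredT s.1 && ~~ points_out s.1 s.2)) //.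
rewrite -(pair_big_dep xpredT (fun t i => ~~ points_out t i) (fun _ _ => 1%N)) /=.
rewrite (eq_bigr (fun=> 2)) => [|t _]; last first.
  rewrite sum1_card -(card_top_diagonal t); apply: eq_card => a.
  by rewrite in_top_diagonal.
by rewrite sum_nat_const muln2 addnn.
Qed.

(** Count the diagonals of tetrahedra: two in each tetrahedron, and two around
    each edge by the angle condition. *)
Lemma card_edge : #|{: edge V}| = #|tet V|.
Proof.
pose diag (y : local_edge V) := is_diagonal_of (@points_out V) y.
have diag2 y : diag y -> #|y.2| == 2.
  by case/orP=> /eqP->; apply/eqP; [exact: card_top_diagonal | exact: card_bottom_diagonal].
have e1 : (\sum_(y | diag y) 1 = #|tet V| * 2)%N.
  rewrite (eq_bigl (fun s : local_edge V => xpredT s.1 && diag (s.1, s.2))) => [|[]//].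
  rewrite -(pair_big_dep xpredT (fun t A => diag (t, A)) (fun _ _ => 1%N)) /=.
  rewrite (eq_bigr (fun=> 2)) => [|t _]; first by rewrite sum_nat_const.
  rewrite sum1_card; transitivity #|[set top_diagonal t; bottom_diagonal t]|.
    by apply: eq_card => A; rewrite !inE.
  rewrite cards2; case: eqP => // e.
  have : (0 < #|top_diagonal t|)%N by rewrite card_top_diagonal.
  case/card_gt0P=> a; rewrite {1}e in_bottom_diagonal => h.
  by have := h; rewrite -in_bottom_diagonal -e in_top_diagonal h.
have e2 : (\sum_(y | diag y) 1 = #|edge_classes V| * 2)%N.
  rewrite (partition_big (@edge_class V) (mem (edge_classes V))) /= => [|y dy]; last first.
    by apply/imsetP; exists y; rewrite // inE diag2.
  rewrite -sum_nat_const; apply: eq_bigr => e /imsetP[x]; rewrite inE => /eqP x2 ->.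
  rewrite sum1_card -[RHS](angle_sum x2); apply: eq_card => y.
  rewrite [LHS]inE inE andbC; congr (_ && _).
  by apply/eqP/idP => [<-|/edge_class_eq//]; exact: edge_class_refl.
apply/eqP; rewrite card_sig -(eqn_pmul2r (ltn0Sn 1)) -e1 e2; apply/eqP.
by congr (_ * _)%N; apply: eq_card.
Qed.

End Counting.

Section CellBoundaries.
Variable V : transverse_taut.
Implicit Types x y : flag V.

Lemma chain_orbit x : walk_chain (cell_boundary x) =
  \sum_(z | fconnect (@turn V) x z) step_chain (flag_step z).
Proof.
rewrite /walk_chain /cell_boundary /around big_map -/(fingraph.orbit (@turn V) x).
rewrite big_uniq ?fingraph.orbit_uniq //; apply: eq_bigl => z.
by rewrite -fconnect_orbit.
Qed.

Lemma chain_orbit_eq x y : fconnect (@turn V) x y ->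
  walk_chain (cell_boundary y) = walk_chain (cell_boundary x).
Proof.
move=> c; rewrite !chain_orbit; apply: eq_bigl => z.
by rewrite (same_connect (fconnect_sym (@turn_inj V)) c).
Qed.

Lemma flipK : involutive (@flip V).
Proof.
case=> t p; rewrite /flip /= mulgA; congr pair; rewrite -[RHS]mul1g; congr (_ * _)%g.
by apply: perm4_ext; rewrite permM !half_turnE perm1.
Qed.

Lemma fconnect_flip x y : fconnect (@turn V) (flip x) (flip y) = fconnect (@turn V) x y.
Proof.
suff h a b : fconnect (@turn V) a b -> fconnect (@turn V) (flip a) (flip b).
  by apply/idP/idP => [/h|/h //]; rewrite !flipK.
move/iter_findex <-; elim: (findex _ _ _) => [|n IH]; first exact: connect0.
apply: connect_trans IH _; rewrite (fconnect_sym (@turn_inj V)) iterS.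
by rewrite -[X in fconnect _ _ X]turn_flip_turn fconnect1.
Qed.

Lemma chain_orbit_flip x : walk_chain (cell_boundary (flip x)) = - walk_chain (cell_boundary x).
Proof.
rewrite !chain_orbit (reindex_inj (inv_inj flipK)) (reindex_inj (@turn_inj V)) -sumrN.
apply: eq_big => z; rewrite ?fconnect_flip //.
  by rewrite (same_connect_r (fconnect_sym (@turn_inj V)) (fconnect1 (@turn V) z)).
move=> _; rewrite -step_chain_opposite; congr step_chain.
have -> : opposite (flag_step z) = ((turn z).1, (turn z).2 o3) by rewrite turn_o3.
by rewrite /flip /flag_step /= [in LHS]permM half_turnE.
Qed.

Definition swap x : flag V := (x.1, (tperm o0 o1 * x.2)%g).

Lemma swap2 x : (swap x).2 o2 = x.2 o2. Proof. by rewrite permM tpermD. Qed.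

Lemma turn_swap x : turn (swap x) = swap (turn x).
Proof.
rewrite /turn /flag_step swap2 /swap /=; congr pair.
have t0 : tperm o2 o3 o0 = o0 by rewrite tpermD.
have t1 : tperm o2 o3 o1 = o1 by rewrite tpermD.
have t2 : tperm o0 o1 o2 = o2 by rewrite tpermD.
have t3 : tperm o0 o1 o3 = o3 by rewrite tpermD.
by apply: perm4_ext; rewrite !permM ?(tpermL, tpermR, t0, t1, t2, t3).
Qed.

Lemma chain_orbit_swap x : walk_chain (cell_boundary (swap x)) = walk_chain (cell_boundary x).
Proof.
have swapK : involutive swap.
  by case=> t p; rewrite /swap /= mulgA tperm2 mul1g.
have iter_swap n a : iter n (@turn V) (swap a) = swap (iter n (@turn V) a).
  by elim: n => // n IH; rewrite !iterS IH turn_swap.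
have h a b : fconnect (@turn V) a b -> fconnect (@turn V) (swap a) (swap b).
  by move/iter_findex <-; rewrite -iter_swap fconnect_iter.
rewrite !chain_orbit (reindex_inj (inv_inj swapK)); apply: eq_big => z.
  by apply/idP/idP => [/h|/h //]; rewrite !swapK.
by rewrite /flag_step swap2.
Qed.

Variable x : edge V -> flag V.
Hypothesis xP : forall e, flag_edge (x e) \in val e.

Lemma flag_edge_card y : #|(flag_edge y).2| = 2.
Proof. by rewrite cards2 (inj_eq perm_inj). Qed.

Lemma edge_of_flag y : exists e : edge V, flag_edge y \in val e.
Proof.
have h : edge_class (flag_edge y) \in edge_classes V.
  by apply/imsetP; exists (flag_edge y); rewrite // inE flag_edge_card.
exists (exist (fun e => e \in edge_classes V) _ h); exact: edge_class_refl.
Qed.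

(** The four flags with a given underlying edge have boundary chains that agree
    up to sign, and the orbit of [x e] contains one of them for each edge of
    the class. *)
Lemma cell_boundary_span y : exists e,
  walk_chain (cell_boundary y) = walk_chain (cell_boundary (x e)) \/
  walk_chain (cell_boundary y) = - walk_chain (cell_boundary (x e)).
Proof.
have [e he] := edge_of_flag y; exists e.
have : connect (@glued_edges V) (flag_edge (x e)) (flag_edge y).
  by have := he; rewrite (edge_val_class (xP e)) inE.
case/orbit_edge_surj => y' c ey; rewrite -(chain_orbit_eq c).
have [et e2] : y'.1 = y.1 /\ (flag_edge y').2 = (flag_edge y).2.
  by split; [exact: (congr1 fst ey) | rewrite ey].
have [yy|yy] := eqVneq (odd_perm y.2) (odd_perm y'.2).
  by case: (same_edge_flags (esym et) yy (esym e2)) => ->; [left | right; rewrite chain_orbit_flip].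
rewrite -chain_orbit_swap; have [||->|->] := @same_edge_flags V (swap y) y' (esym et).
- by rewrite odd_permM odd_tperm; case: (odd_perm _) (odd_perm _) yy => [] [].
- by rewrite e2 /= !permM tpermL tpermR setUC.
- by left.
by right; rewrite chain_orbit_flip.
Qed.

End CellBoundaries.

(** * The first homology group *)

Lemma clear_denominators (I : finType) (f : I -> rat) :
  exists N (z : I -> int), (0 < N)%N /\ forall i, f i *+ N = (z i)%:~R.
Proof.
pose d i := `|denq (f i)|%N.
have dE i : (d i)%:R = (denq (f i))%:~R :> rat by rewrite /d -[in RHS](gez0_abs (denq_ge0 _)).
exists (\prod_i d i)%N, (fun i => numq (f i) * (\prod_(j | j != i) d j)%N); split.
  by rewrite prodn_gt0 // => i; rewrite absz_gt0 denq_neq0.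
move=> i; rewrite (bigD1 i) //= mulrnA.
have -> : f i *+ d i = (numq (f i))%:~R.
  by rewrite -mulr_natr dE -[X in X * _](divq_num_den (f i)) divfK // intr_eq0 denq_neq0.
by rewrite -mulr_natr intrM.
Qed.

Section Homology.
Variable V : transverse_taut.
Local Notation m := #|{: triangle V}|.
Local Notation r := #|tet V|.

Definition chain_row (c : chain1 V) : 'rV[rat]_m := \row_j (c (enum_val j))%:~R.

Lemma chain_rowB c d : chain_row (c - d) = chain_row c - chain_row d.
Proof. by apply/rowP => j; rewrite !mxE !ffunE intrB. Qed.
Lemma chain_row0 : chain_row 0 = 0.
Proof. by apply/rowP => j; rewrite !mxE ffunE. Qed.
Lemma chain_rowD c d : chain_row (c + d) = chain_row c + chain_row d.
Proof. by apply/rowP => j; rewrite !mxE !ffunE intrD. Qed.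
Lemma chain_rowMz c z : chain_row (c *~ z) = z%:~R *: chain_row c.
Proof.
by apply/rowP => j; rewrite !mxE ffunMzE mulrzz intrM mulrC.
Qed.

Lemma chain_row_sum (I : Type) (s : seq I) P (F : I -> chain1 V) :
  chain_row (\sum_(i <- s | P i) F i) = \sum_(i <- s | P i) chain_row (F i).
Proof. exact: (big_morph chain_row chain_rowD chain_row0). Qed.

Definition cell_rows : 'M[rat]_(#|{: flag V}|, m) :=
  \matrix_i chain_row (walk_chain (cell_boundary (enum_val i))).

Lemma rational_boundary (c : chain1 V) : (chain_row c <= cell_rows)%MS <->
  exists n (z : {ffun flag V -> int}), (0 < n)%N /\
      c *+ n = \sum_x walk_chain (cell_boundary x) *~ z x.
Proof.
have sumE (u : 'rV_(#|{: flag V}|)) : u *m cell_rows =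
    \sum_x u 0 (enum_rank x) *: chain_row (walk_chain (cell_boundary x)).
  rewrite mulmx_sum_row (reindex_onto (@enum_rank _) (@enum_val _ _))
    => [|i _]; last exact: enum_valK.
  by apply: eq_big => [x|x _]; rewrite ?enum_rankK ?eqxx // rowK enum_rankK.
split=> [/submxP[u e]|[n [z [n0 e]]]].
  have [N [z [N0 hz]]] := clear_denominators (fun x => u 0 (enum_rank x)).
  exists N, [ffun x => z x]; split=> //.
  have inj : injective chain_row.
    move=> a b /rowP h; apply/ffunP => f; have := h (enum_rank f).
    by rewrite !mxE enum_rankK => /intr_inj.
  apply: inj; rewrite chain_row_sum pmulrn chain_rowMz e sumE scaler_sumr.
  apply: eq_bigr => x _; rewrite ffunE chain_rowMz scalerA -hz.
  by rewrite -mulr_natl.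
have : (chain_row (c *+ n) <= cell_rows)%MS.
  rewrite e chain_row_sum; apply: summx_sub => x _; rewrite chain_rowMz scalemx_sub //.
  by apply: (eq_row_sub (enum_rank x)); rewrite rowK enum_rankK.
by rewrite pmulrn chain_rowMz (eqmx_scale _ _) // intr_eq0 -lt0n.
Qed.

Lemma annihilator : exists K : 'I_m -> triangle V -> int,
  forall c : chain1 V, (chain_row c <= cell_rows)%MS <-> forall j, \sum_f c f * K j f = 0.
Proof.
have [N [z [N0 hz]]] := clear_denominators
  (fun ij : 'I_m * 'I_m => cokermx cell_rows ij.1 ij.2).
have {}hz i j : cokermx cell_rows i j *+ N = (z (i, j))%:~R := hz (i, j).
exists (fun j f => z (enum_rank f, j)) => c; rewrite submxE.
have e j : (chain_row c *m cokermx cell_rows) 0 j *+ N =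
    (\sum_f c f * z (enum_rank f, j))%:~R.
  rewrite mxE -sumrMnl raddf_sum /= (reindex_onto (@enum_rank _) (@enum_val _ _))
    => [|i _]; last exact: enum_valK.
  apply: eq_big => [f|f _]; rewrite ?enum_rankK ?eqxx // mxE enum_rankK -mulrnAr hz.
  by rewrite intrM.
split=> [/eqP h j|h].
  by apply/eqP; rewrite -(intr_eq0 rat) -e h mxE mul0rn.
apply/eqP/rowP => j; have /eqP := e j; rewrite h mulrn_eq0 -[N == _]negbK -lt0n N0.
by rewrite /= => /eqP->; rewrite mxE.
Qed.

Lemma HM_eq (c d : Defs.cycle1 V) : (\pi_(HM V) c = \pi_(HM V) d) <-> (c - d \in @rationally_null V).
Proof. by split=> [/eqP|h]; [rewrite -Quotient.idealrBE | apply/eqP; rewrite -Quotient.idealrBE]. Qed.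

(** The cycles with a multiple that is a boundary are cut out by finitely many
    linear equations, which can be taken with integer coefficients. *)
Lemma HM_functionals : exists (I : Type) (lam : I -> HM V -> int),
  (forall i, additive_fun (lam i)) /\ (forall h, (forall i, lam i h = 0) -> h = 0).
Proof.
have [K hK] := annihilator.
have nullP (c : Defs.cycle1 V) : c \in @rationally_null V <-> forall j, \sum_f val c f * K j f = 0.
  rewrite -hK rational_boundary; split=> [|h]; first by rewrite unfold_in => /asboolP.
  by rewrite unfold_in; apply/asboolP.
pose ev j (c : Defs.cycle1 V) := \sum_f val c f * K j f.
have evB j c d : ev j (c - d) = ev j c - ev j d.
  by rewrite -sumrB; apply: eq_bigr => f _; rewrite raddfB /= !ffunE mulrBl.
have ev_pi j c : ev j (repr (\pi_(HM V) c)) = ev j c.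
  have /nullP/(_ j) : repr (\pi_(HM V) c) - c \in @rationally_null V by apply/HM_eq; rewrite reprK.
  by rewrite -/(ev j _) evB => /eqP; rewrite subr_eq0 => /eqP.
exists 'I_m, (fun j h => ev j (repr h)); split=> [j h k|h eh].
  have -> : h + k = \pi_(HM V) (repr h + repr k) by rewrite raddfD /= !reprK.
  by rewrite ev_pi -[repr k in LHS]opprK evB -[- repr k]sub0r evB -{1}(subrr 0) evB subrr sub0r opprK.
rewrite -[h]reprK -[RHS](raddf0 \pi_(HM V)); apply/HM_eq; rewrite subr0.
exact/nullP.
Qed.

End Homology.

Section Betti.
Variable V : transverse_taut.
Local Notation m := #|{: triangle V}|.
Local Notation r := #|tet V|.
Variable x : edge V -> flag V.
Hypothesis xP : forall e, flag_edge (x e) \in val e.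

Lemma chain_rowN (c : chain1 V) : chain_row (- c) = - chain_row c.
Proof. by rewrite -sub0r chain_rowB chain_row0 sub0r. Qed.

Lemma rank_cell_rows : (\rank (cell_rows V) <= r)%N.
Proof.
pose B : 'M[rat]_(#|{: edge V}|, m) :=
  \matrix_i chain_row (walk_chain (cell_boundary (x (enum_val i)))).
rewrite -(card_edge V); apply: leq_trans (rank_leq_row B); apply: mxrankS.
apply/row_subP => i; rewrite rowK.
have [e he] := cell_boundary_span xP (enum_val i).
have h : (chain_row (walk_chain (cell_boundary (x e))) <= B)%MS.
  by apply: (eq_row_sub (enum_rank e)); rewrite rowK enum_rankK.
by case: he => ->; rewrite ?chain_rowN ?eqmx_opp.
Qed.

Definition boundary_matrix : 'M[rat]_(m, r) :=
  \matrix_(i, j) ((above (enum_val i) == enum_val j)%:R - (below (enum_val i) == enum_val j)%:R).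

Lemma chain_row_boundary c : (chain_row c *m boundary_matrix == 0) = is_cycle c.
Proof.
have e t : (chain_row c *m boundary_matrix) 0 (enum_rank t) = (boundary1 c t)%:~R.
  rewrite mxE ffunE raddf_sum (reindex_onto (@enum_rank _) (@enum_val _ _))
    => [|i _]; last exact: enum_valK.
  apply: eq_big => [f|f _]; rewrite ?enum_rankK ?eqxx // !mxE !enum_rankK.
  by rewrite [RHS]intrM intrB !mulrz_nat.
apply/eqP/eqP => [/rowP h|h].
  apply/ffunP => t; have /eqP := h (enum_rank t).
  by rewrite e mxE intr_eq0 => /eqP->; rewrite ffunE.
by apply/rowP => j; rewrite -(enum_valK j) e h !mxE ffunE.
Qed.

(** With [n] tetrahedra there are [2 n] triangles, the boundary map to the
    tetrahedra has rank less than [n], and the boundaries of the [n] dual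
    2-cells span at most [n] dimensions, so some cycle is not a rational
    boundary. *)
Lemma betti_pos (t0 : tet V) : exists h : HM V, h <> 0.
Proof.
apply: contrapT => hn.
have all0 (c : Defs.cycle1 V) : c \in @rationally_null V.
  rewrite -[c]subr0; apply/HM_eq; rewrite raddf0.
  by apply: contrapT => h; apply: hn; exists (\pi_(HM V) c).
have sub : (kermx boundary_matrix <= cell_rows V)%MS.
  apply/row_subP => i; set v := row i _.
  have v0 : v *m boundary_matrix = 0 by apply/sub_kermxP/row_sub.
  have [N [z [N0 hz]]] := clear_denominators (fun j => v 0 j).
  pose c : chain1 V := [ffun f => z (enum_rank f)].
  have ec : chain_row c = N%:R *: v.
    by apply/rowP => j; rewrite [LHS]mxE ffunE enum_valK -hz [RHS]mxE mulr_natl.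
  have hc : is_cycle c by rewrite -chain_row_boundary ec -scalemxAl v0 scaler0.
  have := all0 (Cycle1 hc); rewrite unfold_in => /asboolP/rational_boundary.
  by rewrite ec (eqmx_scale _ _) // pnatr_eq0 -lt0n.
have := leq_trans (mxrankS sub) rank_cell_rows; rewrite mxrank_ker leq_subLR.
rewrite [X in (X <= _)%N]card_triangle leq_add2r => h.
have /row_fullP[B hB] : row_full boundary_matrix by rewrite /row_full eqn_leq rank_leq_col h.
have e1 : boundary_matrix *m const_mx 1 = 0 :> 'cV_m.
  apply/colP => i; rewrite !mxE; under eq_bigr => j _ do rewrite !mxE mulr1.
  have s1 t : \sum_(j < r) (t == enum_val j)%:R = 1 :> rat.
    rewrite (bigD1 (enum_rank t)) //= enum_rankK eqxx big1 ?addr0 // => j hj.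
    by case: eqP => // e; case/eqP: hj; rewrite e enum_valK.
  by rewrite sumrB !s1 subrr.
have := congr1 (mulmx B) e1; rewrite mulmxA hB mul1mx mulmx0 => /colP/(_ (enum_rank t0)).
by rewrite !mxE => /eqP; rewrite oner_eq0.
Qed.

End Betti.

(** * The twisting character *)

Section Hurewicz.
Variables (V : transverse_taut) (t0 : tet V) (p : tet_lifts t0).

Lemma walk_chain_rev (w : seq (face V)) : walk_chain (rev_walk w) = - walk_chain w.
Proof.
rewrite /walk_chain /rev_walk big_rev big_map -sumrN /=.
by apply: eq_bigr => s _; rewrite step_chain_opposite.
Qed.

Lemma hurewicz1 : hurewicz (1%g : pi1 t0) = 0.
Proof. by apply: (@addrI (HM V) (hurewicz (1%g : pi1 t0))); rewrite -hurewicz_mul mulg1 addr0. Qed.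

Lemma hurewiczV (g : pi1 t0) : hurewicz g^-1%g = - hurewicz g.
Proof. by apply: (@addrI (HM V) (hurewicz g)); rewrite -hurewicz_mul mulgV hurewicz1 subrr. Qed.

Lemma hurewiczXz (g : pi1 t0) (z : int) : exists k : pi1 t0, hurewicz k = hurewicz g *~ z.
Proof.
have nat_case n : exists k : pi1 t0, hurewicz k = hurewicz g *+ n.
  elim: n => [|n [k hk]]; first by exists 1%g; rewrite hurewicz1.
  by exists (g * k)%g; rewrite hurewicz_mul hk mulrS.
case: z => n; first exact: nat_case.
by have [k hk] := nat_case n.+1; exists k^-1%g; rewrite hurewiczV hk.
Qed.

(** Closing up each 1-cell with the chosen paths from the base point turns a
    cycle into a combination of loops: the added paths cancel because the
    boundary of the cycle vanishes. *)
Lemma hurewicz_onto (h : HM V) : exists g : pi1 t0, hurewicz g = h.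
Proof.
have closed (I : Type) (s : seq I) (F : I -> HM V) :
   (forall i, exists g : pi1 t0, hurewicz g = F i) ->
   exists g : pi1 t0, hurewicz g = \sum_(i <- s) F i.
  move=> hF; elim: s => [|i s [g hg]]; first by exists 1%g; rewrite big_nil hurewicz1.
  by have [k hk] := hF i; exists (k * g)%g; rewrite big_cons hurewicz_mul hk hg.
set c := repr h.
pose loop f := path_cat (path_cat (p (val f).1) (path_step (val f))) (path_rev (p (opposite (val f)).1)).
have [g hg] : exists g : pi1 t0, hurewicz g =
    \sum_(f : triangle V) hurewicz (lift_monodromy p (val f)) *~ (- val c f).
  by apply: closed => f; apply: hurewiczXz.
exists g; rewrite hg -[h]reprK -/c.
under eq_bigr => f _ do rewrite hurewicz_loop /loop_homology -raddfMz.
rewrite -raddf_sum; congr (\pi _); apply: val_inj.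
pose P t : chain1 V := walk_chain (val (p t)).
have e1 : val c = - \sum_f step_chain (val f) *~ val c f.
  apply/ffunP => f; rewrite ffunE sum_ffunE (bigD1 f) //= big1 => [|f' hf].
    by rewrite addr0 ffunMzE ffunE (negPf (valP f)) eqxx mulNrz opprK mulrzz mul1r.
  by rewrite ffunMzE ffunE (negPf (valP f')) val_eqE eq_sym (negPf hf) oppr0 mul0rz.
have e2 : \sum_f (P (above f) - P (below f)) *~ val c f = 0.
  transitivity (\sum_t P t *~ boundary1 (val c) t); last first.
    rewrite big1 // => t _; have /eqP -> : is_cycle (val c) by case: (c).
    by rewrite ffunE mulr0z.
  under [RHS]eq_bigr => t _ do rewrite ffunE mulrz_sumr.
  rewrite exchange_big; apply: eq_bigr => f _ /=.
  under eq_bigr => t _ do rewrite mulrC mulrzA.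
  rewrite -mulrz_suml; congr (_ *~ _).
  under eq_bigr => t _ do rewrite mulrzBr.
  rewrite sumrB; congr (_ - _).
    by rewrite (bigD1 (above f)) //= eqxx big1 ?addr0 // => t ht; rewrite eq_sym (negPf ht).
  by rewrite (bigD1 (below f)) //= eqxx big1 ?addr0 // => t ht; rewrite eq_sym (negPf ht).
have e3 : val c = - \sum_f (step_chain (val f) + (P (above f) - P (below f))) *~ val c f.
  under eq_bigr => f _ do rewrite mulrzDl.
  by rewrite big_split /= e2 addr0.
rewrite [RHS]e3 raddf_sum -sumrN; apply: eq_bigr => f _.
rewrite [LHS]raddfMz /= mulrNz; congr (- (_ *~ _)).
rewrite !walk_chain_cat walk_chain_rev [walk_chain [:: _]]big_seq1.
by rewrite addrAC addrC addrA.
Qed.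
End Hurewicz.

Section Twist.
Variables (V : transverse_taut) (t0 : tet V).
Variable ort : tet V -> tet_orientation.
Hypothesis ortP : forall t, transverse_orientation t (ort t).
Local Notation R := (group_ring (HM V)).

Definition twisting (g : pi1 t0) : R := gr_elt (hurewicz g) * (edge_orientation g)%:~R.

Lemma edge_orientation_pm (g : pi1 t0) : edge_orientation g = 1 \/ edge_orientation g = -1.
Proof. by rewrite /edge_orientation; case: asboolP; [left|right]. Qed.

Lemma twistingM g k : twisting (g * k)%g = twisting g * twisting k.
Proof.
by rewrite /twisting hurewicz_mul gr_eltD (edge_orientationM ortP) intrM; exact: mulrACA.
Qed.

Lemma edge_orientation1 : edge_orientation (1%g : pi1 t0) = 1.
Proof. by have := edge_orientation_loop ortP (path_refl t0). Qed.

Lemma twisting1 : twisting 1%g = 1.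
Proof. by rewrite /twisting hurewicz1 edge_orientation1 mulr1 gr_elt0. Qed.

Lemma twistingV g : twisting g * twisting g^-1%g = 1.
Proof. by rewrite -twistingM mulgV twisting1. Qed.

Lemma twisting_sign g : twisting g = gr_elt (hurewicz g) \/ twisting g = - gr_elt (hurewicz g).
Proof.
rewrite /twisting; case: (edge_orientation_pm g) => ->; [left|right]; rewrite ?mulr1 //.
by rewrite mulrN1.
Qed.

Lemma coef_twisting g k : coef k (twisting g - 1) <> 0 -> k = hurewicz g \/ k = 0.
Proof.
have [->|kg] := eqVneq k (hurewicz g); first by left.
have [->|k0] := eqVneq k 0; first by right.
case; rewrite coef_add coef_opp coef_one; case: (twisting_sign g) => ->; rewrite ?coef_opp !coef_elt.
  by rewrite ![_ == k]eq_sym (negPf kg) (negPf k0).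
by rewrite ![_ == k]eq_sym (negPf kg) (negPf k0).
Qed.

Lemma twisting_neq1 g : twisting g - 1 = 0 -> hurewicz g = 0 /\ edge_orientation g = 1.
Proof.
move=> e; have h0 : hurewicz g = 0.
  have /eqP := congr1 (coef 0) e; rewrite coef_add coef_opp coef_one coef_zero.
  case: (twisting_sign g) => ->; rewrite ?coef_opp !coef_elt eqxx;
  by case: (hurewicz g =P 0).
split=> //; move: e; rewrite /twisting h0 gr_elt0 mul1r.
case: (edge_orientation_pm g) => // -> /(congr1 (coef 0)).
by rewrite coef_add coef_zero !coef_opp coef_one eqxx.
Qed.

(** A loop of trivial class and sign [-1] gives [y1 = -2], which forms a
    regular sequence with any [y2] coming from a nonzero class; two independent
    classes give a regular sequence as well.  Otherwise [HM] is infinite cyclic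
    and the sign factors through it, so the ideal is generated by the element
    of a generator. *)
Lemma twisted_augmentation_ideal (p : tet_lifts t0) (x : edge V -> flag V) :
  (forall e, flag_edge (x e) \in val e) ->
  (exists g1 g2, twisting g1 - 1 <> 0 /\
     forall a, divides (twisting g1 - 1) ((twisting g2 - 1) * a) -> divides (twisting g1 - 1) a) \/
  (exists g, twisting g - 1 <> 0 /\ forall k, divides (twisting g - 1) (twisting k - 1)).
Proof.
move=> xP; have [I [lam [lamD sep]]] := HM_functionals V.
have [h1 h10] := betti_pos xP t0.
have [i hi] : exists i, lam i h1 <> 0.
  by apply: contrapT => hn; apply/h10/sep => i; apply: contrapT => ?; apply: hn; exists i.
have [g1 e1] := hurewicz_onto p h1.
have g10 : twisting g1 - 1 <> 0 by move/twisting_neq1; rewrite e1 => -[].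
have kerP lm g : additive_fun lm -> lm (hurewicz g) = 0 ->
    forall k, coef k (twisting g - 1) <> 0 -> lm k = 0.
  by move=> lmD h k /coef_twisting[]->//; rewrite lam0.
(* The sign of a loop of trivial class: here [twisting g0 - 1] is [-2]. *)
have [[g0 [h0 o0]]|trivial] := pselect (exists g : pi1 t0, hurewicz g = 0 /\ edge_orientation g = -1).
  left; exists g0, g1; split; first by move/twisting_neq1 => -[_]; rewrite o0.
  move=> a; apply: (@regular_pair _ (lam i) _ _ h1) => //.
    by apply: kerP => //; rewrite h0 lam0.
  by rewrite -e1; exact: twisting_sign.
(* The functional [lm] below vanishes at [h1] and not at [h2]. *)
have [[j [h2 hj]]|rank1] := pselect (exists j h2, lam j h2 * lam i h1 - lam i h2 * lam j h1 <> 0).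
  left; have [g2 e2] := hurewicz_onto p h2; exists g1, g2; split=> // a.
  pose lm h := lam j h * lam i h1 - lam i h * lam j h1.
  have lmD : additive_fun lm.
    by move=> a' b; rewrite /lm !lamD !mulrDl opprD addrACA.
  apply: (@regular_pair _ lm _ _ h2) => //.
    by apply: kerP => //; rewrite e1 /lm mulrC subrr.
  by rewrite -e2; exact: twisting_sign.
right; have inj h : lam i h = 0 -> h = 0.
  move=> h0; apply: sep => j; apply: contrapT => hj; apply: rank1; exists j, h.
  by rewrite h0 mul0r subr0 => /eqP; rewrite mulf_eq0 => /orP[] /eqP.
(* [lam i] embeds [HM] in the integers, and [t] will generate [HM]. *)
have [n [t [lt tmin]]] : exists n t, `|lam i t|%N = n.+1 /\
    forall h, (0 < `|lam i h|)%N -> (n < `|lam i h|)%N.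
  pose P n := `[< exists t, `|lam i t|%N = n.+1 >].
  have exP : exists n, P n.
    exists `|lam i h1|.-1; apply/asboolP; exists h1; rewrite prednK // absz_gt0.
    exact/eqP.
  case: (ex_minnP exP) => n /asboolP[t et] hmin; exists n, t; split=> // h hpos.
  by rewrite -(prednK hpos) ltnS; apply: hmin; apply/asboolP; exists h; rewrite prednK.
have [g eg] := hurewicz_onto p t; exists g; split.
  move/twisting_neq1 => -[]; rewrite eg => e; move: lt; rewrite e.
  by rewrite lam0.
have gen h : exists z : int, h = t *~ z.
  have lamMz (z : int) : lam i (t *~ z) = lam i t * z.
    have h3 k : lam i (t *+ k) = lam i t *+ k.
      by elim: k => [|k IH]; rewrite ?mulr0n ?lam0 // !mulrS lamD IH.
    case: z => k; first by rewrite -pmulrn h3 -mulr_natr natz.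
    by rewrite NegzE mulrNz lamN // -pmulrn h3 -mulr_natr natz mulrN.
  exists (lam i h %/ lam i t)%Z; apply/eqP; rewrite -subr_eq0; apply/eqP/inj.
  rewrite lamB // lamMz mulrC; apply/eqP/negbNE/negP => ne.
  have em : lam i h - (lam i h %/ lam i t)%Z * lam i t = (lam i h %% lam i t)%Z by [].
  have tn0 : lam i t != 0 by rewrite -absz_gt0 lt.
  have := tmin (h - t *~ (lam i h %/ lam i t)%Z).
  rewrite lamB // lamMz [lam i t * _]mulrC em absz_gt0 -em ne em => /(_ isT).
  have := ltz_mod (lam i h) tn0; have := modz_ge0 (lam i h) tn0.
  case: (_ %% _)%Z => // q _; rewrite -abszE lt ltz_nat ltnS => le.
  by rewrite ltnNge le.
pose Q k := divides (twisting g - 1) (twisting k - 1).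
have QM a b : Q a -> Q b -> Q (a * b)%g.
  by rewrite /Q twistingM; exact: divides_sub1_mul.
have QV a : Q a -> Q a^-1%g by apply: divides_sub1_inv; exact: twistingV.
have Q1 : Q 1%g by exists 0; rewrite twisting1 subrr mul0r.
have Qpow (z : int) : exists k, Q k /\ hurewicz k = t *~ z.
  have nat_case n' : exists k, Q k /\ hurewicz k = t *+ n'.
    elim: n' => [|n' [k [hk ek]]].
      by exists 1%g; split; [exact: Q1 | rewrite hurewicz1].
    exists (g * k)%g; split; last by rewrite hurewicz_mul eg ek mulrS.
    by apply: QM hk; exists 1; rewrite mul1r.
  case: z => n'; first exact: nat_case.
  by have [k [hk ek]] := nat_case n'.+1; exists k^-1%g; split; [exact: QV | rewrite hurewiczV ek].
move=> k; have [z ez] := gen (hurewicz k); have [q [hq eq]] := Qpow z.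
have -> : k = (q * (q^-1 * k))%g by rewrite mulKVg.
apply: QM hq _.
have kz : hurewicz (q^-1 * k)%g = 0 by rewrite hurewicz_mul hurewiczV eq -ez addNr.
exists 0; rewrite mul0r /twisting kz gr_elt0 mul1r.
case: (edge_orientation_pm (q^-1 * k)%g) => e; first by rewrite e subrr.
by case: trivial; exists (q^-1 * k)%g.
Qed.

End Twist.

(** * The twisted chain complex *)

Lemma lift_monodromy_opposite (V : transverse_taut) (t0 : tet V) (p : tet_lifts t0) s :
  lift_monodromy p (opposite s) = (lift_monodromy p s)^-1%g.
Proof.
rewrite [RHS]pi1_invE; apply/loop_classE.
have -> : val (path_cat (path_cat (p (opposite s).1) (path_step (opposite s)))
    (path_rev (p (opposite (opposite s)).1))) =
  (val (p (opposite s).1) ++ [:: opposite s]) ++ rev_walk (val (p (opposite (opposite s)).1)).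
  by [].
by rewrite oppositeK /= !rev_walk_cat rev_walkK catA; exact: rst_refl.
Qed.

Lemma sum_traject (T : finType) (f : T -> T) (M : zmodType) (F : T -> M) (x : T) :
  \sum_(n < fingraph.order f x) F (iter n f x) = \sum_(y | fconnect f x y) F y.
Proof.
transitivity (\sum_(y <- fingraph.orbit f x) F y).
  rewrite (big_nth x) big_mkord size_orbit; apply: eq_bigr => n _.
  by rewrite nth_traject.
rewrite big_uniq ?fingraph.orbit_uniq //; apply: eq_bigl => y.
by rewrite -fconnect_orbit.
Qed.

Section RankOne.
Variables (V : transverse_taut) (t0 : tet V) (p : tet_lifts t0).
Variables (R : comNzRingType) (chi : pi1 t0 -> R).
Hypothesis chiM : forall g h, chi (g * h)%g = chi g * chi h.
Hypothesis chi1 : chi 1%g = 1.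
Local Notation turn := (@turn V).

Definition monodromy (s : face V) : R := chi (lift_monodromy p s).

Lemma monodromy_opposite s : monodromy s * monodromy (opposite s) = 1.
Proof. by rewrite /monodromy lift_monodromy_opposite -chiM mulgV. Qed.

Lemma monodromy_cancel s u v : monodromy s * u = v -> monodromy (opposite s) * v = u.
Proof. by move<-; rewrite mulrA [_ * monodromy s]mulrC monodromy_opposite mul1r. Qed.

(** A weight trivializes, around each edge, the local system defined by [chi];
    multiplying by it makes the coefficients of a boundary depend on the flag
    alone, and not on the number of steps of the walk that leads to it. *)
Variable weight : flag V -> R.
Hypothesis weight_turn : forall y, monodromy (flag_step y) * weight (turn y) = weight y.

Lemma chi_around y n : chi (around_monodromy p y n) * weight y = weight (iter n turn y).
Proof.
elim: n => [|n IH]; first by rewrite chi1 mul1r.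
rewrite [around_monodromy _ _ _]/= chiM -mulrA IH -lift_monodromy_opposite.
exact: monodromy_cancel.
Qed.

Definition cell_coef (x : flag V) (f : triangle V) : R :=
  \sum_(n < fingraph.order turn x)
     let s := flag_step (iter n turn x) in
     if points_out s.1 s.2
     then (if val f == opposite s then chi (around_monodromy p x n) else 0)
     else (if val f == s then - chi (around_monodromy p x n.+1) else 0).

Definition flag_coef (f : triangle V) (y : flag V) : R :=
  let s := flag_step y in
  if points_out s.1 s.2
  then (if val f == opposite s then weight y else 0)
  else (if val f == s then - weight (turn y) else 0).

Lemma cell_coef_weight x f :
  cell_coef x f * weight x = \sum_(y | fconnect turn x y) flag_coef f y.
Proof.
rewrite -sum_traject mulr_suml; apply: eq_bigr => n _; rewrite /flag_coef /=.
case: ifP => _; case: ifP => _; rewrite ?mul0r ?mulNr ?chi_around //.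
by rewrite -[X in chi X]/(around_monodromy p x n.+1) chi_around.
Qed.

(** The contribution of a flag to the boundary of the dual 2-cell, at a 1-cell
    and seen from the tetrahedron above the triangle: the walk around the edge
    arrives in it through the triangle or leaves it through the triangle. *)
Definition face_coef (f : triangle V) (y : flag V) : R :=
  (if val f == (y.1, y.2 o3) then weight y else 0) - (if val f == (y.1, y.2 o2) then weight y else 0).

Lemma flag_coef_monodromy f y : monodromy (val f) * flag_coef f y =
  (if val f == ((turn y).1, (turn y).2 o3) then weight (turn y) else 0) -
  (if val f == (y.1, y.2 o2) then weight y else 0).
Proof.
rewrite turn_o3 -[(_, gluing _ _ _)]/(opposite (flag_step y)) -[(y.1, y.2 o2)]/(flag_step y).
rewrite /flag_coef; have hf := valP f; case: ifP => out.
  have -> : (val f == flag_step y) = false by apply/eqP => e; rewrite e out in hf.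
  rewrite subr0; case: eqP => [->|_]; last by rewrite mulr0.
  exact: monodromy_cancel.
have -> : (val f == opposite (flag_step y)) = false.
  by apply/eqP => e; rewrite e points_out_glued out in hf.
rewrite sub0r; case: eqP => [->|_]; last by rewrite mulr0 oppr0.
by rewrite mulrN weight_turn.
Qed.

(** Multiplied by the monodromy, a step downwards across the triangle counts at
    the tetrahedron that it leaves and a step upwards at the one that it
    reaches; both are the tetrahedron above. *)
Lemma cell_coef_face x f :
  monodromy (val f) * (cell_coef x f * weight x) = \sum_(y | fconnect turn x y) face_coef f y.
Proof.
rewrite cell_coef_weight mulr_sumr (eq_bigr _ (fun y _ => flag_coef_monodromy f y)).
rewrite !sumrB; congr (_ - _).
rewrite [RHS](reindex_inj (@turn_inj V)); apply: eq_bigl => y.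
by rewrite (same_connect_r (fconnect_sym (@turn_inj V)) (fconnect1 turn y)).
Qed.

Definition step_coef (t : tet V) (f : triangle V) : R :=
  (if above f == t then monodromy (val f) else 0) - (if below f == t then 1 else 0).

Lemma sum_step_flag_coef t y : \sum_f step_coef t f * flag_coef f y =
  (if (turn y).1 == t then weight (turn y) else 0) - (if y.1 == t then weight y else 0).
Proof.
pose s := flag_step y; have [out|out] := boolP (points_out s.1 s.2).
  rewrite (bigD1 (exist _ (opposite s) (opposite_bottom out) : triangle V)) //= big1 => [|f hf].
    rewrite addr0 /step_coef /flag_coef -/s out eqxx /above /below -[val _]/(opposite s) oppositeK.
    rewrite -[s.1]/(y.1) -[(opposite s).1]/((turn y).1) mulrBl.
    case: eqP => _; case: eqP => _; rewrite ?mul0r ?mul1r // (monodromy_cancel (weight_turn y)) //.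
  rewrite /flag_coef -/s out; case: eqP => [e|]; last by rewrite mulr0.
  by case/eqP: hf; apply: val_inj; rewrite e.
rewrite (bigD1 (exist _ s out : triangle V)) //= big1 => [|f hf].
  rewrite addr0 /step_coef /flag_coef -/s (negPf out) eqxx /above /below -[val _]/s.
  rewrite -[s.1]/(y.1) -[(opposite s).1]/((turn y).1) mulrBl.
  case: eqP => _; case: eqP => _;
    by rewrite ?mul0r ?mul1r ?mulrN ?weight_turn ?subr0 ?sub0r ?opprK // addrC.
rewrite /flag_coef -/s (negPf out); case: eqP => [e|]; last by rewrite mulr0.
by case/eqP: hf; apply: val_inj; rewrite e.
Qed.

Hypothesis weight_unit : forall y, exists w, weight y * w = 1.

(** The boundary of a step is the difference of the weights at its ends, and
    these differences telescope around the cycle. *)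
Lemma sum_step_cell_coef t x : \sum_f step_coef t f * cell_coef x f = 0.
Proof.
have [w hw] := weight_unit x.
suff e : (\sum_f step_coef t f * cell_coef x f) * weight x = 0.
  by rewrite -[LHS]mulr1 -hw mulrA e mul0r.
rewrite mulr_suml; under eq_bigr => f _ do rewrite -mulrA cell_coef_weight mulr_sumr.
rewrite exchange_big /= (eq_bigr _ (fun y _ => sum_step_flag_coef t y)) sumrB.
apply/eqP; rewrite subr_eq0; apply/eqP; rewrite [RHS](reindex_inj (@turn_inj V)).
by apply: eq_bigl => y; rewrite (same_connect_r (fconnect_sym (@turn_inj V)) (fconnect1 turn y)).
Qed.

Definition step_matrix : 'M[R]_(#|tet V|, #|{: triangle V}|) :=
  \matrix_(i, j) step_coef (enum_val i) (enum_val j).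

Definition cell_matrix (x : edge V -> flag V) : 'M[R]_(#|{: triangle V}|, #|{: edge V}|) :=
  \matrix_(i, j) cell_coef (x (enum_val j)) (enum_val i).

Lemma step_cell_matrix x : step_matrix *m cell_matrix x = 0.
Proof.
apply/matrixP => i j; rewrite !mxE -[RHS](sum_step_cell_coef (enum_val i) (x (enum_val j))).
rewrite (reindex_onto (@enum_rank _) (@enum_val _ _))
    => [|k _]; last exact: enum_valK.
by apply: eq_big => [f|f _]; rewrite ?enum_rankK ?eqxx // !mxE enum_rankK.
Qed.

Definition vertex (t : tet V) : 'cV[R]_#|tet V| := \col_i (enum_val i == t)%:R.

Lemma step_boundary s : exists c : 'cV_#|{: triangle V}|,
  step_matrix *m c = monodromy (opposite s) *: vertex (opposite s).1 - vertex s.1.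
Proof.
have basic (f : triangle V) : step_matrix *m (delta_mx (enum_rank f) 0 : 'cV_#|{: triangle V}|) =
    monodromy (val f) *: vertex (above f) - vertex (below f).
  rewrite -colE; apply/colP => i; rewrite !mxE enum_rankK /step_coef ![_ == enum_val i]eq_sym.
  by case: eqP => _; case: eqP => _; rewrite ?mulr1 ?mulr0.
have [out|out] := boolP (points_out s.1 s.2).
  exists (delta_mx (enum_rank (exist _ (opposite s) (opposite_bottom out) : triangle V)) 0).
  by rewrite basic /above /below /= neighbourK.
exists (- monodromy (opposite s) *: delta_mx (enum_rank (exist _ s out : triangle V)) 0).
rewrite -scalemxAr basic /above /below -[val _]/s scalerBr scaleNr scalerA scaleNr opprK.
by rewrite mulrC monodromy_opposite scale1r addrC.
Qed.

Lemma walk_boundary a w b : walk a w b -> exists c : 'cV_#|{: triangle V}|,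
  step_matrix *m c = (\prod_(s <- w) monodromy (opposite s)) *: vertex b - vertex a.
Proof.
elim: w a => [|s w IH] a /=.
  by move/eqP->; exists 0; rewrite mulmx0 big_nil scale1r subrr.
case/andP=> /eqP<- /IH[c hc]; have [d hd] := step_boundary s.
exists (d + monodromy (opposite s) *: c).
rewrite mulmxDr -scalemxAr hc hd big_cons scalerBr scalerA.
by rewrite addrC addrA subrK.
Qed.

Definition closed_up a w b (h : walk a w b) : pi1 t0 :=
  loop_class (path_cat (path_cat (p a) (exist _ w h)) (path_rev (p b))).

Lemma chi_closed_up a w b (h : walk a w b) :
  chi (closed_up h) * \prod_(s <- w) monodromy (opposite s) = 1.
Proof.
elim: w a h => [|s w IH] a h.
  rewrite big_nil mulr1 -chi1; congr chi; apply/loop_classE => /=.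
  move: h; rewrite cats0 => /eqP ab; subst b.
  exact: homotopic_cancel (valP (p a)).
have /andP[/eqP sa hw] : walk a (s :: w) b by [].
subst a; rewrite big_cons.
have -> : closed_up h = (lift_monodromy p s * closed_up hw)%g.
  rewrite [RHS]pi1_mulE; apply/loop_classE => /=.
  set s' := opposite s.
  have hu : walk t0 (val (p s.1) ++ [:: s]) s'.1.
    by apply: cat_walk (valP (p s.1)) _; exact: walk_step.
  have hv : walk s'.1 (w ++ rev_walk (val (p b))) t0.
    exact: cat_walk hw (walk_rev (valP (p b))).
  have := homotopic_cat hu hv (homotopic_cancel_rev (valP (p s'.1))).
  by rewrite cat0s -!catA /= => hh; exact: rst_sym hh.
by rewrite chiM -/(monodromy s) mulrACA monodromy_opposite mul1r IH.
Qed.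

(** A loop at the base point, moved to [t] along the chosen path, lifts to a
    path whose ends differ by [g]. *)
Lemma loop_boundary g t : exists c : 'cV_#|{: triangle V}|,
  step_matrix *m c = (chi g - 1) *: vertex t.
Proof.
have [w <-] : exists w, loop_class w = g by exists (repr g); exact: loop_class_repr.
have h : walk t (rev_walk (val (p t)) ++ val w ++ val (p t)) t.
  by apply: cat_walk (walk_rev (valP (p t))) (cat_walk (valP w) (valP (p t))).
have [c hc] := walk_boundary h; have e := chi_closed_up h.
have eg : closed_up h = loop_class w.
  apply/loop_classE => /=.
  have h0 : walk t0 [::] t0 by exact: eqxx.
  have c1 := homotopic_cancel (valP (p t)).
  have hv := cat_walk (valP w) (cat_walk (valP (p t)) (walk_rev (valP (p t)))).
  have := homotopic_cat h0 hv c1; rewrite !cat0s -!catA => e1.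
  have := homotopic_cat (valP w) h0 c1; rewrite !cats0 => e2.
  exact: rst_trans e1 e2.
exists (- chi (loop_class w) *: c).
rewrite -scalemxAr hc scalerBr scalerA mulNr -eg e scaleN1r scaleNr opprK addrC.
by rewrite scalerBl scale1r.
Qed.

Lemma path_boundary t t' : exists c : 'cV_#|{: triangle V}|,
  step_matrix *m c = vertex t' - vertex t.
Proof.
have h : walk t (rev_walk (val (p t)) ++ val (p t')) t'.
  by apply: cat_walk (walk_rev (valP (p t))) (valP (p t')).
have [c hc] := walk_boundary h; exists c; rewrite hc.
have := chi_closed_up h; have -> : closed_up h = 1%g.
  apply/loop_classE => /=.
  have h0 : walk t0 [::] t0 by exact: eqxx.
  have hv := cat_walk (valP (p t')) (walk_rev (valP (p t'))).
  have := homotopic_cat h0 hv (homotopic_cancel (valP (p t))); rewrite !cat0s -!catA => e1.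
  exact: rst_trans e1 (homotopic_cancel (valP (p t'))).
by rewrite chi1 mul1r => ->; rewrite scale1r.
Qed.

End RankOne.

(** * Minors of the twisted boundary *)

Section Order.
Variables (V : transverse_taut) (t0 : tet V) (p : tet_lifts t0).
Variables (R : comNzRingType) (dom : integral R) (chi : pi1 t0 -> R).
Hypothesis chiM : forall g h, chi (g * h)%g = chi g * chi h.
Hypothesis chi1 : chi 1%g = 1.
Variable weight : flag V -> R.
Hypothesis weight_turn : forall y, monodromy p chi (flag_step y) * weight (turn y) = weight y.
Hypothesis weight_unit : forall y, exists w, weight y * w = 1.
Variable x : edge V -> flag V.

Local Notation m := #|{: triangle V}|.
Local Notation D := (step_matrix p chi).
Local Notation B := (cell_matrix p chi x).
Local Notation rho := (fun g => (chi g)%:M : 'M[R]_1).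

Definition vec (I : finType) (c : chains R 1 I) : 'cV[R]_#|I| := \col_i c (enum_val i) 0 0.

Lemma vec_inj (I : finType) : injective (@vec I).
Proof.
move=> c d /colP e; apply/ffunP => i; apply/colP => j; rewrite (ord1 j).
by have := e (enum_rank i); rewrite !mxE enum_rankK.
Qed.

Definition unvec (I : finType) (c : 'cV[R]_#|I|) : chains R 1 I := [ffun i => (c (enum_rank i) 0)%:M].

Lemma unvecK (I : finType) : cancel (@unvec I) (@vec I).
Proof. by move=> c; apply/colP => i; rewrite mxE ffunE mxE enum_valK. Qed.

Lemma vecB (I : finType) (c d : chains R 1 I) : vec (c - d) = vec c - vec d.
Proof. by apply/colP => i; rewrite !mxE !ffunE !mxE. Qed.

Lemma vec_comb (I : finType) l (z : 'I_l -> chains R 1 I) (u : 'cV_l) :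
  vec (\sum_i u i 0 *: z i) = (\matrix_(j, i) vec (z i) j 0) *m u.
Proof.
apply/colP => j; rewrite !mxE sum_ffunE summxE; apply: eq_bigr => i _.
by rewrite ffunE !mxE mulrC.
Qed.

Lemma vec_boundary1 c : vec (twisted_boundary1 rho p c) = D *m vec c.
Proof.
apply/colP => i; rewrite !mxE ffunE summxE (reindex_onto (@enum_rank _) (@enum_val _ _))
    => [|k _]; last exact: enum_valK.
apply: eq_big => [f|f _]; rewrite ?enum_rankK ?eqxx // !mxE enum_rankK mulrBl.
by congr (_ - _); case: ifP => _; rewrite ?mul_scalar_mx ?mxE ?mul0r ?mul1r.
Qed.

Lemma vec_boundary2 d : vec (twisted_boundary2 rho p x d) = B *m vec d.
Proof.
apply/colP => i; rewrite !mxE ffunE summxE (reindex_onto (@enum_rank _) (@enum_val _ _))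
    => [|k _]; last exact: enum_valK.
apply: eq_big => [e|e _]; rewrite ?enum_rankK ?eqxx // summxE !mxE enum_rankK mulr_suml.
apply: eq_bigr => n _ /=.
by case: ifP => _; case: ifP => _; rewrite ?mul_scalar_mx ?mxE ?mul0r ?mulNr.
Qed.

Lemma presents_twisted_homology l k (A : 'M[R]_(l, k)) :
  presents (fun c : chains R 1 (triangle V) => twisted_boundary1 rho p c = 0)
    (fun c => exists d, c = twisted_boundary2 rho p x d) A ->
  exists Z : 'M[R]_(m, l), presents_homology D B Z A.
Proof.
case=> z [zZ gen rel]; exists (\matrix_(j, i) vec (z i) j 0); split=> [|c hc|u].
- apply/matrixP => a i; transitivity ((D *m vec (z i)) a 0).
    by rewrite [LHS]mxE [RHS]mxE; apply: eq_bigr => j _; rewrite [X in _ * X = _]mxE.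
  by rewrite -vec_boundary1 zZ !mxE ffunE mxE.
- have [|u [d e]] := gen (unvec c).
    by apply: vec_inj; rewrite vec_boundary1 unvecK hc; apply/colP => i; rewrite !mxE ffunE mxE.
  exists u, (vec d); rewrite -vec_comb -vec_boundary2 -e vecB unvecK addrC subrK //.
rewrite -rel -vec_comb; split=> [[w e]|[d e]].
  by exists (unvec w); apply: vec_inj; rewrite vec_boundary2 unvecK e.
by exists (vec d); rewrite e vec_boundary2.
Qed.

Hypothesis ideal :
  (exists g1 g2, chi g1 - 1 <> 0 /\
     forall a, divides (chi g1 - 1) ((chi g2 - 1) * a) -> divides (chi g1 - 1) a) \/
  (exists g, chi g - 1 <> 0 /\ forall k, divides (chi g - 1) (chi k - 1)).

(** In the principal case, the coordinates of the image of a 1-cell sum to its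
    monodromy minus one, so [reduced_matrix] applies. *)
Lemma twisted_order_minors l k (A : 'M[R]_(l, k)) d :
  presents (fun c : chains R 1 (triangle V) => twisted_boundary1 rho p c = 0)
    (fun c => exists d, c = twisted_boundary2 rho p x d) A ->
  divides_minors B^T d <-> divides_minors A d.
Proof.
case/presents_twisted_homology => Z hA.
have mE : m = (#|tet V| + #|{: edge V}|)%N by rewrite card_triangle card_edge.
have DB : D *m B = 0 by exact: (step_cell_matrix chiM chi1 (weight := weight)).
have vertexE (t : tet V) : vertex R t = delta_mx (enum_rank t) 0.
  by apply/colP => i; rewrite !mxE andbT (can2_eq (@enum_valK _) (@enum_rankK _)).
have loopD g : exists S, D *m S = (chi g - 1)%:M.
  suff [S ->] : exists S, (chi g - 1)%:M = D *m S by exists S.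
  apply: lift_columns => j; have [c hc] := loop_boundary p chiM chi1 g (enum_val j).
  exists c; rewrite hc vertexE enum_valK; apply/colP => i; rewrite !mxE andbT.
  by rewrite mulr_natr.
case: ideal => [[g1 [g2 [y10 reg]]]|[g [y0 hg]]].
  have [S1 e1] := loopD g1; have [S2 e2] := loopD g2.
  exact: (minors_of_depth_two dom mE DB d hA e1 e2 y10 reg).
have [q hq] : exists q : 'I_m -> R, forall j, monodromy p chi (val (enum_val j)) - 1 = (chi g - 1) * q j.
  have h (j : 'I_m) : exists c, monodromy p chi (val (enum_val j : triangle V)) - 1 = (chi g - 1) * c.
    by have [c hc] := hg (lift_monodromy p (val (enum_val j))); exists c; rewrite mulrC.
  by have [q hq] := fin_all_exists h; exists q.
have sumD j : \sum_i D i j = (chi g - 1) * q j.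
  under eq_bigr => i _ do rewrite mxE /step_coef.
  have pick_vertex (u : tet V) (z : R) :
      \sum_(i < #|tet V|) (if u == enum_val i then z else 0) = z.
    rewrite (bigD1 (enum_rank u)) //= enum_rankK eqxx big1 ?addr0 // => i hi.
    by case: eqP => // e; case/eqP: hi; rewrite e enum_valK.
  by rewrite -hq sumrB !pick_vertex.
pose D' := reduced_matrix (enum_rank t0) D q.
have [S hS] : exists S, D' *m S = 1%:M.
  apply: (reduced_split dom y0 sumD) => [i|].
    have [c hc] := path_boundary p chiM chi1 t0 (enum_val i); exists c.
    by rewrite hc !vertexE enum_valK.
  have [c hc] := loop_boundary p chiM chi1 g t0; exists c.
  by rewrite hc vertexE.
have eq0 u (C : 'M_(_, u)) : D' *m C = 0 <-> D *m C = 0 by apply: (reduced_eq0 dom _ y0 sumD).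
have D'B : D' *m B = 0 by apply/eq0.
have hA' : presents_homology D' B Z A.
  case: hA => DZ gen rel; split=> //; first exact/eq0.
  by move=> c /eq0/gen.
exact: (minors_of_split mE D'B d hA' hS).
Qed.

End Order.

(** * Comparison of the taut matrix with the twisted boundary *)

Section Adjust.
Variables (V : transverse_taut) (t0 : tet V).
Variable ort : tet V -> tet_orientation.
Hypothesis ortP : forall t, transverse_orientation t (ort t).
Variable p : tet_lifts t0.

Lemma path_twist_rev (w : seq (face V)) : path_twist ort (rev_walk w) = path_twist ort w.
Proof.
elim: w => // s w IH; rewrite /rev_walk /= rev_cons -cats1 path_twist_cat -/(rev_walk w) IH.
by rewrite /= twist_opposite // addbF addbC.
Qed.

(** Transporting the orientation of the base tetrahedron along the chosen paths
    makes the twist of a face equal to the sign of its lifted monodromy. *)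
Lemma adjusted_orientations : exists ort' : tet V -> tet_orientation,
  (forall t, transverse_orientation t (ort' t)) /\
  (forall s, edge_orientation (lift_monodromy p s) = (-1) ^+ twist ort' s).
Proof.
pose b t := path_twist ort (val (p t)).
exists (fun t => reorient (b t) (ort t)); split=> [t|s]; first exact: transverse_reorient.
have ortP' t := transverse_reorient ortP t (b t).
rewrite (edge_orientation_loop ortP) !path_twist_cat path_twist_rev.
congr (_ ^+ nat_of_bool _); rewrite [path_twist _ (val (path_step s))]addbF.
have [x [y [xs ys xy]]] := two_others s.2.
have oe t : orients_edges (ort t) by case: (ortP t).
have := twistE (ort := fun t => reorient (b t) (ort t)) ortP' xy xs ys.
rewrite !reorientE ?(inj_eq perm_inj) // twistE // -/(b _).
rewrite -[path_twist _ _]/(b (opposite s).1).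
by move: (b s.1) (b (opposite s).1) (ort s.1 _) (twist ort s)
  (twist (fun t => reorient (b t) (ort t)) s) => [] [] [] [] [].
Qed.

End Adjust.

Section FaceSign.
Variable V : transverse_taut.
Variable ort : tet V -> tet_orientation.
Hypothesis ortP : forall t, transverse_orientation t (ort t).

Definition large_edge (y : flag V) i : bool := (flag_edge y).2 == upper_large_edge y.1 i.

(** The orientation of the edge [q o0, q o1] by the transverse orientation,
    compared with the boundary orientation of the face recorded by the parity
    of [q], gives one sign for the large edge and the opposite sign for the two
    others. *)
Lemma face_sign (t : tet V) (i : 'I_4) : exists c : bool, forall q : 'S_4,
  (q o3 = i -> edge_sign ort (t, q) (+) odd_perm q (+) ~~ large_edge (t, q) i = c) /\
  (q o2 = i -> edge_sign ort (t, q) (+) odd_perm q (+) ~~ large_edge (t, q) i = ~~ c).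
Proof.
suff [c hc] : exists c : bool, forall q : 'S_4,
    q o3 = i -> edge_sign ort (t, q) (+) odd_perm q (+) ~~ large_edge (t, q) i = c.
  exists c => q; split=> [|q2]; first exact: hc.
  have := hc (tperm o2 o3 * q)%g; rewrite /edge_sign /large_edge /flag_edge /= odd_permM odd_tperm !permM.
  rewrite tpermR !tpermD //= => /(_ q2) <-.
  by case: (ort _ _) (odd_perm _) (_ == _) => [] [] [].
have /eqP/cards2P[x [y [xy eL]]] := card_upper_large_edge (t, i).
have := notin_upper_large_edge (t, i); rewrite eL !inE negb_or => /andP[ix iy].
have [z u] := third_vertex ix iy xy.
have [|p [p0 p1 p2 p3]] := @perm4 x y z i.
  by rewrite -[[:: x; y; z; i]]/(rot 1 [:: i; x; y; z]) rot_uniq.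
have [oe oc] := ortP t; have [xz zy] := oc i x y z u eL.
exists (ort t (x, y) (+) odd_perm p) => q q3.
have [s [-> s3]] : exists s : 'S_4, q = (s * p)%g /\ s o3 = o3.
  by exists (q * p^-1)%g; rewrite mulgKV permM q3 -p3 permK.
rewrite odd_permM /edge_sign /large_edge /flag_edge /= !permM {q q3}.
have us : uniq (map s [:: o0; o1; o2; o3]) by rewrite (map_inj_uniq perm_inj).
rewrite /= in eL xz zy; rewrite eL -p0 -p1.
have nl a b : (a == o2) || (b == o2) -> ([set p a; p b] == [set p o0; p o1]) = false.
  move=> ab; apply/eqP => /setP/(_ (p o2)).
  by rewrite !inE !(inj_eq perm_inj) /= ![o2 == _]eq_sym ab.
have oyx : ort t (p o1, p o0) = ~~ ort t (p o0, p o1) by rewrite oe (inj_eq perm_inj).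
have ozx : ort t (p o2, p o0) = ~~ ort t (p o0, p o1).
  by rewrite oe (inj_eq perm_inj) /= p0 p1 p2 xz.
have oyz : ort t (p o1, p o2) = ~~ ort t (p o0, p o1).
  by rewrite oe (inj_eq perm_inj) /= p0 p1 p2 zy.
rewrite -p0 -p1 -p2 in xz zy.
have solve (s' : 'S_4) : s =1 s' -> odd_perm s = odd_perm s' by move/permP->.
(* [s] is one of the six permutations of the vertices of the face. *)
case: (ord4_cases (s o0)) => s0; rewrite /= ?s0 ?s3 //= in us;
  case: (ord4_cases (s o1)) => s1; rewrite /= ?s1 //= in us;
  case: (ord4_cases (s o2)) => s2; rewrite /= ?s2 //= {us} in us;
  rewrite s0 s1.
- rewrite (solve 1%g) ?odd_perm1 ?eqxx ?addbF //; first by elim/ord4_ind; rewrite perm1.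
- rewrite (solve (tperm o1 o2)) ?odd_tperm ?nl //=.
    by rewrite xz; case: (ort _ _) (odd_perm _) => [] [].
  by elim/ord4_ind; rewrite ?s0 ?s1 ?s2 ?s3 ?tpermL ?tpermR ?tpermD.
- rewrite (solve (tperm o0 o1)) ?odd_tperm //= ?[[set p o1; p o0]]setUC ?eqxx ?oyx /=.
    by case: (ort _ _) (odd_perm _) => [] [].
  by elim/ord4_ind; rewrite ?s0 ?s1 ?s2 ?s3 ?tpermL ?tpermR ?tpermD.
- rewrite (solve (tperm o0 o2 * tperm o1 o2)%g) ?odd_permM ?odd_tperm ?nl //= ?oyz.
    by case: (ort _ _) (odd_perm _) => [] [].
  have t1 : tperm o0 o2 o1 = o1 by rewrite tpermD.
  have t0 : tperm o1 o2 o0 = o0 by rewrite tpermD.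
  by elim/ord4_ind; rewrite permM ?s0 ?s1 ?s2 ?s3 ?(t1, t0, tpermL, tpermR) // !tpermD.
- rewrite (solve (tperm o0 o1 * tperm o1 o2)%g) ?odd_permM ?odd_tperm ?nl //= ?ozx.
    by case: (ort _ _) (odd_perm _) => [] [].
  have t1 : tperm o0 o1 o2 = o2 by rewrite tpermD.
  have t0 : tperm o1 o2 o0 = o0 by rewrite tpermD.
  by elim/ord4_ind; rewrite permM ?s0 ?s1 ?s2 ?s3 ?(t1, t0, tpermL, tpermR) // !tpermD.
rewrite (solve (tperm o0 o2)) ?odd_tperm ?nl //= ?zy.
  by case: (ort _ _) (odd_perm _) => [] [].
by elim/ord4_ind; rewrite ?s0 ?s1 ?s2 ?s3 ?tpermL ?tpermR ?tpermD.
Qed.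

End FaceSign.

Lemma sign_mulA (R : comNzRingType) (a b : bool) (u v : R) :
  (-1) ^+ b * (u * v) = u * (-1) ^+ a * ((-1) ^+ (a (+) b) * v).
Proof.
by rewrite -mulrA [(-1) ^+ a * _]mulrA -signr_addb addbA addbb addFb mulrCA.
Qed.

Lemma sign_mul_unit (R : comNzRingType) (a : bool) (u v : R) :
  u * v = 1 -> (-1) ^+ a * u * ((-1) ^+ a * v) = 1.
Proof. by move=> uv; rewrite mulrACA -signr_addb addbb uv mulr1. Qed.

Lemma unit_mul (R : comNzRingType) (a b a' b' : R) :
  a * a' = 1 -> b * b' = 1 -> a * b * (a' * b') = 1.
Proof. by move=> ea eb; rewrite mulrACA ea eb mulr1. Qed.

Lemma scaled_coefficient (R : comNzRingType) (a b : bool) (g m z w s : R) :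
  m * (z * w) = (-1) ^+ (a (+) b) * s -> g * s = (-1) ^+ b * w * (g * ((-1) ^+ a * m)) * z.
Proof.
move=> e; have -> : s = (-1) ^+ (a (+) b) * (m * (z * w)).
  by rewrite e mulrA -signr_addb addbb mul1r.
by rewrite signr_addb; ring.
Qed.

Section Weights.
Variables (V : transverse_taut) (t0 : tet V).
Variable ort : tet V -> tet_orientation.
Hypothesis ortP : forall t, transverse_orientation t (ort t).
Variable p : tet_lifts t0.
Hypothesis ort_lift : forall s, edge_orientation (lift_monodromy p s) = (-1) ^+ twist ort s.
Variable l : fab_tet V -> {set 'I_4} -> HM V.
Hypothesis lP : is_edge_labelling p l.
Local Notation R := (group_ring (HM V)).
Local Notation turn := (@turn V).

(** The sign and the translation that compare the lift of an edge seen from a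
    flag with the lift used to label it. *)
Definition weight (y : flag V) : R :=
  (-1) ^+ edge_sign ort y * gr_elt (l (0, y.1) (flag_edge y).2).

Lemma label_translate h t (A : {set 'I_4}) : #|A| = 2 -> l (h, t) A = h + l (0, t) A.
Proof. by move=> A2; have := lP.1 h (0, t) A A2; rewrite /= addr0. Qed.

Lemma weight_turn y : weight y = monodromy p (@twisting V t0) (flag_step y) * weight (turn y).
Proof.
have e2 := flag_edge_card y.
have ni : (flag_step y).2 \notin (flag_edge y).2 by rewrite !inE !(inj_eq perm_inj).
have eA : [set gluing y.1 (flag_step y).2 a | a in (flag_edge y).2] = (flag_edge (turn y)).2.
  by rewrite /flag_edge turn_o0 turn_o1 /= imsetU1 imset_set1.
have e1 : l (0, y.1) (flag_edge y).2 =
    hurewicz (lift_monodromy p (flag_step y)) + l (0, (turn y).1) (flag_edge (turn y)).2.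
  rewrite -label_translate ?flag_edge_card // -(lP.2 (0, y.1) (flag_step y).2 _ e2 ni) eA.
  congr (l (_, _) _); exact: add0r.
rewrite /weight /monodromy /twisting ort_lift (edge_sign_turn ortP) e1 gr_eltD.
rewrite rmorph_sign; exact: sign_mulA.
Qed.

Lemma weight_unit y : exists w, weight y * w = 1.
Proof. by eexists; apply: sign_mul_unit; apply: gr_eltNK. Qed.

End Weights.

Section FaceSum.
Variable V : transverse_taut.
Variable ort : tet V -> tet_orientation.
Hypothesis ortP : forall t, transverse_orientation t (ort t).
Variables (R : comNzRingType) (weight : flag V -> R) (lab : tet V -> {set 'I_4} -> R).
Hypothesis weightE : forall y, weight y = (-1) ^+ edge_sign ort y * lab y.1 (flag_edge y).2.

Definition large_sign (t : tet V) i A : R := if A == upper_large_edge t i then 1 else -1.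

Lemma large_signE t i A : large_sign t i A = (-1) ^+ (A != upper_large_edge t i).
Proof. by rewrite /large_sign; case: eqP; rewrite ?expr0 ?expr1. Qed.

Lemma notin_flag_edge (y : flag V) i : (i \notin (flag_edge y).2) = (i == y.2 o2) || (i == y.2 o3).
Proof.
rewrite -(permKV y.2 i) !inE !(inj_eq perm_inj).
by elim/ord4_ind: (_ i).
Qed.

(** The walk around the edge meets each local edge of its class exactly once,
    so the sum over the walk is a sum over the edges of the triangle that lie
    in the class, with the signs given by [face_sign]. *)
Lemma sum_face_coef (f : triangle V) : exists c : bool, forall (e : edge V) (x : flag V),
  flag_edge x \in val e ->
  \sum_(y | fconnect (@turn V) x y) face_coef weight f y =
  (-1) ^+ (c (+) odd_perm x.2) *
  \sum_(A : {set 'I_4} | [&& #|A| == 2, (val f).2 \notin A & (above f, A) \in val e])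
     large_sign (above f) (val f).2 A * lab (above f) A.
Proof.
have [c hc] := face_sign ortP (above f) (val f).2; exists c => e x ex.
pose F (A : {set 'I_4}) := (-1) ^+ (c (+) odd_perm x.2) *
  (large_sign (above f) (val f).2 A * lab (above f) A).
have aux3 (a b z b' : bool) : a (+) b (+) z = b' -> a = b' (+) b (+) z.
  by case: a b z b' => [] [] [] [].
have aux2 (a b z b' : bool) : a (+) b (+) z = ~~ b' -> ~~ a = b' (+) b (+) z.
  by case: a b z b' => [] [] [] [].
have coefE y : fconnect (@turn V) x y -> face_coef weight f y =
    if (y.1 == above f) && ((val f).2 \notin (flag_edge y).2) then F (flag_edge y).2 else 0.
  move=> /odd_orbit oy; rewrite /face_coef notin_flag_edge -!pair_eqE /= -/(above f).
  rewrite [above f == _]eq_sym; case: eqP => [yt|_] /=; last by rewrite subr0.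
  case: y yt oy => t q /= -> oq; have [h3 h2] := hc q.
  have [e2|n2] := eqVneq (val f).2 (q o2).
    have -> : ((val f).2 == q o3) = false by rewrite e2 (inj_eq perm_inj).
    rewrite sub0r weightE /F large_signE /= mulrA -signr_addb -mulNr -signrN; congr (_ ^+ nat_of_bool _ * _).
    have := h2 (esym e2); rewrite /large_edge /= oq; exact: aux2.
  case: eqP => [e3|_] /=; last by rewrite subr0.
  rewrite subr0 weightE /F large_signE /= mulrA -signr_addb; congr (_ ^+ nat_of_bool _ * _).
  have := h3 (esym e3); rewrite /large_edge /= oq; exact: aux3.
have inE' y : fconnect (@turn V) x y -> flag_edge y \in val e.
  move=> cy; rewrite (edge_val_class ex) inE; move/iter_findex: cy => <-.
  elim: (findex _ _ _) => [|n IH]; first exact: connect0.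
  by apply: connect_trans IH (connect1 _); rewrite iterS; exact: flag_edge_turn.
rewrite (eq_bigr _ coefE) -big_mkcondr mulr_sumr /=.
rewrite (partition_big (fun y : flag V => (flag_edge y).2)
  (fun A => [&& #|A| == 2, (val f).2 \notin A & (above f, A) \in val e])) /=.
  apply: eq_bigr => A /and3P[A2 fA eA].
  have [y0 c0 e0] : exists2 y, fconnect (@turn V) x y & flag_edge y = (above f, A).
    by apply: orbit_edge_surj; move: eA; rewrite (edge_val_class ex) inE.
  rewrite (big_pred1 y0) => [|y]; first by rewrite -[[set y0.2 o0; _]]/((flag_edge y0).2) e0.
  apply/idP/eqP => [/andP[/and3P[cy /eqP yt _] /eqP yA]|->].
    apply/esym/orbit_edge_inj; last by rewrite e0 -yA -yt.
    by apply: connect_trans cy; rewrite (fconnect_sym (@turn_inj V)).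
  have e1 : y0.1 = above f := congr1 fst e0.
  have eA' : (flag_edge y0).2 = A := congr1 snd e0.
  apply/andP; split; last exact/eqP.
  apply/and3P; split; [exact: c0 | exact/eqP | by rewrite -[[set y0.2 o0; _]]/((flag_edge y0).2) eA'].
move=> y /and3P[cy /eqP yt fy]; rewrite fy -yt flag_edge_card eqxx /=.
exact: inE'.
Qed.

End FaceSum.

Section ChangeOfLifts.
Variables (V : transverse_taut) (t0 : tet V).

Definition lift_shift (p p' : tet_lifts t0) (t : tet V) : HM V :=
  hurewicz (loop_class (path_cat (p' t) (path_rev (p t)))).

Lemma lift_shift_monodromy p p' s :
  hurewicz (lift_monodromy p' s) + lift_shift p p' (opposite s).1 =
  lift_shift p p' s.1 + hurewicz (lift_monodromy p s).
Proof.
rewrite /lift_shift !hurewicz_loop /loop_homology -!raddfD; congr (\pi _).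
apply: val_inj; rewrite /= !walk_chain_cat !walk_chain_rev.
move: (walk_chain (val (p s.1))) (walk_chain (val (p' s.1))) (walk_chain [:: s]).
move: (walk_chain (val (p (opposite s).1))) (walk_chain (val (p' (opposite s).1))) => a b c d e.
by rewrite subrKA !addrA subrK.
Qed.

(** Another choice of lifts translates the copies of each tetrahedron in the
    cover, which shifts the labels and leaves the matrix unchanged. *)
Lemma change_lifts (p p' : tet_lifts t0) (k : triangle V -> HM V) l : is_edge_labelling p l ->
  exists k' l', is_edge_labelling p' l' /\ taut_matrix k l = taut_matrix k' l'.
Proof.
move=> [l1 l2].
exists (fun f => k f - lift_shift p p' (above f)),
  (fun x A => l (x.1 + lift_shift p p' x.2, x.2) A); split; first split.
- move=> h [h' t] A A2 /=.
  by rewrite -addrA; exact: (l1 h (h' + lift_shift p p' t, t) A A2).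
- move=> [h t] i A A2 iA.
  rewrite -[RHS](l2 (h + lift_shift p p' t, t) i A A2 iA); congr (l (_, _) _).
  rewrite -[LHS]addrA -[RHS]addrA; congr (_ + _).
  exact: (lift_shift_monodromy p p' (t, i)).
apply/matrixP => i j; rewrite [LHS]mxE [RHS]mxE; apply: eq_bigr => A _.
set f : triangle V := enum_val j.
exact: (congr1 (fun h => (if A == upper_large_edge (above f) (val f).2 then 1 else -1) *
  gr_elt (l (h, above f) A)) (esym (subrK (lift_shift p p' (above f)) (k f)))).
Qed.

End ChangeOfLifts.

(** The coefficients of both matrices agree up to units attached to triangles
    and to edges, so their minors have the same common divisors. *)
Lemma taut_and_order_minors (V : transverse_taut) (t0 : tet V)
    (ort_exists : forall t : tet V, exists o, transverse_orientation t o)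
    (p : tet_lifts t0) (k : triangle V -> HM V) l (x : edge V -> flag V)
    a b (A : 'M[group_ring (HM V)]_(a, b)) d :
  is_edge_labelling p l -> (forall e, flag_edge (x e) \in val e) ->
  presents
    (fun c : chains (group_ring (HM V)) 1 (triangle V) => twisted_boundary1
       (tensor_hurewicz (fun g : pi1 t0 => (edge_orientation g)%:M : 'M[int]_1)) p c = 0)
    (fun c => exists d, c = twisted_boundary2
       (tensor_hurewicz (fun g : pi1 t0 => (edge_orientation g)%:M : 'M[int]_1)) p x d) A ->
  divides_minors (taut_matrix k l) d <-> divides_minors A d.
Proof.
move=> lP xP hA.
have [ort0 ort0P] := choice ort_exists.
have [ort [ortP ort_lift]] := adjusted_orientations ort0P p.
have rhoE : tensor_hurewicz (fun g : pi1 t0 => (edge_orientation g)%:M : 'M[int]_1) =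
    fun g => (twisting g)%:M.
  apply: funext => g; apply/matrixP => i j; rewrite (ord1 i) (ord1 j).
  by rewrite /tensor_hurewicz !mxE.
rewrite rhoE in hA.
have [I [lam [lamD sep]]] := HM_functionals V.
have dom : integral (group_ring (HM V)) := group_ring_integral lamD sep.
have ideal := twisted_augmentation_ideal ort0P p xP.
pose w := weight ort l.
have wt y : monodromy p (@twisting V t0) (flag_step y) * w (turn y) = w y.
  exact: esym (weight_turn ortP ort_lift lP y).
have wu y : exists u, w y * u = 1 by exact: weight_unit.
have chiM : forall g h : pi1 t0, twisting (g * h)%g = twisting g * twisting h := twistingM ort0P.
have chi1 : twisting (1%g : pi1 t0) = 1 := twisting1 t0 ort0P.
apply: iff_trans (twisted_order_minors dom chiM chi1 wt wu ideal d hA).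
have [c hc] := choice (sum_face_coef ortP (weight := w)
  (lab := fun t B => gr_elt (l (0, t) B)) (fun y => erefl)).
pose f (j : 'I_#|{: triangle V}|) : triangle V := enum_val j.
pose u (i : 'I_#|{: edge V}|) := (-1) ^+ odd_perm (x (enum_val i)).2 * w (x (enum_val i)).
pose v (j : 'I_#|{: triangle V}|) :=
  gr_elt (k (f j)) * ((-1) ^+ c (f j) * monodromy p (@twisting V t0) (val (f j))).
have uu i : exists a', u i * a' = 1.
  have [a' ha'] := wu (x (enum_val i)).
  exists ((-1) ^+ odd_perm (x (enum_val i)).2 * a'); exact: sign_mul_unit.
have vv j : exists a', v j * a' = 1.
  exists (gr_elt (- k (f j)) * ((-1) ^+ c (f j) *
    monodromy p (@twisting V t0) (opposite (val (f j))))).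
  apply: unit_mul; first exact: gr_eltNK.
  apply: sign_mul_unit; exact: monodromy_opposite chiM chi1 _.
have [u' hu] := choice uu; have [v' hv] := choice vv.
apply: (divides_minors_units d hu hv) => i j.
rewrite [LHS]mxE [X in _ = _ * X]mxE [X in _ = _ * X]mxE -/(f j).
transitivity (gr_elt (k (f j)) * \sum_(B : {set 'I_4} | [&& #|B| == 2,
    (val (f j)).2 \notin B & (above (f j), B) \in val (enum_val i : edge V)])
    large_sign (group_ring (HM V)) (above (f j)) (val (f j)).2 B * gr_elt (l (0, above (f j)) B)).
  rewrite mulr_sumr; apply: eq_bigr => B /and3P[/eqP B2 _ _].
  rewrite (label_translate lP _ _ B2) gr_eltD; exact: mulrCA.
apply: scaled_coefficient.
rewrite -(hc (f j) (enum_val i) (x (enum_val i)) (xP _)).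
exact: (cell_coef_face chiM chi1 wt).
Qed.

Theorem theorem5p7 (V : veering) (V_connected : connected V) (t0 : tet V)
    (Theta Delta : group_ring (HM V)) :
  is_taut_polynomial t0 Theta ->
  is_twisted_alexander_polynomial (fun g : pi1 t0 => (edge_orientation g)%:M : 'M[int]_1)
    Delta ->
  unit_eq Theta Delta.
Proof.
case=> p [k [l [lP gT]]] [p' [x [xP [a [b [A [hA gA]]]]]]].
have [k' [l' [lP' eT]]] := change_lifts p' k lP; rewrite eT in gT.
have [I [lam [lamD sep]]] := HM_functionals V.
apply: (gcd_unit_eq (group_ring_integral lamD sep) _ gT gA) => d.
exact: (taut_and_order_minors (@transverse_orientation_exists V) k' d lP' xP hA).
Qed.
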